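(* Let $F$ be a $p$-rigid field, and let $k$, $\zeta_{p^l}$ and $\{a_i\}_{i\in\mathcal I}$ be as in the context. Then for every $n\ge1$ the $\mathbb F_p$-vector space $\dot{F^{(n)}}/(\dot{F^{(n)}})^p$ is spanned by the classes $[\zeta_{p^{k+n-1}}]_{F^{(n)}}$ and $[a_i^{1/p^{n-1}}]_{F^{(n)}}$, $i\in\mathcal I$ (the class of $\zeta_{p^{k+n-1}}$ being omitted when $k=\infty$), where $a_i^{1/p^{n-1}}$ denotes any fixed $p^{n-1}$th root of $a_i$.
   Context: $p$ is an odd prime and $F$ a field containing a primitive $p$th root of unity. For a field $L$, $\dot L=L\setminus\{0\}$, $\dot L^p$ the nonzero $p$th powers, $[x]_L=x\dot L^p$. An element $a\in\dot F\setminus\dot F^p$ is $p$-rigid if every element of $N_{F(\sqrt[p]{a})/F}(F(\sqrt[p]{a})^\times)$ lies in $\bigcup_{j=0}^{p-1}a^j\dot F^p$; $F$ is $p$-rigid if every element of $\dot F\setminus\dot F^p$ is $p$-rigid. All fields lie in a fixed separable closure; $F(p)$ is the maximal $p$-extension of $F$. Let $k\in\mathbb N\cup\{\infty\}$ be the largest $h$ such that $F$ contains all $p^h$th roots of unity ($k\ge1$). Fix primitive $p^l$th roots of unity $\zeta_{p^l}\in F(p)$, $l\ge1$, with $\zeta_{p^{l+1}}^p=\zeta_{p^l}$. If $k<\infty$, choose $a_i\in\dot F$ ($i\in\mathcal I$) such that $\{[\zeta_{p^k}]_F\}\cup\{[a_i]_F:i\in\mathcal I\}$ is an $\mathbb F_p$-basis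 of $\dot F/\dot F^p$; if $k=\infty$, choose $a_i$ such that $\{[a_i]_F\}$ is a basis. Set $F^{(1)}=F$, $F^{(2)}=F(\sqrt[p]{a}:a\in\dot F)$, and for $n\ge3$ let $F^{(n)}$ be the compositum of all extensions $F^{(n-1)}(\sqrt[p]{\gamma})$, $\gamma\in F^{(n-1)}\setminus\{0\}$, such that $F^{(n-1)}(\sqrt[p]{\gamma})/F$ is Galois. *)

(* Defs.v *)
From HB Require Import structures.
From mathcomp Require Import all_boot all_order all_algebra.
Set Implicit Arguments. Unset Strict Implicit. Unset Printing Implicit Defensive.
Import Order.TTheory GRing.Theory Num.Theory.
Local Open Scope ring_scope.

(* All fields are subfields of a fixed algebraically closed field [Om],
   represented as (Prop-valued) predicates on [Om]. *)
Section Defs.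
Variable Om : closedFieldType.

Definition is_subfield (K : Om -> Prop) : Prop :=
  [/\ K 0, K 1,
      (forall x y, K x -> K y -> K (x - y) /\ K (x * y))
    & (forall x, K x -> K x^-1)].

Definition gen (S : Om -> Prop) : Om -> Prop :=
  fun x => forall K, is_subfield K -> (forall y, S y -> K y) -> K x.

(* L/F is Galois (algebraic, normal, separable): every x in L is a root of a
   separable polynomial with coefficients in F that splits over L. *)
Definition galois_over (L F : Om -> Prop) : Prop :=
  forall x, L x -> exists s : seq Om,
    [/\ (forall r, r \in s -> L r), uniq s, x \in s
      & forall i, F (\prod_(r <- s) ('X - r%:P))`_i].

(* N_{F(alpha)/F}(F(alpha)^x) for alpha^p = a, a in F not a p-th power,
   F containing the p-th roots of unity: the norm of f(alpha) is the
   product of its conjugates f(z^j alpha), z a primitive p-th root of 1. *)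
Definition norm_group (p : nat) (F : Om -> Prop) (a : Om) : Om -> Prop :=
  fun y => exists (alpha z : Om) (f : {poly Om}),
    [/\ alpha ^+ p = a, p.-primitive_root z, (forall i, F f`_i),
        f.[alpha] != 0 & y = \prod_(j < p) f.[z ^+ j * alpha]].

Definition p_rigid_elt (p : nat) (F : Om -> Prop) (a : Om) : Prop :=
  forall y, norm_group p F a y ->
    exists j : nat, exists c : Om, [/\ (j < p)%N, F c, c != 0 & y = a ^+ j * c ^+ p].

Definition p_rigid_field (p : nat) (F : Om -> Prop) : Prop :=
  forall a, F a -> a != 0 -> ~ (exists c, F c /\ a = c ^+ p) -> p_rigid_elt p F a.

Definition has_roots (p : nat) (F : Om -> Prop) (h : nat) : Prop :=
  forall x : Om, x ^+ (p ^ h) = 1 -> F x.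

Definition is_k (p : nat) (F : Om -> Prop) (k : option nat) : Prop :=
  match k with
  | Some h => has_roots p F h /\ ~ has_roots p F h.+1
  | None => forall h, has_roots p F h
  end.

(* The classes [z] (if z is Some _) and [g i], i in I, span Kdot/Kdot^p
   (all these elements being nonzero elements of K). *)
Definition pspans (p : nat) (K : Om -> Prop) (z : option Om) (I : eqType)
    (g : I -> Om) : Prop :=
  [/\ (forall w, z = Some w -> K w /\ w != 0),
      (forall i, K (g i) /\ g i != 0)
    & forall x, K x -> x != 0 ->
      exists (e0 : nat) (s : seq I) (e : I -> nat) (y : Om),
        [/\ K y, y != 0 &
          x = oapp (fun w => w ^+ e0) 1 z * \prod_(i <- s) g i ^+ e i * y ^+ p]].

Definition pindep (p : nat) (K : Om -> Prop) (z : option Om) (I : eqType)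
    (g : I -> Om) : Prop :=
  forall (e0 : nat) (s : seq I) (e : I -> nat),
    uniq s ->
    (exists y, [/\ K y, y != 0 &
        oapp (fun w => w ^+ e0) 1 z * \prod_(i <- s) g i ^+ e i = y ^+ p]) ->
    (z != None -> (p %| e0)%N) /\ (forall i, i \in s -> (p %| e i)%N).

Definition pbasis p K z (I : eqType) (g : I -> Om) : Prop :=
  pspans p K z g /\ pindep p K z g.

Definition F2 (p : nat) (F : Om -> Prop) : Om -> Prop :=
  gen (fun x => F x \/ F (x ^+ p)).

Definition Fstep (p : nat) (F L : Om -> Prop) : Om -> Prop :=
  gen (fun x => L x \/
        [/\ L (x ^+ p), x != 0 & galois_over (gen (fun y => L y \/ y = x)) F]).

Definition Fn (p : nat) (F : Om -> Prop) (n : nat) : Om -> Prop :=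
  if (n <= 1)%N then F else iter (n - 2) (Fstep p F) (F2 p F).

End Defs.

(* Main.v *)
Require Import Defs.
From HB Require Import structures.
From mathcomp Require Import all_boot all_order all_algebra.
From mathcomp Require Import boolp ring zify.
Import GRing.Theory.
Local Open Scope ring_scope.
Set Implicit Arguments. Unset Strict Implicit. Unset Printing Implicit Defensive.

(** Write T for the nonzero p-th powers of the field at hand. Everything rests on one step: if K is
    rigid and contains the p-th roots of unity, and al is a p-th root of a in K outside T, then (i)
    K(al) is rigid, and (ii) every nonzero element of K(al) is [al ^+ j * c * y ^+ p] with c in K
    ([rigid_adj]). Adjoining finitely many roots and passing to the union, [F2 p K] is rigid and
    each of its classes contains some w with w^p in K ([F2_rigid], [F2_class]). If K is spanned by
    classes g_i, such a w is a product of p-th roots of the g_i, up to a p-th root of unity and an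
    element of K, which both become p-th powers in [F2 p K]; so the roots of the g_i span
    ([F2_spans]). The theorem follows by induction once each layer is [F2] of the previous one. By
    the spanning statement, the roots to be adjoined to the n-th layer L are generated over L by
    elements y with y^(p^n) in F, and each L(y) is Galois over F ([galois_radical]).

    For (i) and (ii), rigidity is traded for a valuation. As [p] is odd, 1 + a is the norm of 1 +
    al, so rigidity gives 1 + x in x^i T for every x outside T. The elements for which i is neither
    0 nor 1 all lie in one subgroup generated by some x0 and T ([irregular_dependent]). Outside that
    subgroup 1 + x is in T or in x T, which separates positive from negative value, and the
    classical construction from rigid elements gives a valuation ring O with maximal ideal m such
    that 1 + m lies in T and the unit classes are powers of one class ([rigid_has_valuation_ring],
    [rigid_valued]).

    Such a valuation extends to K(al). After a change of generator, either the value of a is not p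
    times a value, or a is a unit. In both cases each element is a monomial times a controlled unit
    ([decomp]), so all norms have the form a^j c^p ([rigid_norm]); this shows that a valued field is
    rigid ([valued_rigid]). Hilbert 90, with the congruence between (sg - 1)^(p-1) and the norm
    element modulo p, turns this into (ii) ([radical_classP]). In turn (ii) shows that the extended
    valuation has the same two properties ([valued_extension]), which is (i). *)

(** * Units of R[al] for al a p-th root over a local ring R *)

Section MonogenicRing.

Variables (A : fieldType) (R : subringClosed A).

Lemma monic_division (g : {poly A}) : g \is monic -> g \is a polyOver R ->
  forall f, f \is a polyOver R -> exists q r,
    [/\ q \is a polyOver R, r \is a polyOver R, (size r < size g)%N & f = q * g + r].
Proof.
move=> gm gR f; have [n] := ubnP (size f); elim: n f => // n IH f /ltnSE sf fR.
have [lt|le] := ltnP (size f) (size g).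
  by exists 0, f; rewrite rpred0 mul0r add0r.
have g0 : (0 < size g)%N by rewrite size_poly_gt0 monic_neq0.
have sf0 : (0 < size f)%N by lia.
pose h : {poly A} := f - (lead_coef f)%:P * 'X^(size f - size g) * g.
have cR : (lead_coef f)%:P * 'X^(size f - size g) \is a polyOver R.
  by rewrite rpredM ?polyOverC ?rpredX ?polyOverX //; apply: (polyOverP fR).
have hR : h \is a polyOver R by rewrite rpredB // rpredM.
have sh : (size h < size f)%N.
  have le1 : (size h <= size f)%N.
    rewrite (leq_trans (size_polyD _ _)) // size_polyN geq_max leqnn /=.
    rewrite -mulrA mul_polyC (leq_trans (size_scale_leq _ _)) //.
    by rewrite mulrC size_mulXn ?monic_neq0 // subnK.
  rewrite -(prednK sf0) ltnS; apply/leq_sizeP => j hj.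
  have [->|nj] := eqVneq j (size f).-1; last first.
    by apply: nth_default; apply: leq_trans le1 _; lia.
  rewrite /h coefB -mulrA mul_polyC coefZ coefXnM ifF; last by lia.
  rewrite (_ : (_ - _)%N = (size g).-1); last by lia.
  by rewrite -!lead_coefE (monicP gm) mulr1 subrr.
have [q [r [qR rR sr e]]] := IH h (leq_trans sh sf) hR.
exists (q + (lead_coef f)%:P * 'X^(size f - size g)), r; split => //.
  by rewrite rpredD.
by rewrite mulrDl addrAC -e subrK.
Qed.

Variable J : zmodClosed A.
Hypothesis JR : {subset J <= R}.
Hypothesis RJ : forall x y, x \in R -> y \in J -> x * y \in J.

Lemma prod_congr (I : Type) (s : seq I) (u v : I -> A) :
  (forall i, u i \in R) -> (forall i, v i \in R) ->
  (forall i, u i - v i \in J) ->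
  \prod_(i <- s) u i - \prod_(i <- s) v i \in J.
Proof.
move=> uR vR uv; elim: s => [|i s IH]; first by rewrite !big_nil subrr rpred0.
rewrite !big_cons; have -> : u i * \prod_(j <- s) u j - v i * \prod_(j <- s) v j =
  u i * (\prod_(j <- s) u j - \prod_(j <- s) v j) + (\prod_(j <- s) v j) * (u i - v i).
  by ring.
by rewrite rpredD // RJ // rpred_prod.
Qed.

Lemma det_congr n (M N : 'M[A]_n) :
  (forall i j, M i j \in R) -> (forall i j, N i j \in R) ->
  (forall i j, M i j - N i j \in J) -> \det M - \det N \in J.
Proof.
move=> MR NR MN; rewrite /determinant -sumrB rpred_sum // => s _.
by rewrite -mulrBr RJ ?rpredX ?rpredN1 // prod_congr.
Qed.

Lemma polyOver_eval (S : zmodClosed A) (SR : forall x y, x \in R -> y \in S -> x * y \in S)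
   x (f : {poly A}) : x \in R -> f \is a polyOver S -> f.[x] \in S.
Proof.
move=> xR /polyOverP fS; rewrite horner_coef rpred_sum // => i _.
by rewrite mulrC SR // rpredX.
Qed.

Variable (p : nat) (a : A).
Hypothesis p_pr : prime p.
Hypothesis unitR : forall x, x \in R -> x \notin J -> x^-1 \in R.
Hypothesis aR : a \in R.
Hypothesis irr : forall e, e \in R -> e ^+ p - a \notin J.

(* The constant term of a monic factor of [X^p - a] modulo [J] is, up to sign,
   the determinant of its companion matrix [C], and [C ^+ p] is congruent to
   the scalar [a]. *)
Lemma irred_mod (g q r : {poly A}) : g \is monic -> g \is a polyOver R ->
  (1 < size g <= p)%N -> q \is a polyOver R -> r \is a polyOver J ->
  'X^p - a%:P = q * g + r -> False.
Proof.
move=> gm gR sg qR rJ e.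
pose C := companionmx g; pose d := (size g).-1.
have sC : char_poly C = g by apply: companionmxK.
have CR i j : C i j \in R.
  rewrite !mxE; case: ifP => _; first by rewrite rpredN; apply: (polyOverP gR).
  by rewrite rpred_nat.
have [d' dE] : exists d', d = d'.+1 by exists d.-1; rewrite /d; lia.
have : d = d by [].
rewrite {1}/d => dd; rewrite -/d in C sC CR; clearbody C.
move: d dE C sC CR dd => _ -> C sC CR dd.
have hC : horner_mx C g = 0 by rewrite -sC Cayley_Hamilton.
have pow (M : 'M[A]_d'.+1) i j n : (forall i j, M i j \in R) -> (M ^+ n) i j \in R.
  move=> MR; elim: n i j => [|n IH] i j; first by rewrite expr0 mxE rpred_nat.
  by rewrite exprS mxE rpred_sum // => k _; rewrite rpredM.
have CP : C ^+ p - a%:M = horner_mx C r.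
  have := congr1 (horner_mx C) e.
  by rewrite rmorphB /= rmorphXn /= horner_mx_X horner_mx_C rmorphD rmorphM /= hC mulr0 add0r.
have rC i j : (horner_mx C r) i j \in J.
  rewrite -[r]coefK poly_def raddf_sum /= summxE rpred_sum // => k _.
  by rewrite linearZ /= rmorphXn /= horner_mx_X mxE mulrC RJ ?(polyOverP rJ) // pow.
have dJ : (\det C) ^+ p - a ^+ d'.+1 \in J.
  have detX n : \det (C ^+ n) = \det C ^+ n.
    by elim: n => [|n IH]; rewrite ?det1 // !exprS det_mulmx IH.
  rewrite -(det_scalar d'.+1 a) -detX det_congr // => [i j|i j|i j].
  - exact: pow.
  - by rewrite mxE; case: (i == j) => //=; rewrite ?mulr1n ?mulr0n ?rpred0.
  by have := rC i j; rewrite -CP !mxE.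
have dR : \det C \in R.
  rewrite /determinant rpred_sum // => s _.
  by rewrite rpredM ?rpredX ?rpredN1 // rpred_prod.
have aJ : a \notin J.
  apply/negP => aJ; have := irr (rpred0 R).
  by rewrite expr0n eqn0Ngt prime_gt0 //= sub0r rpredN aJ.
have a0 : a != 0 by apply: contraNneq aJ => ->; rewrite rpred0.
have aV := unitR aR aJ.
have cop : coprime d'.+1 p.
  rewrite coprime_sym prime_coprime //; apply/negP => /dvdn_leq; lia.
have [u [v uv]] : exists u v, (d'.+1 * u = 1 + p * v)%N.
  have := egcdnP p (ltn0Sn d'); case=> km kn E _.
  by exists km, kn; rewrite mulnC E (eqP cop) addnC mulnC.
(* The degree of [g] is prime to [p]; from [d u = 1 + p v] and [(det C)^p = a^d] modulo [J], the
   element [(det C)^u a^(-v)] is a p-th root of [a] modulo [J]. *)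
have := irr (rpredM (rpredX u dR) (rpredX v aV)).
rewrite -[X in X \notin _](_ : a^-1 ^+ (p * v) * ((\det C ^+ p) ^+ u - (a ^+ d'.+1) ^+ u) = _).
  have : (\det C ^+ p) ^+ u - (a ^+ d'.+1) ^+ u \in J.
    have [E|] := eqVneq u 0%N; first by move: uv; rewrite E; lia.
    rewrite subrXX => _; rewrite mulrC RJ // rpred_sum // => i _.
    by rewrite rpredM // ?rpredX.
  by move=> h; rewrite RJ // rpredX.
rewrite mulrBr -!exprM uv exprD expr1 mulrCA -exprMn mulVf // expr1n mulr1.
by rewrite exprMn -!exprM mulrC (mulnC u) (mulnC v).
Qed.

Variable al : A.
Hypothesis al_a : al ^+ p = a.

Definition evalOver (S : {pred A}) (x : A) : Prop :=
  exists2 f : {poly A}, f \is a polyOver S & x = f.[al].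

Hypothesis unit1 : forall y, evalOver J y -> 1 + y != 0 /\ evalOver R (1 + y)^-1.

Lemma evalOverM (S : zmodClosed A) (SR : forall x y, x \in R -> y \in S -> x * y \in S)
  x y : evalOver R x -> evalOver S y -> evalOver S (x * y).
Proof.
move=> [f fR ->] [g gS ->]; exists (f * g); last by rewrite hornerM.
apply/polyOverP => i; rewrite coefM rpred_sum // => j _.
by rewrite SR ?(polyOverP fR) ?(polyOverP gS).
Qed.

(** Euclidean descent on the degree. A leading coefficient in [J] is dropped, which changes the
    value by a factor in 1 + J[al]. Otherwise [f] is scaled to a monic [g], and dividing [X^p - a]
    by [g] gives [q(al) g(al) = - r(al)], where [r] is not zero modulo [J] by [irred_mod]. *)
Lemma primitive_unit (f : {poly A}) : f \is a polyOver R -> (size f <= p)%N ->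
  f \isn't a polyOver J -> f.[al] != 0 /\ evalOver R f.[al]^-1.
Proof.
have RR x y : x \in R -> y \in R -> x * y \in R by move=> *; rewrite rpredM.
have uu x y : x != 0 -> evalOver R x^-1 -> evalOver R y -> evalOver J (y - x) ->
    y != 0 /\ evalOver R y^-1.
  move=> x0 xV yR yx.
  have jJ : evalOver J (x^-1 * (y - x)) by apply: evalOverM.
  have [n0 nV] := unit1 jJ.
  have -> : y = x * (1 + x^-1 * (y - x)) by rewrite mulrBr mulVf // addrC subrK mulrA mulfV // mul1r.
  by rewrite mulf_neq0 // invfM; split => //; apply: evalOverM.
have [n] := ubnP (size f); elim: n f => // n IH f /ltnSE sf fR sp fJ.
have f0 : f != 0 by apply: contraNneq fJ => ->; rewrite rpred0.
have sf0 : (0 < size f)%N by rewrite size_poly_gt0.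
have [lJ|lJ] := boolP (lead_coef f \in J).
  pose h : {poly A} := f - (lead_coef f)%:P * 'X^((size f).-1).
  have mJ : (lead_coef f)%:P * 'X^((size f).-1) \is a polyOver J.
    apply/polyOverP => i; rewrite mul_polyC coefZ coefXn.
    by rewrite mulrC RJ ?rpred_nat.
  have mR : (lead_coef f)%:P * 'X^((size f).-1) \is a polyOver R.
    by apply/polyOverP => i; rewrite JR // (polyOverP mJ).
  have hR : h \is a polyOver R by rewrite rpredB.
  have sh : (size h < size f)%N.
    rewrite -(prednK sf0) ltnS; apply/leq_sizeP => j hj.
    rewrite /h coefB mul_polyC coefZ coefXn.
    have [->|nj] := eqVneq j (size f).-1; first by rewrite mulr1 lead_coefE subrr.
    by rewrite mulr0 subr0 nth_default // -(prednK sf0) ltn_neqAle eq_sym nj.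
  have hJ : h \isn't a polyOver J.
    by apply: contra fJ => hJ; rewrite -[f](subrK ((lead_coef f)%:P * 'X^((size f).-1))) rpredD.
  have [h0 hV] := IH h (leq_trans sh sf) hR (ltnW (leq_trans sh sp)) hJ.
  apply: (uu _ _ h0 hV); first by exists f.
  by exists ((lead_coef f)%:P * 'X^((size f).-1)) => //; rewrite /h hornerD hornerN opprB addrC subrK.
have lR : lead_coef f \in R by apply: (polyOverP fR).
have lV := unitR lR lJ; have l0 : lead_coef f != 0 by rewrite lead_coef_eq0.
pose g := (lead_coef f)^-1 *: f.
have gR : g \is a polyOver R by rewrite polyOverZ.
have sg : size g = size f by rewrite size_scale // invr_eq0.
have gm : g \is monic by rewrite monicE lead_coefZ mulVf.
suff [g0 gV] : g.[al] != 0 /\ evalOver R g.[al]^-1.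
  have -> : f = lead_coef f *: g by rewrite scalerA mulfV // scale1r.
  rewrite hornerZ mulf_neq0 // invfM; split => //; apply: evalOverM => //.
  by exists (lead_coef f)^-1%:P; rewrite ?polyOverC ?hornerC.
have [s1|s1] := leqP (size g) 1.
  have -> : g = 1.
    have := gm; rewrite monicE lead_coefE (_ : (size g).-1 = 0%N); last by lia.
    by rewrite (size1_polyC s1) coefC /= => /eqP ->.
  by rewrite hornerC invr1 oner_neq0; split => //; exists 1; rewrite ?rpred1 ?hornerC.
have XR : 'X^p - a%:P \is a polyOver R by rewrite rpredB ?polyOverC ?rpredX ?polyOverX.
have [q [r [qR rR sr e]]] := monic_division gm gR XR.
have [rJ|rJ] := boolP (r \is a polyOver J).
  by case: (irred_mod gm gR _ qR rJ e); rewrite s1 sg.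
have sr' : (size r < n)%N by rewrite (leq_trans sr) // sg.
have [r0 rV] := IH r sr' rR (leq_trans (ltnW (leq_trans sr (eq_leq sg))) sp) rJ.
have E : q.[al] * g.[al] = - r.[al].
  have := congr1 (horner^~ al) e.
  rewrite hornerD hornerN hornerXn hornerC al_a subrr hornerD hornerM => /esym/eqP.
  by rewrite addr_eq0 => /eqP.
have g0 : g.[al] != 0 by apply: contraNneq r0 => g0; rewrite -oppr_eq0 -E g0 mulr0.
split => //; have -> : g.[al]^-1 = (- q).[al] * r.[al]^-1.
  apply: (mulIf g0); rewrite mulVf // mulrAC hornerN mulNr E opprK mulfV //.
by apply: evalOverM => //; exists (- q); rewrite ?rpredN.
Qed.

End MonogenicRing.

(** * From rigidity to a valuation ring *)

Section RigidValuation.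

Variables (L : fieldType) (p : nat).
Hypotheses (p_pr : prime p) (p_odd : odd p).

Definition ppow (x : L) : Prop := x != 0 /\ exists c, x = c ^+ p.

Lemma ppowM x y : ppow x -> ppow y -> ppow (x * y).
Proof.
move=> [x0 [c xE]] [y0 [d yE]]; split; first by rewrite mulf_neq0.
by exists (c * d); rewrite xE yE exprMn.
Qed.

Lemma ppowV x : ppow x -> ppow x^-1.
Proof.
by move=> [x0 [c xE]]; split; [rewrite invr_eq0 | exists c^-1; rewrite xE exprVn].
Qed.

Lemma ppowXp x : x != 0 -> ppow (x ^+ p).
Proof. by move=> x0; split; [rewrite expf_neq0 | exists x]. Qed.

Lemma ppow1 : ppow 1.
Proof. by split; [rewrite oner_neq0 | exists 1; rewrite expr1n]. Qed.

Lemma ppowX x n : ppow x -> ppow (x ^+ n).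
Proof.
by move=> Tx; elim: n => [|n IH]; rewrite ?expr0 ?exprS; [apply: ppow1 | apply: ppowM].
Qed.

Lemma ppowN1 : ppow (-1).
Proof.
split; first by rewrite oppr_eq0 oner_neq0.
by exists (-1); rewrite -signr_odd p_odd expr1.
Qed.

Lemma ppow_neq0 x : ppow x -> x != 0. Proof. by case. Qed.

Lemma ppowP x y : ppow x -> ppow y -> x = y * (x / y).
Proof. by move=> _ [y0 _]; rewrite mulrC divfK. Qed.

Hypothesis rigid : forall x, x != 0 -> ~ ppow x -> exists i, ppow ((1 + x) / x ^+ i).

(** The exponent [i] that rigidity gives for [1 + x] is then neither 0 nor 1 modulo [p]. *)
Definition irregular x :=
  [/\ x != 0, ~ ppow x, ~ ppow (1 + x) & ~ ppow ((1 + x) / x)].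

(** * Two independent irregular classes are impossible *)

Section Independent.

Variable F : fieldType.
Hypotheses (natF : forall m : nat, (m%:R == 0 :> F) = (p %| m)%N)
  (F_nat : forall u : F, exists m : nat, u = m%:R).
Variables x y : L.
Hypotheses (x0 : x != 0) (y0 : y != 0).
Hypothesis indep : forall m n, ppow (x ^+ m * y ^+ n) -> (p %| m)%N /\ (p %| n)%N.

(** Coordinates of the class of [u] in the plane spanned by the classes of [x] and [y]. The
    exponents are read in [F], a copy of the prime field with [p] elements, so that they can be
    divided. *)
Let cls (u : L) (A B : F) : Prop :=
  exists m n : nat, [/\ A = m%:R, B = n%:R & ppow (u / (x ^+ m * y ^+ n))].

Let mon_neq0 m n : x ^+ m * y ^+ n != 0.
Proof. by rewrite mulf_neq0 ?expf_neq0. Qed.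

Let cls_neq0 u A B : cls u A B -> u != 0.
Proof.
case=> m [n [_ _ [h _]]]; apply: contraNneq h => ->; by rewrite mul0r.
Qed.

Let clsM u v A B C D : cls u A B -> cls v C D -> cls (u * v) (A + C) (B + D).
Proof.
move=> [m [n [-> -> h]]] [m' [n' [-> -> h']]]; exists (m + m')%N, (n + n')%N.
rewrite !natrD; split=> //; have := ppowM h h'.
by rewrite mulf_div !exprD [_ * y ^+ n * _]mulrACA.
Qed.

Let clsV u A B : cls u A B -> cls u^-1 (- A) (- B).
Proof.
move=> [m [n [-> -> h]]]; exists (p.-1 * m)%N, (p.-1 * n)%N.
have pm : p.-1%:R = -1 :> F.
  apply/eqP; rewrite -addr_eq0 -[X in _ + X]/(1%:R) -natrD addn1 natF.
  by rewrite prednK ?prime_gt0.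
rewrite !natrM pm !mulN1r; split => //.
have := ppowM (ppowV h) (ppowV (ppowXp (mon_neq0 m n))).
rewrite (_ : (x ^+ m * y ^+ n) ^+ p = (x ^+ m * y ^+ n) * (x ^+ m * y ^+ n) ^+ p.-1);
  last by rewrite -exprS prednK ?prime_gt0.
have -> : x ^+ (p.-1 * m) * y ^+ (p.-1 * n) = (x ^+ m * y ^+ n) ^+ p.-1.
  by rewrite exprMn -!exprM ![(p.-1 * _)%N]mulnC.
have M0 := mon_neq0 m n; have u0 : u != 0.
  by case: h => h _; apply: contraNneq h => ->; rewrite mul0r.
move: M0 (expf_neq0 p.-1 M0); set M := _ * _; set N := M ^+ _ => M0 N0.
by congr ppow; field; rewrite u0 M0 N0.
Qed.

Let cls1 : cls 1 0 0.
Proof. by exists 0%N, 0%N; split=> //; rewrite !expr0 mulr1 divr1; apply: ppow1. Qed.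

Let clsx : cls x 1 0.
Proof.
exists 1%N, 0%N; split => //; rewrite expr0 mulr1 expr1 mulfV //; exact: ppow1.
Qed.

Let clsy : cls y 0 1.
Proof.
exists 0%N, 1%N; split => //; rewrite expr0 mul1r expr1 mulfV //; exact: ppow1.
Qed.

Let clsX u A B n : cls u A B -> cls (u ^+ n) (n%:R * A) (n%:R * B).
Proof.
move=> uAB; elim: n => [|n IH]; first by rewrite !mul0r expr0; apply: cls1.
by rewrite exprS -addn1 addnC natrD !mulrDl !mul1r; apply: clsM.
Qed.

Let cls_ppow u A B v : cls u A B -> ppow (v / u) -> cls v A B.
Proof.
move=> uAB vu; have u0 := cls_neq0 uAB; case: uAB => m [n [-> -> h]].
exists m, n; split => //; have := ppowM vu h.
by rewrite mulrA divfK.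
Qed.

Let cls00 u : cls u 0 0 <-> ppow u.
Proof.
split=> [[m [n [/esym/eqP + /esym/eqP + h]]]|h].
  rewrite !natF => /dvdnP[m' mE] /dvdnP[n' nE].
  have M0 := mon_neq0 m n; rewrite -[u](divfK M0).
  apply: ppowM h _; rewrite mE nE !exprM -exprMn; apply: ppowXp.
  exact: mon_neq0.
by apply: cls_ppow cls1 _; rewrite divr1.
Qed.

Let cls_uniq u A B C D : cls u A B -> cls u C D -> A = C /\ B = D.
Proof.
move=> h1 h2; have u0 := cls_neq0 h1; have := clsM h1 (clsV h2); rewrite mulfV //.
case=> m [n [mE nE]]; rewrite div1r => /ppowV; rewrite invrK => /indep[].
by rewrite -!natF -mE -nE => /eqP h3 /eqP h4; split; exact: subr0_eq.
Qed.

Let cls_ntriv u A B : cls u A B -> (A, B) != (0, 0) -> ~ ppow u.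
Proof.
move=> h1 n /cls00 h2; have [] := cls_uniq h1 h2; move=> EA EB.
by move/eqP: n; rewrite EA EB.
Qed.

Let cls_add1 u A B : cls u A B -> (A, B) != (0, 0) -> exists i : F, cls (1 + u) (i * A) (i * B).
Proof.
move=> h n; have [i hi] := rigid (cls_neq0 h) (cls_ntriv h n).
by exists i%:R; apply: cls_ppow (clsX i h) hi.
Qed.

(** Since [u + v = u (1 + v / u)], rigidity puts the class of a sum on the affine line through the
    classes of its terms. *)
Let cls_add u v A B C D : cls u A B -> cls v C D -> (A, B) != (C, D) ->
  exists i : F, cls (u + v) (A + i * (C - A)) (B + i * (D - B)).
Proof.
move=> h1 h2 n; have u0 := cls_neq0 h1; have h := clsM h2 (clsV h1).
have [|i hi] := cls_add1 h.
  by apply: contraNneq n => E; rewrite (subr0_eq (congr1 fst E)) (subr0_eq (congr1 snd E)).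
exists i; have := clsM h1 hi.
by rewrite mulrDr mulr1 mulrCA mulfV // mulr1.
Qed.

(** The elimination behind [phi_succ]: [i], [j], [i'] are the exponents of [u], [y], [1 + u]; [m]
    and [k] place [1 + u + y] on two lines, [n] and [n'] place [2 + u + y] on two others, and [r] is
    the exponent of [1 + u + y]. *)
Let median_algebra (i j m k n n' r i' : F) :
  j != 0 -> j != 1 ->
  k = i * (1 - m) -> m = j * (1 - k) -> n' = i' * (1 - n) -> n = j * (1 - n') ->
  n' = r * (1 - m) -> n = r * m -> i' * (1 - i) = 1 - i'.
Proof.
move=> j0 j1 Ek Em En' En Er Er'.
have e1 : m * (1 - i * j) = j * (1 - i).
  by move: Em; rewrite Ek => h; rewrite mulrBr mulr1 {1}h; ring.
have e2 : n' * (1 - i' * j) = i' * (1 - j).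
  by move: En'; rewrite En => h; rewrite mulrBr mulr1 {1}h; ring.
have e3 : n * (1 - i' * j) = j * (1 - i').
  by move: En; rewrite En' => h; rewrite mulrBr mulr1 {1}h; ring.
have e4 : n' * m = n * (1 - m) by rewrite Er Er'; ring.
have e5 : i' * (1 - j) * m = j * (1 - i') * (1 - m).
  rewrite -e2 -e3; transitivity (n' * m * (1 - i' * j)); first by ring.
  by rewrite e4; ring.
have e6 : i' * (1 - j) * (j * (1 - i)) = j * (1 - i') * (1 - j).
  rewrite -e1; transitivity (i' * (1 - j) * m * (1 - i * j)); first by ring.
  rewrite e5; transitivity (j * (1 - i') * ((1 - i * j) - m * (1 - i * j))); first by ring.
  by rewrite e1; ring.
have nz : j * (1 - j) != 0 by rewrite mulf_neq0 // subr_eq0 eq_sym.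
apply: (mulfI nz); transitivity (i' * (1 - j) * (j * (1 - i))); first by ring.
by rewrite e6; ring.
Qed.

Section Run.

Variable j : F.
Hypotheses (phi_y : cls (1 + y) 0 j) (j0 : j != 0) (j1 : j != 1).

(* [phi u = i] means [1 + u] has the class of [u ^+ i]; computing the class of
   [2 + u + y] by adding its terms in three different orders gives
   [phi (1 + u) = 1 / (2 - phi u)]. *)
Let phi_succ u e i : cls u e 0 -> e != 0 -> cls (1 + u) (i * e) 0 -> i != 0 -> i != 1 ->
  exists i', cls (1 + (1 + u)) (i' * (i * e)) 0 /\ i' * (1 - i) = 1 - i'.
Proof.
move=> hu e0 h1u i0 i1.
have ie0 : i * e != 0 by rewrite mulf_neq0.
have pne (C D E G : F) : (C != E) || (D != G) -> (C, D) != (E, G).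
  by rewrite xpair_eqE negb_and.
have [|i' h2u] := cls_add1 h1u; first by rewrite pne ?ie0.
rewrite mulr0 in h2u; exists i'; split => //.
have [|m hm] := cls_add h1u clsy; first by rewrite pne ?ie0.
have [|k hk] := cls_add phi_y hu; first by rewrite pne ?j0 ?orbT.
have [|n hn] := cls_add h2u clsy; first by rewrite pne ?(eq_sym 0 1) ?oner_neq0 ?orbT.
have [|n' hn'] := cls_add phi_y h1u; first by rewrite pne ?j0 ?orbT.
have [|r hr] := cls_add1 hm.
  apply: pne; have [->|] := eqVneq m 0; first by rewrite mul0r addr0 ie0.
  by move=> m0; apply/orP; right; rewrite subr0 mulr1 add0r.
have eq_cls v w A B C D : v = w -> cls v A B -> cls w C D -> A = C /\ B = D.
  by move=> ->; apply: cls_uniq.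
have [Ek Em] := eq_cls _ _ _ _ _ _ (addrAC 1 u y) hm hk.
have [En' En] := eq_cls _ _ _ _ _ _ (addrAC 1 (1 + u) y) hn hn'.
have [Er Er'] := eq_cls _ _ _ _ _ _ (addrA 1 (1 + u) y) hr hn.
apply: (@median_algebra i j m k n n' r i') => //.
- apply: (mulIf e0).
  transitivity (i * e + m * (0 - i * e)); last by ring.
  by rewrite Ek; ring.
- transitivity (0 + m * (1 - 0)); first by ring.
  by rewrite Em; ring.
- apply: (mulIf ie0); transitivity (0 + n' * (i * e - 0)); first by ring.
  by rewrite -En'; ring.
- transitivity (0 + n * (1 - 0)); first by ring.
  by rewrite En; ring.
- apply: (mulIf ie0); transitivity (0 + n' * (i * e - 0)); first by ring.
  by rewrite -En' -Er; ring.
transitivity (0 + n * (1 - 0)); first by ring.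
by rewrite -Er'; ring.
Qed.

(** The relation of [phi_succ] reads [i' / (1 - i') = i / (1 - i) + 1]; here [s] is the initial
    value of this quotient, kept in a form free of division. *)
Let phi_run s u e i (k : nat) : cls u e 0 -> e != 0 -> cls (1 + u) (i * e) 0 ->
  i != 0 -> i != 1 -> i = s * (1 - i) ->
  exists u e i, [/\ cls u e 0, e != 0, cls (1 + u) (i * e) 0, i != 0 &
     i != 1 /\ i = (s + k%:R) * (1 - i)].
Proof.
move=> hu e0 h1 i0 i1 Ei; elim: k => [|k [{hu e0 h1 i0 i1 Ei}u [{}e [{}i [hu e0 h1 i0 [i1 Ei]]]]]].
  by exists u, e, i; rewrite addr0.
have [i' [h2 E]] := phi_succ hu e0 h1 i0 i1.
have i'0 : i' != 0.
  by apply: contra_eq_neq E => ->; rewrite mul0r subr0 eq_sym oner_neq0.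
exists (1 + u), (i * e), i'; split => //; first by rewrite mulf_neq0.
split.
  apply: contra_eq_neq E => ->; rewrite mul1r subrr subr_eq0 eq_sym //.
rewrite -E -addn1 natrD addrA mulrDl mul1r mulrCA -Ei -{1}[i']mulr1; ring.
Qed.

(* Along [u, 1 + u, 2 + u, ...] the quantity [phi / (1 - phi)] grows by 1, but
   it cannot take the value [-1]. *)
Lemma independent_absurd i : cls (1 + x) i 0 -> i != 0 -> i != 1 -> False.
Proof.
move=> h i0 i1; have [k kE] := F_nat (- 1 - i / (1 - i)); have i1' : 1 - i != 0 by rewrite subr_eq0 eq_sym.
pose s := i / (1 - i).
have [||u [e [i' [_ _ _ _ [n1 E]]]]] := @phi_run s x 1 i k clsx (oner_neq0 _) _ i0 i1.
- by rewrite mulr1.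
- by rewrite divfK.
move: E; rewrite -kE addrCA subrr addr0 mulN1r opprB => /eqP.
by rewrite -subr_eq0 opprB addrCA subrr addr0 oner_eq0.
Qed.

End Run.

Let cls_irregular u A B : irregular u -> cls u A B ->
  exists i : F, [/\ cls (1 + u) (i * A) (i * B), i != 0 & i != 1].
Proof.
move=> [u0 Tu n1 n2] hu; have [i hi] := rigid u0 Tu.
have h1 := cls_ppow (clsX i hu) hi; exists i%:R; split => //.
  by apply/eqP => E; apply: n1; apply/cls00; rewrite E !mul0r in h1.
apply/eqP => E; apply: n2; apply/cls00; rewrite E !mul1r in h1.
by have := clsM h1 (clsV hu); rewrite !subrr.
Qed.

Lemma independent_irregular : irregular x -> irregular y -> False.
Proof.
move=> /cls_irregular/(_ clsx)[i [hi i0 i1]] /cls_irregular/(_ clsy)[j [hj j0 j1]].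
rewrite !mulr0 !mulr1 in hi hj.
exact: (independent_absurd hj j0 j1 hi).
Qed.

End Independent.
(** If [y] is in no class of a power of [x], inverting exponents modulo [p] shows that [x] and [y]
    are independent modulo p-th powers, against [independent_irregular]. *)
Lemma irregular_dependent x y : irregular x -> irregular y ->
  exists j, ppow (y / x ^+ j).
Proof.
move=> hx hy; have [x0 Tx _ _] := hx; have [y0 _ _ _] := hy.
have natF (m : nat) : (m%:R == 0 :> 'F_p) = (p %| m)%N.
  by rewrite -(dvdn_pcharf (pchar_Fp p_pr)).
have F_nat (u : 'F_p) : exists m : nat, u = m%:R by exists (val u); rewrite natr_Zp.
apply: contrapT => nxy; apply: (independent_irregular natF F_nat x0 y0 _ hx hy).
have bez n : ~~ (p %| n)%N -> exists u v, (n * u = 1 + p * v)%N.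
  rewrite -prime_coprime // => /eqP E.
  have n0 : (0 < n)%N by rewrite lt0n; apply: contra_eq_neq E => ->; rewrite gcdn0 gtn_eqF ?prime_gt1.
  have [km kn E' _] := egcdnP p n0.
  by exists km, kn; rewrite mulnC E' gcdnC E addnC mulnC.
have pdvd n z : z != 0 -> ~ ppow z -> ppow (z ^+ n) -> (p %| n)%N.
  move=> z0 Tz h; apply: contraT => /bez[u [v uv]]; case: Tz.
  have := ppowM (ppowX u h) (ppowV (ppowX v (ppowXp z0))).
  by rewrite -!exprM uv exprD expr1 mulfK // expf_neq0.
move=> m n h; have pn : (p %| n)%N.
  apply: contraT => /bez[u [v uv]]; case: nxy; exists (p.-1 * (m * u))%N.
  have := ppowM (ppowM (ppowX u h) (ppowV (ppowX v (ppowXp y0)))) (ppowV (ppowX (m * u) (ppowXp x0))).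
  have E : x ^+ (p * (m * u)) = x ^+ (m * u) * x ^+ (p.-1 * (m * u)).
    by rewrite -exprD -mulSn prednK ?prime_gt0.
  congr ppow; rewrite exprMn -!exprM uv exprD expr1 E.
  by field; rewrite !expf_neq0.
split => //; move/dvdnP: pn h => [n' ->] h; apply: (pdvd _ x x0 Tx).
have := ppowM h (ppowV (ppowX n' (ppowXp y0))).
by rewrite -exprM mulnC mulfK // expf_neq0.
Qed.

(** * The valuation ring attached to a subgroup containing all irregular elements *)

Section ValuationRing.

Variable x0 : L.

Let H (x : L) : Prop := exists j, ppow (x / x0 ^+ j).

Hypothesis regular : forall y, y != 0 -> ~ H y -> ppow (1 + y) \/ ppow ((1 + y) / y).

Let HM x y : H x -> H y -> H (x * y).
Proof.
by move=> [i hi] [j hj]; exists (i + j)%N; have := ppowM hi hj; rewrite mulf_div exprD.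
Qed.

Let TH x : ppow x -> H x.
Proof. by move=> h; exists 0%N; rewrite divr1. Qed.

Let Hn0 x : H x -> x != 0.
Proof. by case=> j [h _]; apply: contraNneq h => ->; rewrite mul0r. Qed.

Let HX x n : H x -> H (x ^+ n).
Proof.
by move=> h; elim: n => [|n IH]; rewrite ?exprS; [apply/TH/ppow1 | exact: HM].
Qed.

Let HV x : H x -> H x^-1.
Proof.
move=> h; have n0 := Hn0 h.
have := HM (TH (ppowV (ppowXp n0))) (HX p.-1 h).
by rewrite (_ : x ^+ p = x * x ^+ p.-1) ?invfM ?mulfVK ?expf_neq0 // -exprS prednK ?prime_gt0.
Qed.

Let HMl x y : H x -> H (x * y) -> H y.
Proof. by move=> hx hxy; have := HM (HV hx) hxy; rewrite mulKf ?Hn0. Qed.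

Let HMr x y : H y -> H (x * y) -> H x.
Proof. by move=> hx hxy; have := HM hxy (HV hx); rewrite mulfK ?Hn0. Qed.

(** [x ^+ p.+1] is a power of [x * x] because [p] is odd, and [H] contains [x ^+ p]. *)
Let Hsq x : x != 0 -> H (x * x) -> H x.
Proof.
move=> n0 h; apply: (@HMr x (x ^+ p)); first exact: TH (ppowXp n0).
rewrite -exprS -[p.+1]even_halfK ?oddS ?p_odd // -mul2n exprM expr2; exact: HX.
Qed.

Let TQ x y : ppow x -> ppow (x / y) -> ppow y.
Proof.
move=> hx hxy; have := ppowM hx (ppowV hxy).
have [x'0 _] := hx; have y0 : y != 0.
  by case: hxy => + _; apply: contraNneq => ->; rewrite invr0 mulr0.
by rewrite invf_div mulrCA mulfV // mulr1.
Qed.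

Let TQV x y : ppow y -> ppow (x / y) -> ppow x.
Proof. by move=> hy hxy; have := ppowM hxy hy; rewrite divfK // ppow_neq0. Qed.

Let HN1 : H (-1). Proof. exact/TH/ppowN1. Qed.

(** These are to be the elements of positive value outside [H]. Outside [H] exactly one of [y] and
    [y^-1] qualifies, by [smVn] and [sm_asym]. *)
Let sm (y : L) : Prop := [/\ y != 0, ~ H y & ppow (1 + y)].

Let out_add u z : ppow u -> z != 0 -> ~ H z -> ppow (u + z) \/ ppow ((u + z) / z).
Proof.
move=> hu z0 hz; have u0 := ppow_neq0 hu.
have zu0 : z / u != 0 by rewrite mulf_neq0 ?invr_eq0.
have zuH : ~ H (z / u) by move=> h; apply: hz; apply: HMr h; apply/HV/TH.
have E : u + z = u * (1 + z / u) by field.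
case: (regular zu0 zuH) => h; [left | right].
  by rewrite E; apply: ppowM.
rewrite (_ : _ / z = (1 + z / u) / (z / u)) //; last by field; rewrite u0 z0.
Qed.

Let smVn y : y != 0 -> ~ H y -> ~ sm y -> sm y^-1.
Proof.
move=> y0 hy ny; split; [by rewrite invr_eq0 | by move/HV; rewrite invrK |].
case: (regular y0 hy) => [h|]; first by case: ny.
by rewrite mulrDl mul1r mulfV // addrC.
Qed.

Let sm_asym y : sm y -> sm y^-1 -> False.
Proof.
move=> [y0 hy h1] [_ _ h2]; apply: hy; apply: TH; apply: TQ h1 _.
by rewrite mulrDl mul1r mulfV // addrC.
Qed.

Let smM x y : sm x -> sm y -> ~ H (x * y) -> sm (x * y).
Proof.
move=> [x0' hx h1x] [y0 hy h1y] hxy; have xy0 : x * y != 0 by rewrite mulf_neq0.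
split => //; case: (regular xy0 hxy) => // hbig; exfalso.
have n1 : ~ ppow (x * y) by move/TH.
have n2 : ~ ppow x by move/TH.
have n3 : ~ ppow y by move/TH.
(* The class of [1 + x + x * y] is computed by grouping it as [(1 + x) + x y], [(1 + x y) + x] and
   [1 + x (1 + y)]; every outcome makes [x], [y] or [x y] a p-th power. *)
have [||hA|hA] := @out_add (1 + x) (x * y) h1x => //.
- have y'0 : y^-1 != 0 by rewrite invr_eq0.
  have [||h|h] := @out_add ((1 + x * y) / (x * y)) y^-1 hbig => //.
  + by move/HV; rewrite invrK.
  + apply: n1; apply: TQ hA _; move: h; congr ppow; field; rewrite ?x0' ?y0 ?oner_neq0 //.
  + apply: n2; apply: TQ hA _; move: h; congr ppow; field; rewrite ?x0' ?y0 ?oner_neq0 //.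
have [||hB|hB] := @out_add 1 (x * (1 + y)) ppow1 => //.
- by rewrite mulf_neq0 // ppow_neq0.
- by move=> h; apply: hx; apply: HMr h; apply: TH.
- apply: n1; apply: TQ hB _; move: hA; congr ppow; ring.
apply: n3; have gn0 : 1 + x + x * y != 0.
  by case: hA => h _; apply: contraNneq h => ->; rewrite mul0r.
have := ppowM (ppowM hB h1y) (ppowV hA); congr ppow.
have e1 : 1 + x * (1 + y) = 1 + x + x * y by ring.
by rewrite e1; field; rewrite x0' y0 gn0 ppow_neq0 ?oner_neq0 //.
Qed.

(** Otherwise [1 - y] is [- y] times a p-th power, hence [1 - y^2 = (1 - y)(1 + y)] is [y] times
    one. Regularity at [- y^2] makes it a p-th power, or [- y^2] times one, and in both cases [y]
    would be a p-th power. *)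
Let smN y : sm y -> sm (- y).
Proof.
move=> [y0 hy h1]; have ny0 : - y != 0 by rewrite oppr_eq0.
have nH : ~ H (- y) by rewrite -mulN1r => /(HMl HN1).
split => //; case: (regular ny0 nH) => // h; exfalso.
have h' : ppow ((1 - y * y) / y).
  have := ppowM (ppowM h h1) ppowN1; congr ppow; field; rewrite ?y0 ?oner_neq0 //.
have yy0 : - (y * y) != 0 by rewrite oppr_eq0 mulf_neq0.
have yyH : ~ H (- (y * y)) by rewrite -mulN1r => /(HMl HN1)/(Hsq y0).
have [h2|h2] := regular yy0 yyH.
  by apply: hy; apply: TH; apply: TQ h2 _.
apply: hy; apply: TH.
have n0 : 1 - y * y != 0.
  by case: h' => h' _; apply: contraNneq h' => ->; rewrite mul0r.
have := ppowM (ppowM h' (ppowV h2)) ppowN1; congr ppow.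
by field; rewrite yy0 y0 n0 ?oner_neq0.
Qed.

Let sm_1addM x w : sm x -> sm w -> sm ((1 + x) * w).
Proof.
move=> [x'0 hx h1x] [w0 hw h1w]; have x10 := ppow_neq0 h1x.
have z0 : (1 + x) * w != 0 by rewrite mulf_neq0.
have zH u v : ppow u -> ~ H v -> ~ H (u * v) by move=> hu hv /(HMl (TH hu)).
have keep u v : sm u -> sm v -> ~ ppow (u * v) -> sm ((1 + u) * v).
  move=> [u0 hu h1u] [v0 hv h1v] nuv; have v'0 := ppow_neq0 h1u.
  apply: contrapT => /smVn-/(_ (mulf_neq0 v'0 v0) (zH _ _ h1u hv))[_ _ hb].
  (* As [1 + q = (1 + v + u v) / (1 + v)], smallness of [((1 + u) v)^-1] puts [v] in the class of
     [1 + q]. Each class that rigidity or regularity allows for [1 + q] forces [u] or [v] into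
     [H]. *)
  have v1 := ppow_neq0 h1v; pose q := u * v / (1 + v).
  have q0 : q != 0 by rewrite !mulf_neq0 // invr_eq0.
  have nq : ~ ppow q by move=> h; apply: nuv; apply: TQV h.
  have vq : ppow (v / (1 + q)).
    have := ppowM (ppowM hb h1u) (ppowV h1v); move/ppowV; congr ppow.
    have qE : 1 + q = (1 + v + u * v) / (1 + v) by rewrite /q; field.
    have := ppow_neq0 hb.
    have -> : 1 + ((1 + u) * v)^-1 = (1 + v + u * v) / ((1 + u) * v).
      by field; rewrite v0 v'0 ?oner_neq0 //.
    rewrite mulf_eq0 negb_or => /andP[n0 _]; rewrite qE; field; rewrite ?v0 ?v1 ?v'0 ?n0 ?oner_neq0 //.
  have q1 : 1 + q != 0.
    by case: vq => h _; apply: contraNneq h => ->; rewrite invr0 mulr0.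
  have [Huv|Huv] := pselect (H (u * v)).
    have [i hi] := rigid q0 nq; apply: hv.
    have Hq : H q by apply: HM Huv _; apply/HV/TH.
    have := HM (HM (TH vq) (TH hi)) (HX i Hq); congr H; field; rewrite ?expf_neq0 ?q1 ?oner_neq0 //.
  have Hq : ~ H q by move=> h; apply: Huv; apply: HMr h; apply/HV/TH.
  have [h|h] := regular q0 Hq; first by apply: hv; apply: TH; apply: TQV vq.
  have uE : u = q * (1 + v) / v by rewrite /q; field; rewrite ?v0 ?v1.
  apply: hu; apply: TH; rewrite uE.
  have := ppowM (ppowM vq h) (ppowV h1v) => /ppowV; congr ppow.
  by field; rewrite ?q0 ?v0 ?v1 ?q1 ?oner_neq0.
(* When [x * w] is a p-th power, [keep] is applied to [x] and [((1 + x) * w)^-1] instead; it makes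
   [w^-1] small, which is absurd. *)
have [x2|x2] := pselect (ppow (x * w)); last exact: keep.
apply: contrapT => ns; have zH' := zH _ _ h1x hw.
have si := smVn z0 zH' ns.
have nx2 : ~ ppow (x * x) by move/TH/(Hsq x'0).
have sw : sm ((1 + x) * ((1 + x) * w)^-1).
  apply: keep => // h; apply: nx2; have := ppowM (ppowM h h1x) x2; congr ppow; field; rewrite ?w0 ?x10 ?oner_neq0 //.
have sw' : sm w by [].
apply: (sm_asym sw'); move: sw; congr sm; field; rewrite ?w0 ?x10 ?oner_neq0 //.
Qed.

Let sm_1addV x : sm x -> sm (- (x / (1 + x))).
Proof.
move=> [x'0 hx h1x]; have x1 := ppow_neq0 h1x.
split; first by rewrite oppr_eq0 mulf_neq0 ?invr_eq0.
  by rewrite -mulN1r => /(HMl HN1) h; apply: hx; apply: HMr h; apply/HV/TH.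
by have := ppowV h1x; congr ppow; field.
Qed.

Let sm_div1add x w : sm x -> sm w -> sm (w / (1 + x)).
Proof.
move=> hx hw; have [_ _ /ppow_neq0 x1] := hx; have := sm_1addM (sm_1addV hx) hw.
by congr sm; field.
Qed.

(** [1 + v w = (1 - v) (1 + (1 + w) v / (1 - v))], and [(1 + w) v / (1 - v)] is again small. *)
Let ppow_1addM v w : sm v -> sm w -> ppow (1 + v * w).
Proof.
move=> hv hw; have [_ _ h1] := smN hv.
have [_ _ h2] := sm_div1add (smN hv) (sm_1addM hw hv).
have := ppowM h1 h2; congr ppow; field.
exact: ppow_neq0 h1.
Qed.

(** Inside [H] the class of [1 + x] does not reveal the sign of the value, so integrality is tested
    there by multiplication on the small elements. *)
Definition vring (x : L) : Prop :=
  x = 0 \/ sm x \/ (H x /\ forall y, sm y -> sm (x * y)).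

Let vringU x : vring x -> x != 0 -> ~ sm x -> H x /\ forall y, sm y -> sm (x * y).
Proof. by move=> [->|[|]] //; rewrite eqxx. Qed.

Let HsmM x y : H x -> sm y -> sm (x * y) \/ sm (x * y)^-1.
Proof.
move=> hx [y0 hy h1]; have [h|h] := pselect (sm (x * y)); [by left | right].
by apply: smVn => //; [rewrite mulf_neq0 // Hn0 | move/(HMl hx)].
Qed.

(** For [x] in [H], if small [y] and [z] have [x y] and [x^-1 z] not small, then [(x y)^-1] and
    [x / z] are small. Their product, or their products with [z] and with [y], yield an element that
    is small together with its inverse. *)
Let vring_total x : x != 0 -> vring x \/ vring x^-1.
Proof.
move=> n0; have [hx|hx] := pselect (H x); last first.
  have [h|h] := pselect (sm x); first by left; right; left.
  by right; right; left; apply: smVn.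
have [h|/existsNP[y /not_implyP[hy nxy]]] := pselect (forall y, sm y -> sm (x * y)).
  by left; right; right.
right; right; right; split; first exact: HV.
move=> z hz; apply: contrapT => nxz.
have a1 : sm (x * y)^-1 by case: (HsmM hx hy).
have a2 : sm (x / z) by case: (HsmM (HV hx) hz) => //; rewrite invfM invrK.
have [y0 Hy _] := hy; have [z0 Hz _] := hz.
have [hyz|hyz] := pselect (H (y * z)); last first.
  apply: (@sm_asym (y * z)); first exact: smM.
  have -> : (y * z)^-1 = (x * y)^-1 * (x / z) by field; rewrite n0 y0 z0.
  apply: smM => //; have -> : (x * y)^-1 * (x / z) = (y * z)^-1 by field; rewrite n0 y0 z0.
  by move/HV; rewrite invrK.
have nH : ~ H (z / y).
  move=> h; apply: Hz; apply: Hsq => //; have := HM hyz h; congr H; field.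
  by rewrite y0.
apply: (@sm_asym (x * y / z)).
  have -> : x * y / z = x / z * y by ring.
  apply: smM => // h; apply: nH; have := HM hx (HV h); congr H; field.
  by rewrite n0 y0 z0.
have -> : (x * y / z)^-1 = (x * y)^-1 * z by field; rewrite n0 y0 z0.
apply: smM => // h; apply: nH; have := HM hx h; congr H; field.
by rewrite n0 y0.
Qed.

Let vringM x y : vring x -> vring y -> vring (x * y).
Proof.
have ss u v : sm u -> sm v -> vring (u * v).
  move=> hu hv; have [u0 Hu _] := hu; have [v0 Hv _] := hv; right.
  have [huv|huv] := pselect (H (u * v)); last by left; apply: smM.
  right; split => // w hw; have [w0 Hw _] := hw.
  have huvw : ~ H (u * v * w) by move/(HMl huv).
  (* One of [v * w] and [u * w] is outside [H]: otherwise [u * u], hence [u], would lie in [H]. *)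
  have [hvw|hvw] := pselect (H (v * w)); last first.
    by rewrite -mulrA; apply: smM => //; [apply: smM | rewrite mulrA].
  have huw : ~ H (u * w).
    move=> huw; apply: Hu; apply: Hsq => //; have := HM (HM huv huw) (HV hvw); congr H; field.
    by rewrite v0 w0.
  rewrite (_ : u * v * w = v * (u * w)); last by ring.
  by apply: smM => //; [apply: smM | rewrite (_ : v * (u * w) = u * v * w) //; ring].
move=> [->|[hx|[hx hx']]]; first by rewrite mul0r; left.
  move=> [->|[hy|[hy hy']]]; first by rewrite mulr0; left.
    exact: ss.
  by right; left; rewrite mulrC; apply: hy'.
move=> [->|[hy|[hy hy']]]; first by rewrite mulr0; left.
  by right; left; apply: hx'.
right; right; split; first exact: HM.
by move=> z hz; rewrite -mulrA; apply: hx'; apply: hy'.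
Qed.

Let vring_1add x : vring x -> vring (1 + x).
Proof.
move=> [->|[hx|[hx hx']]].
- rewrite addr0; right; right; split; first exact/TH/ppow1.
  by move=> y; rewrite mul1r.
- right; right; split; first by case: hx => _ _ /TH.
  by move=> y; apply: sm_1addM.
have [->|g0] := eqVneq (1 + x) 0; first by left.
right; have [hg|hg] := pselect (H (1 + x)); [right; split => // | left].
  (* The identity used is [1 + (1 + x) w = (1 + w) (1 + x w / (1 + w))]. *)
  move=> w hw; have hxw := hx' _ hw.
  have [w0 Hw h1w] := hw; have [_ _ h2] := sm_div1add hw hxw.
  split; first by rewrite mulf_neq0.
    by move/(HMl hg).
  have := ppowM h1w h2; congr ppow; field.
  exact: ppow_neq0.
(* If [(1 + x)^-1] is small, so is [- x (1 + x)^-1], and adding 1 to it shows that [(1 + x)^-1] is a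
   p-th power, hence in [H]. *)
apply: contrapT => /(smVn g0 hg) hgV.
have [_ _ h] := smN (hx' _ hgV).
case: hgV => _ + _; apply; apply: TH; move: h; congr ppow; field.
exact: g0.
Qed.

Lemma rigid_valuation_ring :
  [/\ forall x y, vring x -> vring y -> vring (x - y) /\ vring (x * y),
      vring 1,
      forall x, x != 0 -> vring x \/ vring x^-1,
      forall x, vring x -> ~ vring x^-1 -> ppow (1 + x)
    & forall x, x != 0 -> vring x -> vring x^-1 -> exists j, ppow (x / x0 ^+ j)].
Proof.
have v1 : vring 1 by have := vring_1add (or_introl erefl); rewrite addr0.
have vN x : vring x -> vring (- x).
  rewrite -mulN1r; apply: vringM; right; right; split=> // y; rewrite mulN1r; exact: smN.
split => // [x y hx hy|x hx nx|x n0 hx hxV].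
- split; last exact: vringM.
  have vD u v : vring u -> vring v -> v != 0 -> vring (u / v) -> vring (u + v).
    move=> hu hv v0 huv; have := vringM hv (vring_1add huv); congr vring; field.
    exact: v0.
  have [->|y0] := eqVneq y 0; first by rewrite subr0.
  have [->|x'0] := eqVneq x 0; first by rewrite sub0r; apply: vN.
  have q0 : x / - y != 0 by rewrite mulf_neq0 ?invr_eq0 ?oppr_eq0.
  case: (vring_total q0) => [|]; first by apply: vD; rewrite ?oppr_eq0 //; apply: vN.
  by rewrite invf_div addrC; apply: vD => //; apply: vN.
- have [x0E|n0] := eqVneq x 0; first by case: nx; rewrite x0E invr0; left.
  have [[] //|nsm] := pselect (sm x).
  have [hx' _] := vringU hx n0 nsm.
  (* A non-unit [x] of [H] is a product of two small elements, [x / w] and [w], so that [ppow_1addM]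
     applies. *)
  have /existsNP[w /not_implyP[hw nw]] : ~ forall y, sm y -> sm (x^-1 * y).
    by move=> h; apply: nx; right; right; split => //; apply: HV.
  have [w0 _ _] := hw; have hv : sm (x / w).
    by case: (HsmM (HV hx') hw) => //; rewrite invfM invrK.
  by have := ppow_1addM hv hw; rewrite divfK.
have [hs|hs] := pselect (sm x); last by have [] := vringU hx n0 hs.
have [hs'|hs'] := pselect (sm x^-1); first by case: (sm_asym hs).
have xV0 : x^-1 != 0 by rewrite invr_eq0.
by have [/HV + _] := vringU hxV xV0 hs'; rewrite invrK.
Qed.

End ValuationRing.
(* If no element is irregular, [x0 = 1] works; otherwise any irregular [x0]. *)
Lemma rigid_has_valuation_ring : exists (O : L -> Prop) (x0 : L),
  [/\ (x0 != 0 /\ forall x y, O x -> O y -> O (x - y) /\ O (x * y)),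
      O 1,
      forall x, x != 0 -> O x \/ O x^-1,
      forall x, O x -> ~ O x^-1 -> ppow (1 + x)
    & forall x, x != 0 -> O x -> O x^-1 -> exists j, ppow (x / x0 ^+ j)].
Proof.
suff [x0 [n0 h]] : exists x0, x0 != 0 /\ forall y, y != 0 ->
    ~ (exists j, ppow (y / x0 ^+ j)) -> ppow (1 + y) \/ ppow ((1 + y) / y).
  by exists (vring x0), x0; have [] := rigid_valuation_ring h; split.
have key y : y != 0 -> ~ ppow y -> ~ irregular y -> ppow (1 + y) \/ ppow ((1 + y) / y).
  by move=> y0 Ty hy; apply: contrapT => /not_orP[n1 n2]; apply: hy.
have [[x0 hx0]|hno] := pselect (exists x, irregular x); [exists x0 | exists 1].
  have [n0 Tx0 _ _] := hx0; split => // y y0 hy; apply: key => //.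
    by move=> h; apply: hy; exists 0%N; rewrite divr1.
  by move=> /(irregular_dependent hx0).
split; first exact: oner_neq0.
move=> y y0 hy; apply: key => //; last by move=> h; apply: hno; exists y.
by move=> h; apply: hy; exists 0%N; rewrite divr1.
Qed.

End RigidValuation.

(** * Subfields, their homomorphisms, and simple radical extensions *)

(** The zero ideal: with it [primitive_unit] says that K[al] is a field. *)
Definition zerop (A : fieldType) : {pred A} := pred1 0.

Lemma zerop_zmod (A : fieldType) : zmod_closed (@zerop A).
Proof.
split=> [|x y]; rewrite !inE ?eqxx // => /eqP -> /eqP ->.
by rewrite subrr.
Qed.

HB.instance Definition _ (A : fieldType) := GRing.isZmodClosed.Build A (@zerop A) (@zerop_zmod A).

Section Subfields.

Variable Om : closedFieldType.
Implicit Types (K E M : Om -> Prop).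

Definition sfpred K (HK : is_subfield K) : {pred Om} := fun x => `[<K x>].

Lemma sfpred_closed K (HK : is_subfield K) : divring_closed (sfpred HK).
Proof.
have [K0 K1 KBM KV] := HK; split=> [|x y|x y]; rewrite /in_mem /=.
- exact/asboolP.
- by move=> /asboolP hx /asboolP hy; apply/asboolP; case: (KBM x y).
- move=> /asboolP hx /asboolP hy; apply/asboolP.
  by case: (KBM x y^-1) => //; apply: KV.
Qed.

HB.instance Definition _ K (HK : is_subfield K) :=
  GRing.isDivringClosed.Build Om (sfpred HK) (sfpred_closed HK).

Lemma sfP K (HK : is_subfield K) x : reflect (K x) (x \in sfpred HK).
Proof. exact: asboolP. Qed.

Lemma gen_subfield (S : Om -> Prop) : is_subfield (gen S).
Proof.
split=> [K [] //|K [] //|x y hx hy|x hx K HK hS].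
  split=> K HK hS; have [_ _ h _] := HK.
    by case: (h x y (hx K HK hS) (hy K HK hS)).
  by case: (h x y (hx K HK hS) (hy K HK hS)).
by have [_ _ _] := HK; apply; apply: hx.
Qed.

Lemma gen_sub (S : Om -> Prop) x : S x -> gen S x.
Proof. by move=> hx K _; apply. Qed.

Lemma gen_min (S : Om -> Prop) K : is_subfield K -> (forall x, S x -> K x) ->
  forall x, gen S x -> K x.
Proof. by move=> HK hS x; apply. Qed.

Definition adj K al := gen (fun y => K y \/ y = al).

Lemma adj_sub K al x : K x -> adj K al x.
Proof. by move=> h; apply: gen_sub; left. Qed.

Lemma adj_gen K al : adj K al al.
Proof. by apply: gen_sub; right. Qed.

Lemma adj_subfield K al : is_subfield (adj K al).
Proof. exact: gen_subfield. Qed.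

(** A homomorphism with domain [K] is a total function of which only the values on [K] matter. *)
Definition ishom K (h : Om -> Om) :=
  h 1 = 1 /\ forall x y, K x -> K y -> h (x - y) = h x - h y /\ h (x * y) = h x * h y.

Section Hom.

Variables (K : Om -> Prop) (HK : is_subfield K) (h : Om -> Om) (hh : ishom K h).
Local Notation k := (sfpred HK).

Lemma hom1 : h 1 = 1. Proof. by case: hh. Qed.

Lemma homB x y : x \in k -> y \in k -> h (x - y) = h x - h y.
Proof. by move=> /sfP hx /sfP hy; case: hh => _ /(_ x y hx hy) []. Qed.

Lemma homM x y : x \in k -> y \in k -> h (x * y) = h x * h y.
Proof. by move=> /sfP hx /sfP hy; case: hh => _ /(_ x y hx hy) []. Qed.

Lemma hom0 : h 0 = 0.
Proof. by rewrite -[0 in LHS](subrr 0) homB ?rpred0 // subrr. Qed.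

Lemma homN x : x \in k -> h (- x) = - h x.
Proof. by move=> hx; rewrite -sub0r homB ?rpred0 // hom0 sub0r. Qed.

Lemma homD x y : x \in k -> y \in k -> h (x + y) = h x + h y.
Proof. by move=> hx hy; rewrite -[y in LHS]opprK homB ?rpredN // homN ?opprK. Qed.

Lemma hom_sum (I : Type) (s : seq I) (u : I -> Om) : (forall i, u i \in k) ->
  h (\sum_(i <- s) u i) = \sum_(i <- s) h (u i).
Proof.
move=> hu; elim: s => [|i s IH]; rewrite ?big_nil ?hom0 // !big_cons homD ?IH //.
by rewrite rpred_sum.
Qed.

Lemma homX x n : x \in k -> h (x ^+ n) = h x ^+ n.
Proof. by move=> hx; elim: n => [|n IH]; rewrite ?hom1 // !exprS homM ?rpredX ?IH. Qed.

Lemma hom_eq0 x : x \in k -> (h x == 0) = (x == 0).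
Proof.
move=> hx; have [->|x0] := eqVneq x 0; first by rewrite hom0 eqxx.
apply/eqP => E; have : h (x / x) = 1 by rewrite mulfV ?hom1.
by rewrite homM ?rpredV // E mul0r => /eqP; rewrite eq_sym oner_eq0.
Qed.

Lemma hom_inj x y : x \in k -> y \in k -> h x = h y -> x = y.
Proof.
move=> hx hy E; apply/eqP; rewrite -subr_eq0 -hom_eq0 ?rpredB // homB //.
by rewrite E subrr.
Qed.

Lemma hom_map_polyB f g : f \is a polyOver k -> g \is a polyOver k ->
  map_poly h (f - g) = map_poly h f - map_poly h g.
Proof.
move=> /polyOverP hf /polyOverP hg; apply/polyP => i.
by rewrite coefB !coef_map_id0 ?hom0 // coefB homB.
Qed.

Lemma hom_map_polyM f g : f \is a polyOver k -> g \is a polyOver k ->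
  map_poly h (f * g) = map_poly h f * map_poly h g.
Proof.
move=> /polyOverP hf /polyOverP hg; apply/polyP => i.
rewrite coefM coef_map_id0 ?hom0 // coefM hom_sum => [|j]; last by rewrite rpredM.
by apply: eq_bigr => j _; rewrite !coef_map_id0 ?hom0 // homM.
Qed.

Lemma hom_map_polyC c : map_poly h c%:P = (h c)%:P.
Proof.
by apply/polyP => i; rewrite coef_map_id0 ?hom0 // !coefC; case: (i == 0)%N; rewrite ?hom0.
Qed.

Lemma hom_map_polyXn n : map_poly h 'X^n = 'X^n.
Proof.
by apply/polyP => i; rewrite coef_map_id0 ?hom0 // !coefXn; case: (i == n)%N; rewrite ?hom0 ?hom1.
Qed.

Lemma hom_horner f x : f \is a polyOver k -> x \in k -> h f.[x] = (map_poly h f).[h x].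
Proof.
move=> /polyOverP hf hx; rewrite horner_coef hom_sum; last by move=> i; rewrite rpredM ?rpredX.
rewrite (@horner_coef_wide _ (size f)) ?size_poly //.
by apply: eq_bigr => i _; rewrite homM ?rpredX // homX // coef_map_id0 ?hom0.
Qed.

End Hom.

Section RadicalExtension.

Variables (p : nat) (K : Om -> Prop) (HK : is_subfield K) (al : Om).
Hypotheses (p_pr : prime p) (K_a : K (al ^+ p)).
Local Notation k := (sfpred HK).
Local Notation a := (al ^+ p).

Let ak : a \in k. Proof. exact/sfP. Qed.

Let modulus : 'X^p - a%:P \is a polyOver k.
Proof. by apply: rpredB; rewrite ?polyOverC // rpredX // polyOverX. Qed.

Let monic_mod : 'X^p - a%:P \is monic.
Proof. by rewrite monicXnsubC ?prime_gt0. Qed.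

Lemma radical_mod f : f \is a polyOver k -> exists q r,
  [/\ q \is a polyOver k, r \is a polyOver k, (size r <= p)%N & f = q * ('X^p - a%:P) + r].
Proof.
move=> fk; have [q [r [qk rk sr E]]] := monic_division monic_mod modulus fk.
by exists q, r; split => //; move: sr; rewrite size_XnsubC ?prime_gt0.
Qed.

Lemma radical_reduce f : f \is a polyOver k -> exists r,
  [/\ r \is a polyOver k, (size r <= p)%N & forall b, b ^+ p = a -> f.[b] = r.[b]].
Proof.
move=> /radical_mod[q [r [qk rk sr E]]]; exists r; split => // b hb.
by rewrite E hornerD hornerM hornerD hornerN hornerXn hornerC hb subrr mulr0 add0r.
Qed.

Hypothesis a_npow : ~ exists c, K c /\ a = c ^+ p.

Lemma radical_unit f : f \is a polyOver k -> (size f <= p)%N -> f != 0 ->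
  f.[al] != 0 /\ evalOver al k f.[al]^-1.
Proof.
move=> fk sf f0; apply: (@primitive_unit _ _ (@zerop Om) _ _ p a) => //.
- by move=> x; rewrite inE => /eqP ->; rewrite rpred0.
- by move=> x y _; rewrite !inE => /eqP ->; rewrite mulr0.
- by move=> x xk _; rewrite rpredV.
- move=> e /sfP he; rewrite inE subr_eq0; apply/eqP => E; apply: a_npow.
  by exists e.
- move=> y [g /polyOverP g0 ->]; have -> : g = 0.
    by apply/polyP => i; rewrite coef0; apply/eqP; apply: g0.
  rewrite horner0 addr0 invr1 oner_neq0; split => //.
  by exists 1; rewrite ?hornerC ?rpred1.
apply: contra f0 => /polyOverP f0; apply/eqP/polyP => i; rewrite coef0.
by apply/eqP; apply: f0.
Qed.

Lemma radical_coord f g : f \is a polyOver k -> g \is a polyOver k ->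
  (size f <= p)%N -> (size g <= p)%N -> f.[al] = g.[al] -> f = g.
Proof.
move=> fk gk sf sg E; apply/eqP; rewrite -subr_eq0; apply: contraT => n0.
have [|//||] := @radical_unit (f - g); rewrite ?rpredB //.
  by rewrite (leq_trans (size_polyD _ _)) // size_polyN geq_max sf.
by rewrite hornerD hornerN E subrr eqxx.
Qed.

Lemma adjP x : adj K al x <-> evalOver al k x.
Proof.
have alE : al \in sfpred (adj_subfield K al) by apply/sfP; apply: adj_gen.
split; last first.
  move=> [f fk ->]; apply/(sfP (adj_subfield K al)).
  apply: (@polyOver_eval _ (sfpred (adj_subfield K al))) => // [x' y|]; first exact: rpredM.
  by apply: polyOverS fk => y /sfP hy; apply/sfP; apply: adj_sub.
apply: gen_min; last first.
  move=> y [hy|->]; first by exists y%:P; rewrite ?hornerC // polyOverC; apply/sfP.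
  by exists 'X; rewrite ?hornerX ?polyOverX.
split=> [||x' y [f fk ->] [g gk ->]|x' [f fk ->]].
- by exists 0; rewrite ?horner0 ?rpred0.
- by exists 1; rewrite ?hornerC ?rpred1.
- split; [exists (f - g) | exists (f * g)]; rewrite ?rpredB ?rpredM //.
    by rewrite hornerD hornerN.
  by rewrite hornerM.
have [r [rk sr ->]] := radical_reduce fk => //.
have [->|r0] := eqVneq r 0; last by case: (radical_unit rk sr r0).
by exists 0; rewrite ?rpred0 // horner0 invr0.
Qed.

Lemma adjPr x : adj K al x -> exists f, [/\ f \is a polyOver k, (size f <= p)%N & x = f.[al]].
Proof.
by move=> /adjP[f /radical_reduce[r [rk sr E]] ->]; exists r; rewrite E.
Qed.

(** The map sending [f(al)] to [(h f)(b)] is well defined: by uniqueness of coordinates a polynomial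
    vanishing at [al] is a multiple of [X^p - a], whose image vanishes at [b]. *)
Lemma hom_extend h b : ishom K h -> b ^+ p = h a -> exists h',
  [/\ ishom (adj K al) h', (forall x, K x -> h' x = h x) & h' al = b].
Proof.
move=> hh hb; pose Phi f := (map_poly h f).[b].
have kerPhi f : f \is a polyOver k -> f.[al] = 0 -> Phi f = 0.
  move=> fk; have [q [r [qk rk sr E]]] := radical_mod fk.
  rewrite E hornerD hornerM hornerD hornerN hornerXn hornerC subrr mulr0 add0r => r0.
  have {r0} -> : r = 0 by apply: radical_coord; rewrite ?rpred0 ?size_poly0 ?horner0.
  have Xk : 'X^p \is a polyOver k by rewrite rpredX // polyOverX.
  rewrite addr0 /Phi (hom_map_polyM hh) // (hom_map_polyB hh) // ?polyOverC //.
  by rewrite (hom_map_polyXn HK) // (hom_map_polyC HK) // hornerM hornerD hornerN hornerXn hornerC hb subrr mulr0.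
have PhiB f g : f \is a polyOver k -> g \is a polyOver k -> Phi (f - g) = Phi f - Phi g.
  by move=> fk gk; rewrite /Phi (hom_map_polyB hh) // hornerD hornerN.
pose h' x := if pselect (evalOver al k x) is left e then Phi (projT1 (cid2 e)) else 0.
have h'E f : f \is a polyOver k -> h' f.[al] = Phi f.
  move=> fk; rewrite /h'; case: pselect => [e|[]]; last by exists f.
  case: cid2 => /= g gk E; apply/eqP; rewrite -subr_eq0 -PhiB //; apply/eqP.
  by apply: kerPhi; rewrite ?rpredB // hornerD hornerN E subrr.
have h'K x : K x -> h' x = h x.
  move=> Kx; have hx : x \in k by apply/sfP.
  rewrite -[x in LHS](hornerC x al) h'E ?polyOverC //.
  by rewrite /Phi (hom_map_polyC HK) // hornerC.
exists h'; split => //.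
  split; first by rewrite h'K ?(hom1 hh) //; case: HK.
  move=> _ _ /adjP[f fk ->] /adjP[g gk ->]; rewrite -hornerN -hornerD -hornerM !h'E ?rpredB ?rpredM //.
  by rewrite PhiB // /Phi (hom_map_polyM hh) // hornerM.
rewrite -[al in LHS]hornerX h'E ?polyOverX // /Phi -['X]expr1 (hom_map_polyXn HK) //.
by rewrite hornerXn.
Qed.

End RadicalExtension.

End Subfields.

(** * Cyclic extensions of degree p: norms, Hilbert 90, classes modulo p-th powers *)

(** Coefficientwise form of [(X - 1)^(p-1) = 1 + X + ... + X^(p-1)] modulo [p], with [p.-1] standing
    for -1. *)
Lemma bin_pred_prime_mod p i : prime p -> (i < p)%N ->
  ('C(p.-1, i) * p.-1 ^ (p.-1 - i) = 1 %[mod p])%N.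
Proof.
move=> p_pr; have p0 := prime_gt0 p_pr; have pE := prednK p0.
have key j : (j < p)%N -> ('C(p.-1, j) * p.-1 ^ j = 1 %[mod p])%N.
  elim: j => [|j IH] jp; first by rewrite bin0.
  rewrite -IH; last exact: ltnW.
  apply/eqP; rewrite -(eqn_modDr ('C(p.-1, j) * p.-1 ^ j.+1)%N).
  have /eqP -> : (('C(p.-1, j.+1) * p.-1 ^ j.+1 + 'C(p.-1, j) * p.-1 ^ j.+1) %% p == 0)%N.
    by rewrite -mulnDl -/(p %| _)%N -binS pE dvdn_mulr // prime_dvd_bin.
  rewrite eq_sym; apply/eqP.
  rewrite (_ : ('C(p.-1, j) * p.-1 ^ j + _ = 'C(p.-1, j) * p.-1 ^ j * p)%N) ?modnMl //.
  by rewrite -{7}pE mulnS expnS mulnCA [(_ * p.-1)%N]mulnC.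
move=> ip; have ile : (i <= p.-1)%N by rewrite -ltnS pE.
by rewrite -bin_sub // key // -{2}pE ltnS leq_subr.
Qed.

Section CyclicExtension.

Variables (Om : closedFieldType) (p : nat) (K : Om -> Prop) (HK : is_subfield K) (al z : Om).
Hypotheses (p_pr : prime p) (K_a : K (al ^+ p)) (z_prim : p.-primitive_root z) (K_z : K z).
Hypothesis a_npow : ~ exists c, K c /\ al ^+ p = c ^+ p.

Local Notation k := (sfpred HK).
Local Notation a := (al ^+ p).
Local Notation E := (adj K al).
Let HE : is_subfield E := adj_subfield K al.
Local Notation e := (sfpred HE).

Let kP x : K x -> x \in k. Proof. by move=> h; apply/sfP. Qed.
Let eP x : E x -> x \in e. Proof. by move=> h; apply/sfP. Qed.
Let Ee x : x \in e -> E x. Proof. by move/sfP. Qed.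
Let alE : E al. Proof. exact: adj_gen. Qed.
Let ke x : x \in k -> x \in e. Proof. by move=> /sfP h; apply: eP; apply: adj_sub. Qed.
Let zpow j : (z ^+ j) ^+ p = 1.
Proof. by rewrite exprAC (prim_expr_order z_prim) expr1n. Qed.

Lemma radical_neq0 : al != 0.
Proof.
have [K0 _ _ _] := HK.
by apply/eqP => al0; apply: a_npow; exists 0; rewrite al0 !expr0n.
Qed.

Variable sg : Om -> Om.
Hypotheses (sg_hom : ishom E sg) (sg_K : forall x, K x -> sg x = x) (sg_al : sg al = z * al).

Lemma sg_eval f j : f \is a polyOver k -> iter j sg f.[al] = f.[z ^+ j * al].
Proof.
move=> fk; elim: j => [|j IH]; first by rewrite mul1r.
have zal : z ^+ j * al \in e by rewrite rpredM ?rpredX //; [apply/ke/kP | apply: eP].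
rewrite iterS IH (hom_horner sg_hom) //; last by apply: polyOverS fk.
rewrite (homM sg_hom) ?rpredX // ?eP //; last exact: adj_sub.
rewrite (homX sg_hom) ?sg_al ?(sg_K K_z); last by apply: eP; apply: adj_sub.
rewrite mulrA -exprSr; congr horner.
by apply/polyP => i; rewrite coef_map_id0 ?(hom0 HE sg_hom) // sg_K //; apply/(sfP HK)/(polyOverP fk).
Qed.

Lemma sg_E x : E x -> E (sg x).
Proof.
move=> /(adjP HK p_pr K_a a_npow)[f fk ->]; have := sg_eval 1 fk; rewrite /= => ->.
apply: Ee; apply: (@polyOver_eval _ e) => //; first by move=> x' y; apply: rpredM.
  by rewrite rpredM //; [apply/ke/kP | apply: eP].
by apply: polyOverS fk.
Qed.

Lemma sg_iterE j x : E x -> E (iter j sg x).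
Proof. by move=> h; elim: j => //= j; apply: sg_E. Qed.

Lemma sg_order x : E x -> iter p sg x = x.
Proof.
move=> /(adjP HK p_pr K_a a_npow)[f fk ->].
by rewrite sg_eval // (prim_expr_order z_prim) mul1r.
Qed.

(** Comparing the coordinates of [f(z al)] and [f(al)] gives [f_i z^i = f_i], which kills every
    coefficient with [0 < i < p]. *)
Lemma sg_fixed x : E x -> sg x = x -> K x.
Proof.
move=> /(adjPr HK p_pr K_a a_npow)[f [fk sf ->]].
have := sg_eval 1 fk; rewrite /= => -> fx.
pose g := \poly_(i < p) (f`_i * z ^+ i).
have gk : g \is a polyOver k.
  apply/polyOverP => i; rewrite coef_poly; case: ifP => _; rewrite ?rpred0 //.
  by apply: rpredM; [apply: (polyOverP fk) | apply/rpredX/kP].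
have gf : g = f.
  apply: (radical_coord (HK := HK) p_pr K_a a_npow) => //; first exact: size_poly.
  rewrite horner_poly -[RHS]fx (horner_coef_wide _ sf).
  by apply: eq_bigr => i _; rewrite exprMn expr1 mulrA.
suff -> : f = (f`_0)%:P by rewrite hornerC; apply/(sfP HK)/(polyOverP fk).
apply/polyP => i; rewrite coefC; case: (posnP i) => [->//|i0].
have [ip|ip] := ltnP i p; last by rewrite nth_default // (leq_trans sf).
have := congr1 (fun q : {poly Om} => q`_i) gf; rewrite /= coef_poly ip => /eqP.
rewrite -subr_eq0 -{2}[f`_i]mulr1 -mulrBr mulf_eq0 => /orP[/eqP //|].
rewrite subr_eq0 -(expr0 z) (eq_prim_root_expr z_prim) mod0n modn_small // => /eqP i0'.
by rewrite i0' in i0.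
Qed.

Definition norm x := \prod_(j < p) iter j sg x.

Lemma norm_eval f : f \is a polyOver k -> norm f.[al] = \prod_(j < p) f.[z ^+ j * al].
Proof. by move=> fk; apply: eq_bigr => j _; rewrite sg_eval. Qed.

Lemma sg_prod n (u : nat -> Om) : (forall i, E (u i)) ->
  sg (\prod_(i < n) u i) = \prod_(i < n) sg (u i).
Proof.
move=> hu; elim: n => [|n IH]; first by rewrite !big_ord0 (hom1 sg_hom).
rewrite !big_ord_recr /= (homM sg_hom (HK := HE)) ?IH ?eP //.
by apply: Ee; apply: rpred_prod => i _; apply: eP.
Qed.

Lemma norm_K x : E x -> K (norm x).
Proof.
move=> Ex; apply: sg_fixed.
  by apply: Ee; apply: rpred_prod => i _; apply: eP; apply: sg_iterE.
rewrite /norm sg_prod => [|i]; last exact: sg_iterE.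
have p0 := prime_gt0 p_pr; rewrite -(prednK p0) big_ord_recr big_ord_recl /=.
rewrite -iterS prednK // sg_order // mulrC; congr (_ * _).
Qed.

Lemma normM x y : E x -> E y -> norm (x * y) = norm x * norm y.
Proof.
move=> Ex Ey; rewrite /norm -big_split; apply: eq_bigr => j _ /=.
elim: (nat_of_ord j) => [//|i IH]; rewrite !iterS IH (homM sg_hom (HK := HE)) //; by apply: eP; apply: sg_iterE.
Qed.

Lemma norm_const c : K c -> norm c = c ^+ p.
Proof.
move=> Kc; rewrite /norm (eq_bigr (fun=> c)) ?prodr_const ?card_ord // => j _.
by elim: (nat_of_ord j) => [//|i IH]; rewrite iterS IH sg_K.
Qed.

Lemma sg_neq0 x : E x -> x != 0 -> sg x != 0.
Proof. by move=> Ex; rewrite (hom_eq0 sg_hom (HK := HE)) // eP. Qed.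

Lemma sg_iter_neq0 j x : E x -> x != 0 -> iter j sg x != 0.
Proof.
move=> Ex x0; elim: j => //= j IH; apply: sg_neq0 => //; exact: sg_iterE.
Qed.

Lemma norm_neq0 x : E x -> x != 0 -> norm x != 0.
Proof. by move=> Ex x0; apply/prodf_neq0 => j _; apply: sg_iter_neq0. Qed.

Lemma norm_gen : odd p -> norm al = a.
Proof.
move=> p_odd; rewrite -[al in LHS]hornerX norm_eval ?polyOverX //.
under eq_bigr do rewrite hornerX.
rewrite big_split /= prodr_const card_ord -(big_mkord xpredT (fun j => z ^+ j)) prodrXr.
rewrite bin2_sum; have : (p %| 'C(p, 2))%N.
  by rewrite prime_dvd_bin //=; apply: odd_prime_gt2.
by case/dvdnP => q ->; rewrite mulnC exprM (prim_expr_order z_prim) expr1n mul1r.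
Qed.

Lemma norm_monomial j c : odd p -> K c -> norm (al ^+ j * c) = a ^+ j * c ^+ p.
Proof.
move=> p_odd Kc; have Ec : E c by apply: adj_sub.
have Eal n : E (al ^+ n) by apply: Ee; apply: rpredX; apply: eP.
rewrite normM // (norm_const Kc) //; congr (_ * _).
elim: j => [|j IH]; last by rewrite !exprS normM // IH norm_gen.
by rewrite !expr0 norm_const ?expr1n //; case: HK.
Qed.

(** The resolvent [b t] solves the equation for every [t]. On [t = al^i] it is [g(z^i) al^i], and
    the nonzero polynomial [g] of degree less than [p] cannot vanish at all [p] roots of unity. *)
Lemma hilbert90 x : E x -> norm x = 1 -> exists y, [/\ E y, y != 0 & x * sg y = y].
Proof.
move=> Ex Nx; pose X n := \prod_(i < n) iter i sg x.
have EX n : E (X n) by apply: Ee; apply: rpred_prod => i _; apply: eP; apply: sg_iterE.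
pose b t := \sum_(j < p) X j * iter j sg t.
have Eb t : E t -> E (b t).
  by move=> Et; apply: Ee; apply: rpred_sum => i _; apply: rpredM; apply: eP => //; apply: sg_iterE.
have xb t : E t -> x * sg (b t) = b t.
  move=> Et; rewrite (hom_sum (HK := HE) sg_hom) => [|i]; last first.
    by apply: rpredM; apply: eP => //; apply: sg_iterE.
  have XS n : x * sg (X n) = X n.+1.
    by rewrite /X sg_prod => [|i]; [rewrite big_ord_recl | apply: sg_iterE].
  have step : \sum_(j < p.+1) X j * iter j sg t = b t + X p * iter p sg t.
    by rewrite big_ord_recr.
  have X0 : X 0%N = 1 by rewrite /X big_ord0.
  have Xp : X p = 1 by [].
  move: step; rewrite big_ord_recl /= X0 Xp !mul1r sg_order // addrC => /addIr <-; rewrite mulr_sumr; apply: eq_bigr => i _.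
  rewrite (homM sg_hom (HK := HE)) ?mulrA ?XS //; apply: eP => //; exact: sg_iterE.
pose g := \poly_(j < p) X j.
have bg i : b (al ^+ i) = g.[z ^+ i] * al ^+ i.
  rewrite horner_poly mulr_suml; apply: eq_bigr => j _.
  rewrite -[al ^+ i in LHS]hornerXn sg_eval ?rpredX ?polyOverX // hornerXn exprMn.
  by rewrite mulrA exprAC.
have [i gi] : exists i : 'I_p, g.[z ^+ i] != 0.
  apply/existsP; apply: contraT; rewrite negb_exists => /forallP g0.
  have g00 : g`_0 = 1 by rewrite coef_poly prime_gt0 // /X big_ord0.
  have gn0 : g != 0 by apply: contra_eq_neq g00 => ->; rewrite coef0 eq_sym oner_neq0.
  pose rs := [seq z ^+ i | i <- iota 0 p].
  have rrs : all (root g) rs.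
    apply/allP => y /mapP[i]; rewrite mem_iota /= add0n => ip yE; rewrite {}yE.
    by have := g0 (Ordinal ip); rewrite negbK.
  have urs : uniq rs.
    rewrite map_inj_in_uniq ?iota_uniq // => i j; rewrite !mem_iota /= !add0n => ip jp /eqP.
    by rewrite (eq_prim_root_expr z_prim) !modn_small // => /eqP.
  have := max_poly_roots gn0 rrs urs; rewrite size_map size_iota ltnNge.
  by rewrite size_poly.
exists (b (al ^+ i)); split; first by apply: Eb; apply: Ee; apply: rpredX; apply: eP.
  by rewrite bg mulf_neq0 // expf_neq0 // radical_neq0.
by apply: xb; apply: Ee; apply: rpredX; apply: eP.
Qed.

(** This is [sg x / x] up to a p-th power, written without an inverse. *)
Let dl x := sg x * x ^+ p.-1.

Let dl_neq0 x : E x -> x != 0 -> dl x != 0.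
Proof. by move=> Ex x0; rewrite mulf_neq0 ?expf_neq0 // sg_neq0. Qed.

Let dlE x : E x -> E (dl x).
Proof.
by move=> Ex; apply: Ee; apply: rpredM; [apply: eP; apply: sg_E | apply: rpredX; apply: eP].
Qed.

Let dl_iterE n x : E x -> E (iter n dl x).
Proof. by move=> Ex; elim: n => //= n; apply: dlE. Qed.

Let dlM x y : E x -> E y -> dl (x * y) = dl x * dl y.
Proof.
by move=> Ex Ey; rewrite /dl (homM sg_hom (HK := HE)) ?eP // exprMn mulrACA.
Qed.

Let dl_iterM n x y : E x -> E y -> iter n dl (x * y) = iter n dl x * iter n dl y.
Proof.
by move=> Ex Ey; elim: n => //= n ->; rewrite dlM //; apply: dl_iterE.
Qed.

(** The binomial expansion of [(sg + (p - 1))^n], written multiplicatively. *)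
Let dl_iter n x : E x -> iter n dl x =
  \prod_(i < n.+1) iter i sg x ^+ ('C(n, i) * p.-1 ^ (n - i)).
Proof.
move=> Ex; elim: n => [|n IH]; first by rewrite big_ord_recl big_ord0 mulr1 /= expr1.
rewrite iterS {}IH /dl (@sg_prod n.+1 (fun i => iter i sg x ^+ ('C(n, i) * p.-1 ^ (n - i)))); last first.
  by move=> i; apply: Ee; apply: rpredX; apply: eP; apply: sg_iterE.
rewrite -prodrXl.
have -> : \prod_(i < n.+1) (iter i sg x ^+ ('C(n, i) * p.-1 ^ (n - i))) ^+ p.-1 =
    x ^+ (p.-1 ^ n.+1) * \prod_(i < n.+1) iter i.+1 sg x ^+ ('C(n, i.+1) * p.-1 ^ (n - i)).
  transitivity (\prod_(i < n.+2) iter i sg x ^+ ('C(n, i) * p.-1 ^ (n.+1 - i))).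
    rewrite [RHS]big_ord_recr /= bin_small // mul0n expr0 mulr1; apply: eq_bigr => i _.
    by rewrite -exprM -mulnA -expnSr subSn // -ltnS.
  by rewrite big_ord_recl bin0 mul1n subn0.
rewrite mulrCA -big_split [RHS]big_ord_recl /= bin0 mul1n subn0; congr (_ * _).
apply: eq_bigr => i _; rewrite (homX sg_hom (HK := HE)) -?exprD; last first.
  by apply: eP; apply: sg_iterE.
by rewrite /bump /= add1n subSS binS mulnDl addnC.
Qed.

Definition radical_class x := exists j c y,
  [/\ K c, c != 0, E y, y != 0 & x = al ^+ j * c * y ^+ p].

Let classM x y : radical_class x -> radical_class y -> radical_class (x * y).
Proof.
move=> [j [c [u [Kc c0 Eu u0 ->]]]] [j' [c' [u' [Kc' c'0 Eu' u'0 ->]]]].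
exists (j + j')%N, (c * c'), (u * u'); split; rewrite ?mulf_neq0 //.
- by apply/(sfP HK)/rpredM; apply: kP.
- by apply: Ee; apply: rpredM; apply: eP.
by rewrite exprD exprMn; ring.
Qed.

Let class_dl x : radical_class x -> radical_class (dl x).
Proof.
move=> [j [c [y [Kc c0 Ey y0 xE]]]]; have z0 : z != 0.
  apply/eqP => z0; have /eqP := prim_expr_order z_prim.
  by rewrite z0 expr0n gtn_eqF ?prime_gt0 // eq_sym oner_eq0.
have Ec : E c by apply: adj_sub.
have x0 : x != 0 by rewrite xE !mulf_neq0 ?expf_neq0 // radical_neq0.
have ye := eP Ey; have ce := eP Ec; have ale := eP alE.
have xe : x \in e by rewrite xE; apply: rpredM; [apply: rpredM; [apply: rpredX|] | apply: rpredX].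
have sy0 := sg_neq0 Ey y0; have sye := eP (sg_E Ey).
exists 0%N, (z ^+ j), (x * (sg y / y)); split; rewrite ?expf_neq0 ?mulf_neq0 ?invr_eq0 //.
- by apply/(sfP HK)/rpredX/kP.
- by apply: Ee; apply: rpredM => //; apply: rpredM => //; apply: rpredVr.
rewrite /dl expr0 mul1r; have -> : sg x = z ^+ j * (x * (sg y / y) ^+ p).
  rewrite {1}xE !(homM sg_hom (HK := HE)) ?(homX sg_hom (HK := HE)) ?rpredM ?rpredX //.
  rewrite sg_al (sg_K Kc) exprMn xE expr_div_n; field.
  by rewrite expf_neq0.
rewrite [in RHS]exprMn (_ : x ^+ p = x * x ^+ p.-1); last by rewrite -exprS prednK ?prime_gt0.
by ring.
Qed.

Hypothesis norms : forall x, E x -> x != 0 ->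
  exists j c, [/\ K c, c != 0 & norm x = norm (al ^+ j * c)].

(* By Hilbert 90 every [x] is [dl y] up to [radical_class]; iterating, [x] is
   [iter p.-1 dl y] up to [radical_class], and since [(sg - 1)^(p-1)] is the
   norm element modulo [p] this is [norm y] times a [p]-th power. *)
Lemma radical_classP x : E x -> x != 0 -> radical_class x.
Proof.
have step u : E u -> u != 0 -> exists d y, [/\ radical_class d, E y, y != 0, E d & u = d * dl y].
  move=> Eu u0; have [j [c [Kc c0 Nu]]] := norms Eu u0.
  have Ec : E c by apply: adj_sub.
  pose v := al ^+ j * c.
  have Ev : E v by apply: Ee; apply: rpredM; [apply: rpredX; apply: eP | apply: eP].
  have v0 : v != 0 by rewrite mulf_neq0 ?expf_neq0 // radical_neq0.
  have EuV : E (u / v) by apply: Ee; apply: rpredM; rewrite ?rpredV; apply: eP.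
  have N1 : norm (u / v) = 1.
    apply: (mulIf (norm_neq0 Ev v0)); rewrite mul1r -normM // divfK //.
  have [b [Eb b0 ub]] := hilbert90 EuV N1.
  have EbV : E b^-1 by apply: Ee; rewrite rpredV; apply: eP.
  have sb0 := sg_neq0 Eb b0.
  exists (v * b ^+ p), b^-1; split; rewrite ?invr_eq0 //.
  - by exists j, c, b.
  - by apply: Ee; apply: rpredM; [apply: eP | apply: rpredX; apply: eP].
  have sbV : sg b^-1 = (sg b)^-1.
    apply: (mulIf sb0); rewrite mulVf // -(homM sg_hom (HK := HE)) ?eP // mulVf //.
    exact: hom1 sg_hom.
  rewrite /dl sbV exprVn (_ : b ^+ p = b * b ^+ p.-1); last by rewrite -exprS prednK ?prime_gt0.
  have -> : u = v * (b / sg b) by rewrite -{1}ub mulfK // mulrC divfK.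
  by field; rewrite sb0 expf_neq0.
have iter_class n d : radical_class d -> radical_class (iter n dl d).
  by move=> hd; elim: n => //= n; apply: class_dl.
have main n u : E u -> u != 0 -> exists d y, [/\ radical_class d, E y, y != 0 & u = d * iter n dl y].
  move=> Eu u0; elim: n => [|n [d [y [hd Ey y0 uE]]]].
    exists 1, u; split; rewrite ?mul1r //; exists 0%N, 1, 1.
    have [_ K1 _ _] := HK; have [_ E1 _ _] := HE.
    by rewrite oner_neq0 expr0 expr1n !mul1r.
  have [d' [y' [hd' Ey' y'0 Ed' yE]]] := step y Ey y0.
  exists (d * iter n dl d'), y'; split => //; first by apply: classM => //; apply: iter_class.
  rewrite uE yE dl_iterM //; last exact: dlE.
  by rewrite mulrA -iterSr.
move=> Ex x0; have [d [y [hd Ey y0 ->]]] := main p.-1 x Ex x0; apply: classM => //.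
rewrite dl_iter // prednK ?prime_gt0 //.
pose q i := (('C(p.-1, i) * p.-1 ^ (p.-1 - i)) %/ p)%N.
exists 0%N, (norm y), (\prod_(i < p) iter i sg y ^+ q i); split.
- exact: norm_K.
- exact: norm_neq0.
- by apply: Ee; apply: rpred_prod => i _; apply: rpredX; apply: eP; apply: sg_iterE.
- by apply/prodf_neq0 => i _; rewrite expf_neq0 // sg_iter_neq0.
rewrite expr0 mul1r -prodrXl -big_split; apply: eq_bigr => i _ /=.
rewrite -exprM -exprS [in LHS](divn_eq ('C(p.-1, i) * _) p).
by rewrite bin_pred_prime_mod // modn_small ?prime_gt1 // addn1.
Qed.

End CyclicExtension.

(** * Valuation rings whose one-units are p-th powers *)

Section Subrings.

Variable Om : closedFieldType.

Definition is_subring (O : Om -> Prop) :=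
  O 1 /\ forall x y, O x -> O y -> O (x - y) /\ O (x * y).

Definition srpred O (HO : is_subring O) : {pred Om} := fun x => `[<O x>].

Lemma srpred_closed O (HO : is_subring O) : subring_closed (srpred HO).
Proof.
have [O1 h] := HO; split=> [|x y|x y]; rewrite /in_mem /=.
- exact/asboolP.
- by move=> /asboolP hx /asboolP hy; apply/asboolP; case: (h x y).
- by move=> /asboolP hx /asboolP hy; apply/asboolP; case: (h x y).
Qed.

HB.instance Definition _ O (HO : is_subring O) :=
  GRing.isSubringClosed.Build Om (srpred HO) (srpred_closed HO).

Lemma srP O (HO : is_subring O) x : reflect (O x) (x \in srpred HO).
Proof. exact: asboolP. Qed.

Definition is_pow p (K : Om -> Prop) x := x != 0 /\ exists c, K c /\ x = c ^+ p.

(** The form of rigidity that is carried up the tower: one-units are p-th powers, and the classes of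
    units are powers of the class of [x0], which need not itself be a unit. Since [0^-1 = 0], the
    premises of [val_pow] exclude 0. *)
Record valued p (K O : Om -> Prop) (x0 : Om) : Prop := Valued {
  val_sub : forall x, O x -> K x;
  val_ring : is_subring O;
  val_total : forall x, K x -> x != 0 -> O x \/ O x^-1;
  val_pow : forall x, O x -> ~ O x^-1 -> is_pow p K (1 + x);
  val_gen : K x0 /\ x0 != 0;
  val_unit : forall x, x != 0 -> O x -> O x^-1 -> exists j, is_pow p K (x / x0 ^+ j) }.

End Subrings.

Section Valued.

Variables (Om : closedFieldType) (p : nat) (K O : Om -> Prop) (HK : is_subfield K).
Variable x0 : Om.
Hypotheses (p_pr : prime p) (p_odd : odd p) (VO : valued p K O x0).

Let HO := val_ring VO.
Local Notation o := (srpred HO).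
Local Notation k := (sfpred HK).

Let oP x : O x -> x \in o. Proof. by move=> h; apply/srP. Qed.
Let Oo x : x \in o -> O x. Proof. by move/srP. Qed.
Let kP x : K x -> x \in k. Proof. by move=> h; apply/sfP. Qed.
Let Kk x : x \in k -> K x. Proof. by move/sfP. Qed.
Let OK x : O x -> K x. Proof. by case: VO => + _ _ _ _ _; apply. Qed.

Lemma val_M x y : O x -> O y -> O (x * y).
Proof. by move=> hx hy; apply: Oo; apply: rpredM; apply: oP. Qed.

Lemma val_B x y : O x -> O y -> O (x - y).
Proof. by move=> hx hy; apply: Oo; apply: rpredB; apply: oP. Qed.

Lemma val_D x y : O x -> O y -> O (x + y).
Proof. by move=> hx hy; apply: Oo; apply: rpredD; apply: oP. Qed.

Lemma val_X x n : O x -> O (x ^+ n).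
Proof. by move=> hx; apply: Oo; apply: rpredX; apply: oP. Qed.

Lemma val_0 : O 0. Proof. by apply: Oo; apply: rpred0. Qed.
Lemma val_1 : O 1. Proof. by apply: Oo; apply: rpred1. Qed.

(** The case of 0 is separate because [0^-1 = 0] lies in [O]. *)
Definition maxi x := O x /\ (x = 0 \/ ~ O x^-1).

Lemma val_maxi x : O x -> maxi x \/ (x != 0 /\ O x^-1).
Proof.
move=> hx; have [->|n0] := eqVneq x 0; first by left; split; [apply: val_0 | left].
by have [h|h] := pselect (O x^-1); [right | left; split => //; right].
Qed.

Lemma maxi_unit x : maxi x -> x != 0 -> ~ O x^-1.
Proof. by move=> [_ [->|//]]; rewrite eqxx. Qed.

Lemma maxi_not1 : ~ maxi 1.
Proof. by move=> /maxi_unit/(_ (oner_neq0 _)); rewrite invr1; apply; apply: val_1. Qed.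

Lemma maxi_mul x y : O x -> maxi y -> maxi (x * y).
Proof.
move=> hx hy; have [oy _] := hy; split; first exact: val_M.
have [->|y0] := eqVneq y 0; first by left; rewrite mulr0.
have [->|x'0] := eqVneq x 0; first by left; rewrite mul0r.
right=> h; apply: (maxi_unit hy y0); have := val_M hx h.
by rewrite invfM mulrA mulfV // mul1r.
Qed.

Lemma maxi_zmod : zmod_closed [pred x | `[<maxi x>]].
Proof.
have m0 : maxi 0 by split; [apply: val_0 | left].
have mN x : maxi x -> maxi (- x).
  by move=> hx; rewrite -mulN1r; apply: maxi_mul => //; apply: Oo; rewrite rpredN1.
have mD x y : x != 0 -> O (y / x) -> maxi x -> maxi (x + y).
  move=> n0 hyx hx; have -> : x + y = (1 + y / x) * x by field.
  by apply: maxi_mul => //; apply: val_D => //; apply: val_1.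
split=> [|x y]; rewrite !inE; first exact/asboolP.
move=> /asboolP hx /asboolP hy; apply/asboolP.
have [->|x'0] := eqVneq x 0; first by rewrite sub0r; apply: mN.
have [->|y0] := eqVneq y 0; first by rewrite subr0.
have Kxy : K (- y / x).
  by apply: Kk; apply: rpred_div; rewrite ?rpredN; (apply: kP; apply: OK); [case: hy | case: hx].
have [|h|h] := val_total VO Kxy.
- by rewrite mulf_neq0 ?oppr_eq0 ?invr_eq0.
- exact: mD.
rewrite addrC; apply: mD; rewrite ?oppr_eq0 //; last exact: mN.
by move: h; rewrite invf_div.
Qed.

Definition mpred : {pred Om} := [pred x | `[<maxi x>]].
HB.instance Definition _ := GRing.isZmodClosed.Build Om mpred maxi_zmod.

Lemma mP x : reflect (maxi x) (x \in mpred). Proof. exact: asboolP. Qed.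

Let mo : {subset mpred <= o}. Proof. by move=> x /mP[/oP]. Qed.
Let om x y : x \in o -> y \in mpred -> x * y \in mpred.
Proof. by move=> /srP hx /mP hy; apply/mP; apply: maxi_mul. Qed.

Lemma val_1maxi x : maxi x -> [/\ 1 + x != 0, O (1 + x), O (1 + x)^-1 & is_pow p K (1 + x)].
Proof.
move=> hx; have [ox _] := hx; have o1 := val_D val_1 ox.
have [h|[n0 h]] := val_maxi o1.
  have /mP h' := h; have /mP hx' := hx; case: maxi_not1; apply/mP.
  by rewrite -[1](addrK x) rpredB.
split => //; have [->|x'0] := eqVneq x 0.
  rewrite addr0; split; first exact: oner_neq0.
  by exists 1; rewrite expr1n; case: HK.
exact: val_pow VO _ ox (maxi_unit hx x'0).
Qed.

Lemma val_root x n : (0 < n)%N -> K x -> O (x ^+ n) -> O x.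
Proof.
move=> n0 Kx h; have [->|x'0] := eqVneq x 0; first exact: val_0.
have [//|hV] := val_total VO Kx x'0.
have -> : x = x ^+ n * x^-1 ^+ n.-1.
  by rewrite exprVn -{1}(prednK n0) exprS mulfK ?expf_neq0.
by apply: val_M => //; apply: val_X.
Qed.

Lemma maxi_root x n : (0 < n)%N -> K x -> maxi (x ^+ n) -> maxi x.
Proof.
move=> n0 Kx h; have hx := val_root n0 Kx h.1.
have [//|[x'0 hV]] := val_maxi hx.
by case: (maxi_unit h); rewrite ?expf_neq0 // -exprVn; apply: val_X.
Qed.

(** * Extending the valuation to K(al) *)

Section Extension.

Variables (al z : Om) (sg : Om -> Om).
Hypotheses (K_a : K (al ^+ p)) (z_prim : p.-primitive_root z) (K_z : K z).
Hypothesis a_npow : ~ exists c, K c /\ al ^+ p = c ^+ p.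
Local Notation E := (adj K al).
Local Notation a := (al ^+ p).
Hypotheses (sg_hom : ishom E sg) (sg_K : forall x, K x -> sg x = x) (sg_al : sg al = z * al).
Local Notation N := (norm p sg).

Let HE : is_subfield E := adj_subfield K al.
Local Notation e := (sfpred HE).
Let eP x : E x -> x \in e. Proof. by move=> h; apply/sfP. Qed.
Let Ee x : x \in e -> E x. Proof. by move/sfP. Qed.
Let KE x : K x -> E x. Proof. exact: adj_sub. Qed.
Let alE : E al. Proof. exact: adj_gen. Qed.
Let al0 : al != 0. Proof. exact (radical_neq0 HK a_npow). Qed.
Let p0 : (0 < p)%N. Proof. exact: prime_gt0. Qed.

(** A monomial [c * al ^+ i] has its p-th power in [K], which fixes its value. The sums of monomials
    of value at least 0, [span O], will be the extended valuation ring, and [span maxi] its maximal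
    ideal. *)
Inductive span (J : Om -> Prop) : Om -> Prop :=
| span0 : span J 0
| spanS i c x : K c -> J ((c * al ^+ i) ^+ p) -> span J x -> span J (c * al ^+ i + x).

Lemma span_E J x : span J x -> E x.
Proof.
elim=> [|i c {}x Kc _ _ hx]; first by apply: Ee; rewrite rpred0.
apply: Ee; apply: rpredD; last exact: eP.
by apply: rpredM; [(apply: eP; apply: KE) | (apply: rpredX; apply: eP)].
Qed.

Lemma span_mono J i c : K c -> J ((c * al ^+ i) ^+ p) -> span J (c * al ^+ i).
Proof. by move=> Kc h; rewrite -[_ * _]addr0; apply: spanS => //; apply: span0. Qed.

Lemma spanD J x y : span J x -> span J y -> span J (x + y).
Proof.
move=> hx hy; elim: hx => [|i c {}x Kc h _ IH]; first by rewrite add0r.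
by rewrite -addrA; apply: spanS.
Qed.

Lemma spanW (J J' : Om -> Prop) x : (forall y, J y -> J' y) -> span J x -> span J' x.
Proof. by move=> JJ; elim=> [|i c {}x Kc h _ IH]; [apply: span0 | apply: spanS => //; apply: JJ]. Qed.

Lemma spanM (J : Om -> Prop) (OJ : forall x y, O x -> J y -> J (x * y)) x y :
  span O x -> span J y -> span J (x * y).
Proof.
move=> hx hy; elim: hx => [|i c {}x Kc h _ IH]; first by rewrite mul0r; apply: span0.
rewrite mulrDl; apply: spanD => // {IH}; elim: hy => [|j d {}y Kd h' _ IH']; first by rewrite mulr0; apply: span0.
rewrite mulrDr; apply: spanD => //.
have -> : c * al ^+ i * (d * al ^+ j) = (c * d) * al ^+ (i + j) by rewrite exprD; ring.
apply: span_mono; first by apply: Kk; apply: rpredM; apply: kP.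
rewrite exprD mulrACA exprMn; exact: OJ.
Qed.

Lemma span_sg (J : Om -> Prop) x : span J x -> span J (sg x).
Proof.
elim=> [|i c {}x Kc h hx IH]; first by rewrite (hom0 HE sg_hom); apply: span0.
have Em : E (c * al ^+ i) by apply: Ee; apply: rpredM; [(apply: eP; apply: KE) | (apply: rpredX; apply: eP)].
rewrite (homD (HK := HE) sg_hom) ?eP //; last exact: span_E hx.
apply: spanD => //; rewrite (homM (HK := HE) sg_hom) ?rpredX ?eP //; last exact: KE.
rewrite (homX (HK := HE) sg_hom) ?eP // sg_al sg_K // exprMn mulrA.
apply: span_mono; first by apply: Kk; apply: rpredM; rewrite ?rpredX // kP.
move: h; congr J; rewrite !exprMn -!exprM mulnC (exprM z).
by rewrite mulnC (prim_expr_order z_prim) expr1n mulr1.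
Qed.

Lemma span_K (J : Om -> Prop) x : J (x ^+ p) -> K x -> span J x.
Proof.
move=> h Kx; rewrite -[x]mulr1 -(expr0 al); apply: span_mono => //.
by rewrite expr0 mulr1.
Qed.

(* [J] is [O] or [maxi]. *)
Lemma span_coord (J : zmodClosed Om) (OJ : forall x y, x \in o -> y \in J -> x * y \in J) x :
  span (fun y => y \in J) x ->
  exists f, [/\ f \is a polyOver k, (size f <= p)%N, forall i, (f`_i * al ^+ i) ^+ p \in J & x = f.[al]].
Proof.
have monoD i c d : K c -> K d -> (c * al ^+ i) ^+ p \in J -> (d * al ^+ i) ^+ p \in J ->
    ((c + d) * al ^+ i) ^+ p \in J.
  have half u v : K u -> K v -> v != 0 -> O (u / v) -> (v * al ^+ i) ^+ p \in J ->
      ((u + v) * al ^+ i) ^+ p \in J.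
    move=> Ku Kv v0 huv h; have -> : (u + v) * al ^+ i = (u / v + 1) * (v * al ^+ i) by field.
    by rewrite exprMn OJ // rpredX // rpredD ?rpred1 ?oP.
  move=> Kc Kd hc hd; have [->|c0] := eqVneq c 0; first by rewrite add0r.
  have [->|d0] := eqVneq d 0; first by rewrite addr0.
  have Kcd : K (c / d) by apply: Kk; apply: rpred_div; apply: kP.
  have [|h|h] := val_total VO Kcd; first by rewrite mulf_neq0 ?invr_eq0.
    exact: half.
  by rewrite addrC; apply: half => //; rewrite -invf_div.
elim=> [|i c {}x Kc h _ [f [fk sf fJ ->]]].
  by exists 0; rewrite rpred0 size_poly0 horner0; split=> // i; rewrite coef0 mul0r expr0n gtn_eqF // rpred0.
pose c' := c * a ^+ (i %/ p); pose j := (i %% p)%N.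
have Kc' : K c' by apply: Kk; apply: rpredM; [apply: kP | (apply: rpredX; apply: kP)].
have mE : c * al ^+ i = c' * al ^+ j by rewrite {1}(divn_eq i p) exprD mulnC exprM mulrA.
have jp : (j < p)%N by rewrite ltn_mod.
exists (c' *: 'X^j + f); split.
- by rewrite rpredD // polyOverZ ?kP // rpredX // polyOverX.
- rewrite (leq_trans (size_polyD _ _)) // geq_max sf andbT.
  by rewrite (leq_trans (size_scale_leq _ _)) // size_polyXn.
- move=> l; rewrite coefD coefZ coefXn; have [->|_] := eqVneq l j; last by rewrite mulr0 add0r.
  rewrite mulr1; apply: monoD => //; last by rewrite -mE.
  by apply: Kk; apply: (polyOverP fk).
by rewrite hornerD hornerZ hornerXn mE.
Qed.

(** Coordinates of degree less than [p] are unique, so an element of [K] is its own constant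
    monomial, whose p-th power is in [J]. *)
Lemma span_coordK (J : zmodClosed Om) (OJ : forall x y, x \in o -> y \in J -> x * y \in J) x :
  span (fun y => y \in J) x -> K x -> x ^+ p \in J.
Proof.
move=> /(span_coord OJ)[f [fk sf fJ xE]] Kx.
have fE : f = x%:P.
  apply: (radical_coord (HK := HK) p_pr K_a a_npow); rewrite ?polyOverC ?kP ?hornerC //.
  by rewrite (leq_trans (size_polyC_leq1 _)).
by have := fJ 0%N; rewrite fE coefC mulr1.
Qed.

Lemma spanO_K x : span O x -> K x -> O x.
Proof.
move=> hx Kx; apply: (val_root p0 Kx); apply: Oo; apply: span_coordK => //.
  by move=> u v; apply: rpredM.
by apply: spanW hx; apply: oP.
Qed.

Lemma spanM_K x : span maxi x -> K x -> maxi x.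
Proof.
move=> hx Kx; apply: (maxi_root p0 Kx); apply/mP; apply: span_coordK => //.
by apply: spanW hx => y /mP.
Qed.

Lemma span1 : span O 1.
Proof.
have [_ K1 _ _] := HK; apply: span_K => //.
by rewrite expr1n; apply: val_1.
Qed.

Lemma span_prod n (u : nat -> Om) : (forall i, span O (u i)) -> span O (\prod_(i < n) u i).
Proof.
move=> hu; elim: n => [|n IH]; first by rewrite big_ord0; apply: span1.
by rewrite big_ord_recr /=; apply: spanM => //; apply: val_M.
Qed.

Lemma span_iter (J : Om -> Prop) j x : span J x -> span J (iter j sg x).
Proof. by move=> hx; elim: j => //= j; apply: span_sg. Qed.

Let normK x : E x -> K (N x).
Proof. exact (@norm_K _ _ _ HK _ _ p_pr K_a z_prim K_z a_npow _ sg_hom sg_K sg_al x). Qed.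

Let normMul x y : E x -> E y -> N (x * y) = N x * N y.
Proof. exact (@normM _ _ _ HK _ _ p_pr K_a K_z a_npow _ sg_hom sg_K sg_al x y). Qed.

Let normC c : K c -> N c = c ^+ p.
Proof. exact (@norm_const _ p _ _ sg_K c). Qed.

Let normn0 x : E x -> x != 0 -> N x != 0.
Proof. exact (@norm_neq0 _ _ _ HK _ _ p_pr K_a K_z a_npow _ sg_hom sg_K sg_al x). Qed.

Lemma norm_O x : span O x -> O (N x).
Proof.
move=> hx; apply: spanO_K; last by apply: normK; apply: span_E hx.
by apply: (@span_prod p (fun i => iter i sg x)) => i; apply: span_iter.
Qed.

Lemma norm_1maxi y : span maxi y -> exists2 w, maxi w & N (1 + y) = 1 + w.
Proof.
move=> hy; have hyO : span O y by apply: spanW hy => u [].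
have all_n n : exists2 w, span maxi w & \prod_(j < n) iter j sg (1 + y) = 1 + w.
  elim: n => [|n [w hw IH]].
    by exists 0; [apply: span0 | rewrite big_ord0 addr0].
  rewrite big_ord_recr IH /=; have -> : iter n sg (1 + y) = 1 + iter n sg y.
    have Ey := span_E hyO; have E1 : E 1 by apply: span_E span1.
    elim: n {w hw IH} => //= n ->; rewrite (homD (HK := HE) sg_hom) ?(hom1 sg_hom) ?eP //.
    by apply: span_E (span_iter n hyO).
  exists (w + (1 + w) * iter n sg y); last by ring.
  apply: spanD => //; apply: spanM; first exact: maxi_mul.
    by apply: spanD; [apply: span1 | apply: spanW hw => u []].
  exact: span_iter.
have [w hw wE] := all_n p; exists w => //; apply: spanM_K => //.
have -> : w = N (1 + y) - 1 by rewrite /norm wE addrC addKr.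
apply: Kk; apply: rpredB; last exact: rpred1.
apply: kP; apply: normK; apply: Ee; apply: rpredD; first exact: rpred1.
by apply: eP; apply: span_E hyO.
Qed.

(** The inverse of [x] is the product of its other conjugates divided by the norm. *)
Lemma unit_of_norm x : span O x -> N x != 0 -> O (N x)^-1 -> x != 0 /\ span O x^-1.
Proof.
move=> hx n0 hV.
have NE : N x = x * \prod_(i < p.-1) iter i.+1 sg x.
  by rewrite /norm; case: p p0 => // n _; rewrite big_ord_recl.
have x'0 : x != 0 by apply: contraNneq n0 => x'0; rewrite NE x'0 mul0r.
split=> //; have -> : x^-1 = (N x)^-1 * \prod_(i < p.-1) iter i.+1 sg x.
  have r0 : \prod_(i < p.-1) iter i.+1 sg x != 0.
    by apply: contraNneq n0 => r0; rewrite NE r0 mulr0.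
  by rewrite {1}NE invfM mulfVK.
apply: spanM; first exact: val_M.
  apply: span_K; first exact: val_X.
  exact: OK.
by apply: (@span_prod p.-1 (fun i => iter i.+1 sg x)) => i; apply: span_iter.
Qed.

Lemma unit_1maxi y : span maxi y -> 1 + y != 0 /\ span O (1 + y)^-1.
Proof.
move=> hy; have [w hw wE] := norm_1maxi hy; have [n0 o1 oV _] := val_1maxi hw.
apply: unit_of_norm; rewrite ?wE //.
by apply: spanD; [apply: span1 | apply: spanW hy => u []].
Qed.

Lemma norm_unit u : u != 0 -> span O u -> span O u^-1 -> O (N u)^-1.
Proof.
move=> u0 hu hV; have := norm_O hV; congr O.
apply: (mulIf (normn0 (span_E hu) u0)); rewrite -normMul; [|exact: span_E hV|exact: span_E hu].
rewrite !mulVf ?normn0 //; last exact: span_E hu.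
by rewrite normC ?expr1n //; case: HK.
Qed.

(** A monomial of least value is chosen; values are compared through p-th powers, which lie in
    [K]. *)
Lemma dominant x : E x -> x != 0 -> exists f i,
  [/\ f \is a polyOver k, (size f <= p)%N, x = f.[al], f`_i != 0 &
      forall j, O ((f`_j * al ^+ j / (f`_i * al ^+ i)) ^+ p)].
Proof.
move=> /(adjPr HK p_pr K_a a_npow)[f [fk sf xE]] x'0.
have fK i : K f`_i by apply/(sfP HK)/(polyOverP fk).
pose r j i := (f`_j * al ^+ j / (f`_i * al ^+ i)) ^+ p.
have rK j i : K (r j i).
  rewrite /r expr_div_n !exprMn -!exprM ![(_ * p)%N]mulnC !exprM.
  apply: Kk; apply: rpred_div; apply: rpredM; apply: rpredX; apply: kP; rewrite ?fK //.
have main n : (exists2 i, (i < n)%N & f`_i != 0) ->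
    exists2 i, f`_i != 0 & forall j, (j < n)%N -> O (r j i).
  have rr i : f`_i != 0 -> r i i = 1.
    by move=> h; rewrite /r divff ?expr1n // mulf_neq0 // expf_neq0.
  have r0 j i : f`_j = 0 -> r j i = 0.
    by move=> h; rewrite /r h !mul0r expr0n gtn_eqF.
  elim: n => [[]//|n IH [i0 i0n fi0]].
  have [[i fi hi]|none] := pselect (exists2 i, f`_i != 0 & forall j, (j < n)%N -> O (r j i)); last first.
    have small j : (j < n)%N -> f`_j = 0.
      by move=> jn; apply/eqP; apply: contrapT => /negP h; apply: none; apply: IH; exists j.
    exists i0 => // j; rewrite ltnS leq_eqVlt => /orP[/eqP ->|/small h]; last first.
      by rewrite r0 //; apply: val_0.
    move: i0n; rewrite ltnS leq_eqVlt => /orP[/eqP <-|/small h].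
      by rewrite rr //; apply: val_1.
    by rewrite h eqxx in fi0.
  have [fn|fn] := eqVneq f`_n 0.
    exists i => // j; rewrite ltnS leq_eqVlt => /orP[/eqP ->|]; last exact: hi.
    by rewrite r0 //; apply: val_0.
  have n0 j : f`_j != 0 -> f`_j * al ^+ j != 0 by move=> h; rewrite mulf_neq0 // expf_neq0.
  have [|h|h] := val_total VO (rK n i).
  - by rewrite /r expf_neq0 // mulf_neq0 ?invr_eq0 ?n0.
  - by exists i => // j; rewrite ltnS leq_eqVlt => /orP[/eqP ->//|]; apply: hi.
  exists n => // j; rewrite ltnS leq_eqVlt => /orP[/eqP ->|jn].
    by rewrite rr //; apply: val_1.
  have -> : r j n = r j i * (r n i)^-1.
    rewrite /r -exprVn -exprMn; congr (_ ^+ _).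
    by rewrite invf_div mulrA divfK ?n0.
  by apply: val_M => //; apply: hi.
have f0 : f != 0 by apply: contraNneq x'0 => f0; rewrite xE f0 horner0.
have [|i fi hi] := main (size f).
  exists (size f).-1; first by rewrite prednK ?size_poly_gt0.
  by rewrite -lead_coefE lead_coef_eq0.
exists f, i; split => // j; have [js|js] := ltnP j (size f); first exact: hi.
by rewrite nth_default // !mul0r expr0n gtn_eqF //; apply: val_0.
Qed.

(** No monomial of exponent prime to [p] has value 0: the value of [a] is not [p] times a value of
    [K]. *)
Definition ramified := forall c i, K c -> ~~ (p %| i)%N -> O ((c * al ^+ i) ^+ p) -> maxi ((c * al ^+ i) ^+ p).
Definition unramified := O a /\ O a^-1.

Lemma decomp_ramified x : ramified -> E x -> x != 0 -> exists c i y,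
  [/\ K c, c != 0, span maxi y & x = c * al ^+ i * (1 + y)].
Proof.
move=> ram Ex x'0; have [f [i [fk sf xE fi hi]]] := dominant Ex x'0.
have fK j : K f`_j by apply/(sfP HK)/(polyOverP fk).
have ip : (i < p)%N by apply: leq_trans sf; rewrite ltnNge; apply: contra fi => h; rewrite nth_default.
have m0 : f`_i * al ^+ i != 0 by rewrite mulf_neq0 // expf_neq0.
exists f`_i, i, (\sum_(j < p | j != Ordinal ip) f`_j * al ^+ j / (f`_i * al ^+ i)); split => //.
  have closed (s : seq 'I_p) (P : pred 'I_p) (t : 'I_p -> Om) : (forall j, P j -> span maxi (t j)) ->
      span maxi (\sum_(j <- s | P j) t j).
    move=> ht; elim: s => [|j s IH]; first by rewrite big_nil; apply: span0.
    by rewrite big_cons; case: ifP => // Pj; apply: spanD => //; apply: ht.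
  apply: closed => j ji.
  (* The exponent [j + (p - 1) i] is congruent to [j - i] modulo [p], hence prime to [p], so the
     ratio of the two monomials has positive value. *)
  have tE : f`_j * al ^+ j / (f`_i * al ^+ i) = f`_j / f`_i / a ^+ i * al ^+ (j + p.-1 * i).
    have aE : a ^+ i = al ^+ i * al ^+ (p.-1 * i).
      by rewrite -exprM -exprD -mulSn prednK.
    by rewrite aE exprD; field; rewrite !expf_neq0.
  have Kc : K (f`_j / f`_i / a ^+ i).
    by apply: Kk; apply: rpred_div; [apply: rpred_div; apply: kP | apply: rpredX; apply: kP].
  have := hi j; rewrite tE => hj; apply: span_mono => //; apply: ram => //.
  apply: contra ji => /dvdnP[q hq]; apply/eqP/val_inj => /=.
  have pi : (p * i = i + p.-1 * i)%N by rewrite -mulSn prednK.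
  have : (j + p * i = i + q * p)%N by rewrite -hq pi addnCA.
  move/(congr1 (modn^~ p)); rewrite addnC [(p * i)%N]mulnC modnMDl.
  by rewrite [(i + _)%N]addnC modnMDl !modn_small.
rewrite xE (horner_coef_wide _ sf) (bigD1 (Ordinal ip)) //= mulrDr mulr1 mulr_sumr.
by congr (_ + _); apply: eq_bigr => j _; rewrite mulrCA mulfV // mulr1.
Qed.

Let monoJ i c : unramified -> O ((c * al ^+ i) ^+ p) -> O (c ^+ p).
Proof.
move=> [_ aV] h; have -> : c ^+ p = (c * al ^+ i) ^+ p * a^-1 ^+ i.
  by rewrite exprMn exprVn exprAC mulfK // !expf_neq0.
by apply: val_M => //; apply: val_X.
Qed.

Let span_eval x : unramified -> span O x -> evalOver al o x.
Proof.
move=> ur; elim=> [|i c {}x Kc h _ [f fo ->]]; first by exists 0; rewrite ?rpred0 ?horner0.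
have oc : c \in o by apply: oP; apply: (val_root p0 Kc); apply: monoJ ur h.
exists (c *: 'X^i + f); last by rewrite hornerD hornerZ hornerXn.
by rewrite rpredD // polyOverZ // rpredX // polyOverX.
Qed.

Let eval_span (J : zmodClosed Om) (OJ : forall x y, x \in o -> y \in J -> x * y \in J)
  (Jo : {subset J <= o}) x : unramified -> evalOver al J x -> span (fun y => y \in J) x.
Proof.
move=> [ao _] [f /polyOverP fJ ->]; rewrite horner_coef.
elim: (index_enum _) => [|i s IH]; first by rewrite big_nil; apply: span0.
rewrite big_cons; apply: spanS => //; first by apply: OK; apply: Oo; apply: Jo.
rewrite exprMn exprAC -(prednK p0) exprSr -mulrA [_ * _ ^+ i]mulrC mulrA.
apply: OJ => //; apply: rpredM; last by rewrite prednK //; apply: rpredX; apply: oP.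
by apply: rpredX; apply: Jo.
Qed.

(** Dividing by the dominant coefficient gives a polynomial over [O] with a coefficient 1, and
    [primitive_unit] for [O] and its maximal ideal makes its value at [al] a unit. *)
Lemma decomp_unramified x : unramified -> E x -> x != 0 -> exists c u,
  [/\ K c, c != 0, x = c * u, u != 0 & span O u /\ span O u^-1].
Proof.
move=> ur Ex x'0; have [ao aV] := ur.
have [f [i [fk sf xE fi hi]]] := dominant Ex x'0.
have fK j : K f`_j by apply/(sfP HK)/(polyOverP fk).
pose g := (f`_i)^-1 *: f.
have gO j : O g`_j.
  rewrite coefZ mulrC; have Kq : K (f`_j / f`_i) by apply: Kk; apply: rpred_div; apply: kP.
  apply: (val_root p0 Kq).
  have -> : (f`_j / f`_i) ^+ p = (f`_j * al ^+ j / (f`_i * al ^+ i)) ^+ p * a ^+ i * a^-1 ^+ j.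
    rewrite !expr_div_n !exprMn exprVn ![(al ^+ _) ^+ p]exprAC; field.
    by rewrite !expf_neq0.
  by do 2!(apply: val_M; last exact: val_X).
have sg' : size g = size f by rewrite size_scale // invr_eq0.
have [||||||| u0 uV] := @primitive_unit _ o mpred mo om p a p_pr _ _ _ al erefl _ g.
- by move=> y /srP hy /mP ny; apply: oP; case: (val_maxi hy) => // -[].
- exact: oP.
(* If [c^p] is [a] modulo the maximal ideal, then [c^p / a] is a one-unit, hence a p-th power, and
   so is [a]. *)
- move=> c /srP hc; apply/mP => hm; apply: a_npow.
  have [_ _ _ [n1 [d [Kd dE]]]] := val_1maxi (maxi_mul aV hm).
  have a0 : a != 0 by rewrite expf_neq0.
  have cE : c ^+ p = a * d ^+ p by rewrite -dE; field.
  have d0 : d != 0 by apply: contraNneq n1 => d0; rewrite dE d0 expr0n gtn_eqF.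
  exists (c / d); rewrite expr_div_n cE mulfK ?expf_neq0 //; split=> //.
  by apply: Kk; apply: rpred_div; [apply: kP; apply: OK | apply: kP].
- move=> y yJ; have ym : span maxi y.
    by apply: spanW (eval_span om mo ur yJ) => v /mP.
  by have [n1 hV] := unit_1maxi ym; split => //; apply: span_eval.
- by apply/polyOverP => j; apply: oP.
- by rewrite sg'.
- apply/negP => /polyOverP/(_ i); rewrite coefZ mulVf // => /mP; exact: maxi_not1.
have oo x' y : x' \in o -> y \in o -> x' * y \in o by apply: rpredM.
have eo y : evalOver al o y -> span O y.
  by move=> hy; apply: spanW (eval_span oo (fun _ h => h) ur hy) => v /srP.
exists f`_i, g.[al]; split => //; first by rewrite hornerZ mulVKf.
by split; apply: eo => //; exists g => //; apply/polyOverP => j; apply: oP.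
Qed.

Hypothesis ram_or : ramified \/ unramified.

Definition good_unit u := [/\ u != 0, span O u, span O u^-1 &
  (exists y, span maxi y /\ u = 1 + y) \/ unramified].

Lemma decomp x : E x -> x != 0 -> exists c i u,
  [/\ K c, c != 0, good_unit u & x = c * al ^+ i * u].
Proof.
move=> Ex x'0; case: ram_or => [ram|ur].
  have [c [i [y [Kc c0 hy xE]]]] := decomp_ramified ram Ex x'0.
  exists c, i, (1 + y); split => //; have [n1 hV] := unit_1maxi hy; split => //.
    by apply: spanD; [apply: span1 | apply: spanW hy => u []].
  by left; exists y.
have [c [u [Kc c0 xE u0 [hu hV]]]] := decomp_unramified ur Ex x'0.
by exists c, 0%N, u; split => //; rewrite ?mulr1 //; split => //; right.
Qed.

Lemma is_powM (M : Om -> Prop) (HM : is_subfield M) x y : is_pow p M x -> is_pow p M y -> is_pow p M (x * y).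
Proof.
move=> [x'0 [c [Mc xE]]] [y0 [d [Md yE]]]; split; first by rewrite mulf_neq0.
exists (c * d); rewrite xE yE exprMn; split => //.
by apply/(sfP HM)/rpredM; apply/(sfP HM).
Qed.

Lemma is_powV (M : Om -> Prop) (HM : is_subfield M) x : is_pow p M x -> is_pow p M x^-1.
Proof.
move=> [x'0 [c [Mc xE]]]; split; first by rewrite invr_eq0.
exists c^-1; rewrite xE exprVn; split => //.
by have [_ _ _] := HM; apply.
Qed.

Lemma is_powX (M : Om -> Prop) (HM : is_subfield M) x n : is_pow p M x -> is_pow p M (x ^+ n).
Proof.
move=> h; elim: n => [|n IH]; last by rewrite exprS; apply: is_powM.
rewrite expr0; split; first exact: oner_neq0.
by exists 1; rewrite expr1n; case: HM.
Qed.

Lemma is_powXp (M : Om -> Prop) x : M x -> x != 0 -> is_pow p M (x ^+ p).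
Proof. by move=> Mx n0; split; [rewrite expf_neq0 | exists x]. Qed.

Let bezout n : ~~ (p %| n)%N -> exists u v, (n * u = 1 + p * v)%N.
Proof.
rewrite -prime_coprime // => /eqP G.
have n0 : (0 < n)%N by rewrite lt0n; apply: contra_eq_neq G => ->; rewrite gcdn0 gtn_eqF ?prime_gt1.
have [km kn G' _] := egcdnP p n0.
by exists km, kn; rewrite mulnC G' gcdnC G addnC mulnC.
Qed.

Let a0 : a != 0. Proof. by rewrite expf_neq0. Qed.

Lemma pow_dvd j : is_pow p K (a ^+ j) -> (p %| j)%N.
Proof.
move=> h; apply: contraT => /bezout[u [v uv]]; case: a_npow.
have [_ [c [Kc cE]]] := is_powM HK (is_powX HK u h) (is_powV HK (is_powX HK v (is_powXp K_a a0))).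
exists c; split=> //; rewrite -cE; move: (a) a0 => b b0.
by rewrite -!exprM uv exprD expr1 mulfK // expf_neq0.
Qed.

(** All unit classes are powers of the class of [x0], whose order divides [p]; the unit [a] has a
    nontrivial class, so it generates them. *)
Lemma unit_gen x : unramified -> x != 0 -> O x -> O x^-1 -> exists l, is_pow p K (x / a ^+ l).
Proof.
move=> [ao aV] x'0 ox oV; have [K0 n0] := val_gen VO.
have [i hi] := val_unit VO a0 ao aV; have [j hj] := val_unit VO x'0 ox oV.
have /bezout[u [v uv]] : ~~ (p %| i)%N.
  apply/negP => /dvdnP[q iE]; case: a_npow.
  have Kq : K (x0 ^+ q) by apply: Kk; apply: rpredX; apply: kP.
  have [_ [c [Kc cE]]] := is_powM HK hi (is_powXp Kq (expf_neq0 q n0)).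
  by exists c; split=> //; rewrite -cE iE exprM divfK // expf_neq0 ?expf_neq0.
exists (u * j)%N; have Kv : K (x0 ^+ v) by apply: Kk; apply: rpredX; apply: kP.
have := is_powM HK hj (is_powV HK (is_powM HK (is_powX HK j (is_powX HK u hi))
  (is_powX HK j (is_powXp Kv (expf_neq0 v n0))))).
congr is_pow; have -> : (a / x0 ^+ i) ^+ u = a ^+ u / (x0 * (x0 ^+ v) ^+ p).
  by rewrite expr_div_n -!exprM uv mulnC [(v * p)%N]mulnC exprD expr1 (mulnC u).
rewrite [a ^+ (u * j)]exprM; set A := a ^+ u; set B := x0 ^+ v.
have A0 : A != 0 by rewrite expf_neq0.
have B0 : B ^+ p != 0 by rewrite !expf_neq0.
rewrite expr_div_n exprMn; field.
by rewrite !expf_neq0.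
Qed.

Lemma norm_al : N al = a.
Proof.
rewrite -[al in LHS]hornerX (norm_eval (HK := HK) p K_z sg_hom sg_K sg_al) ?polyOverX //.
under eq_bigr do rewrite hornerX.
rewrite big_split /= prodr_const card_ord -(big_mkord xpredT (fun j => z ^+ j)) prodrXr.
rewrite bin2_sum; have : (p %| 'C(p, 2))%N.
  by rewrite prime_dvd_bin //=; apply: odd_prime_gt2.
by case/dvdnP => q ->; rewrite mulnC exprM (prim_expr_order z_prim) expr1n mul1r.
Qed.

Let normX x n : E x -> N (x ^+ n) = N x ^+ n.
Proof.
move=> Ex; elim: n => [|n IH].
  by rewrite !expr0 normC ?expr1n //; case: HK.
by rewrite !exprS normMul ?IH //; apply: Ee; apply: rpredX; apply: eP.
Qed.

Let normPair i c : K c -> N (al ^+ i * c) = a ^+ i * c ^+ p.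
Proof.
move=> Kc; rewrite normMul ?(normX i alE) ?(normC Kc) ?norm_al //; last exact: KE.
by apply: Ee; apply: rpredX; apply: eP.
Qed.

(** By [decomp] only the norm of a good unit matters: a one-unit has a one-unit as norm, hence a
    p-th power; in the unramified case the norm is a unit of [O] and [unit_gen] applies. *)
Lemma rigid_norm x : E x -> x != 0 -> exists j c, [/\ K c, c != 0 & N x = a ^+ j * c ^+ p].
Proof.
move=> Ex x'0; have [c [i [u [Kc c0 [u0 hu hV gu] ->]]]] := decomp Ex x'0.
have [Ec Eu] : E c /\ E u by split; [apply: KE | apply: span_E hu].
have Eai : E (al ^+ i) by apply: Ee; apply: rpredX; apply: eP.
have -> : N (c * al ^+ i * u) = a ^+ i * c ^+ p * N u.
  have Em : E (c * al ^+ i) by apply: Ee; apply: rpredM; apply: eP.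
  by rewrite (normMul Em Eu) (normMul Ec Eai) (normC Kc) (normX i alE) norm_al [c ^+ p * _]mulrC.
have [l [_ [d [Kd dE]]]] : exists l, is_pow p K (N u / a ^+ l).
  case: gu => [[y [hy ->]]|ur].
    have [w hw ->] := norm_1maxi hy; exists 0%N; rewrite divr1.
    by have [] := val_1maxi hw.
  apply: unit_gen => //; [exact: normn0 | exact: norm_O | exact: norm_unit].
have al0' : a ^+ l != 0 by rewrite expf_neq0.
have dE' : N u = a ^+ l * d ^+ p by rewrite -dE mulrC divfK.
exists (i + l)%N, (c * d); split.
- by apply: Kk; apply: rpredM; apply: kP.
- rewrite mulf_neq0 //; apply/eqP => d0; have := normn0 Eu u0.
  by rewrite dE' d0 expr0n gtn_eqF // mulr0 eqxx.
by rewrite dE' exprD exprMn; ring.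
Qed.

Lemma spanN x : span O x -> span O (- x).
Proof.
move=> hx; rewrite -mulN1r; apply: spanM => //; first exact: val_M.
apply: span_K; first by rewrite -signr_odd p_odd expr1; apply: Oo; rewrite rpredN1.
by apply: Kk; rewrite rpredN1.
Qed.

Let spanOM x y : span O x -> span O y -> span O (x * y).
Proof. by apply: spanM; apply: val_M. Qed.

Let spanOX x n : span O x -> span O (x ^+ n).
Proof.
by move=> hx; elim: n => [|n IH]; rewrite ?exprS; [apply: span1 | apply: spanOM].
Qed.

Definition one_unit x := exists y, span maxi y /\ x = 1 + y.

Lemma one_unitM x y : one_unit x -> one_unit y -> one_unit (x * y).
Proof.
move=> [u [hu ->]] [v [hv ->]]; exists (u + (1 + u) * v); split; last by ring.
apply: spanD => //; apply: spanM => //; first exact: maxi_mul.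
by apply: spanD; [apply: span1 | apply: spanW hu => w []].
Qed.

Lemma one_unitV x : one_unit x -> one_unit x^-1.
Proof.
move=> [u [hu ->]]; have [n1 hV] := unit_1maxi hu.
exists (- (1 + u)^-1 * u); split; last by field.
by apply: spanM => //; [apply: maxi_mul | apply: spanN].
Qed.

Lemma one_unitX x n : one_unit x -> one_unit (x ^+ n).
Proof.
move=> hx; elim: n => [|n IH]; rewrite ?exprS; last exact: one_unitM.
by exists 0; split; [apply: span0 | rewrite addr0].
Qed.

Lemma one_unit_pow c : K c -> one_unit c -> is_pow p K c.
Proof.
move=> Kc [y [hy cE]]; have [K0 K1 _ _] := HK.
have my : maxi y.
  apply: spanM_K => //; have -> : y = c - 1 by rewrite cE addrC addKr.
  by apply: Kk; apply: rpredB; apply: kP.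
by rewrite cE; have [] := val_1maxi my.
Qed.

(** In the form given by [radical_classP], the p-th power of the monomial part of [w] lies in [K]
    and joins [c]. *)
Lemma class_good v : E v -> v != 0 -> exists j c u,
  [/\ K c, c != 0, good_unit u & v = al ^+ j * c * u ^+ p].
Proof.
move=> Ev v0.
have norms x : E x -> x != 0 -> exists j c, [/\ K c, c != 0 & N x = N (al ^+ j * c)].
  move=> Ex x'0; have [j [c [Kc c0 ->]]] := rigid_norm Ex x'0; exists j, c; split => //.
  by rewrite normPair.
have [j [c [w [Kc c0 Ew w0 vE]]]] :=
  radical_classP HK p_pr K_a z_prim K_z a_npow sg_hom sg_K sg_al norms Ev v0.
have [d [i [u [Kd d0 gu wE]]]] := decomp Ew w0.
exists j, (c * (d ^+ p * a ^+ i)), u; split => //.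
- by apply: Kk; apply: rpredM; [|apply: rpredM; apply: rpredX]; apply: kP.
- by rewrite !mulf_neq0 // !expf_neq0.
by rewrite vE wE !exprMn -!exprM (mulnC p i); ring.
Qed.

Let absorb j c : (p %| j)%N -> K c -> c != 0 -> exists c', [/\ K c', c' != 0 & al ^+ j * c = c'].
Proof.
move=> /dvdnP[q ->] Kc c0; exists (a ^+ q * c); rewrite mulf_neq0 ?expf_neq0 // mulnC exprM.
by split => //; apply: Kk; apply: rpredM; [apply: rpredX|]; apply: kP.
Qed.

Lemma valued_extension : exists x1, valued p E (span O) x1.
Proof.
have max_span x : span O x -> ~ span O x^-1 -> span maxi x.
  move=> hx nV; have [x'0|x'0] := eqVneq x 0; first by rewrite x'0; apply: span0.
  have [c [i [u [Kc c0 [u0 hu hV _] xE]]]] := decomp (span_E hx) x'0.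
  have wE : c * al ^+ i = x * u^-1 by rewrite xE mulfK.
  have hw : span O (c * al ^+ i) by rewrite wE; apply: spanOM.
  have Nw : N (c * al ^+ i) = (c * al ^+ i) ^+ p.
    by rewrite mulrC normPair // exprMn [in RHS]exprAC.
  have ow := norm_O hw; have [mw|[w0 wV]] := val_maxi ow; last first.
    have [_ hwV] := unit_of_norm hw w0 wV.
    by case: nV; rewrite xE invfM; apply: spanOM.
  rewrite xE mulrC; apply: spanM => //; first exact: maxi_mul.
  by apply: span_mono; rewrite -?Nw.
have total x : E x -> x != 0 -> span O x \/ span O x^-1.
  move=> Ex x'0; have [c [i [u [Kc c0 [u0 hu hV _] xE]]]] := decomp Ex x'0.
  have Kw : K ((c * al ^+ i) ^+ p).
    by rewrite exprMn exprAC; apply: Kk; apply: rpredM; apply: rpredX; apply: kP.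
  have [|h|h] := val_total VO Kw; first by rewrite expf_neq0 // mulf_neq0 // expf_neq0.
    by left; rewrite xE; apply: spanOM => //; apply: span_mono.
  right; rewrite xE invfM; apply: spanOM => //.
  have -> : (c * al ^+ i)^-1 = c^-1 / a ^+ i * al ^+ (p.-1 * i).
    have -> : a ^+ i = al ^+ i * al ^+ (p.-1 * i) by rewrite -exprM -exprD -mulSn prednK.
    by field; rewrite c0 !expf_neq0.
  apply: span_mono.
    by apply: Kk; apply: rpred_div; [rewrite rpredV | apply: rpredX]; apply: kP.
  move: h; congr O; rewrite -exprVn; congr (_ ^+ _).
  have -> : a ^+ i = al ^+ i * al ^+ (p.-1 * i) by rewrite -exprM -exprD -mulSn prednK.
  by field; rewrite c0 !expf_neq0.
have unitK c : span O c -> span O c^-1 -> K c -> O c /\ O c^-1.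
  by move=> h hV Kc; split; apply: spanO_K => //; have [_ _ _] := HK; apply.
have powE x : is_pow p K x -> is_pow p E x.
  by move=> [n0 [c [Kc cE]]]; split => //; exists c; split => //; apply: KE.
have gen_pow c l u : is_pow p K (c / a ^+ l) -> E u -> u != 0 -> is_pow p E (c * u ^+ p).
  move=> [n0 [t [Kt tE]]] Eu u0; have al0' : a ^+ l != 0 by rewrite expf_neq0.
  have t0 : t != 0 by apply: contraNneq n0 => t0; rewrite tE t0 expr0n gtn_eqF.
  rewrite -[c](divfK al0') tE exprAC -!exprMn; apply: is_powXp.
    by apply: Ee; apply: rpredM; [apply: rpredM; [|apply: rpredX]|]; apply: eP => //; apply: KE.
  by rewrite !mulf_neq0 // expf_neq0.
have pow x : span O x -> ~ span O x^-1 -> is_pow p E (1 + x).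
  move=> hx nV; have hm := max_span x hx nV; have [v0 hvV] := unit_1maxi hm.
  have hv : span O (1 + x) by apply: spanD; [apply: span1|].
  have [j [c [u [Kc c0 [u0 hu hV gu] vE]]]] := class_good (span_E hv) v0.
  have [Eu Ev] : E u /\ E (1 + x) by split; [apply: span_E hu | apply: span_E hv].
  (* The norm of [1 + x] is a one-unit, hence a p-th power of [K], and also [a ^+ j] times a p-th
     power. *)
  have pj : (p %| j)%N.
    apply: pow_dvd; have [w hw Nw] := norm_1maxi hm.
    have Kq : K (c * N u) by apply: Kk; apply: rpredM; apply: kP => //; apply: normK.
    have q0 : c * N u != 0 by rewrite mulf_neq0 // normn0.
    have [_ _ _ hpw] := val_1maxi hw.
    have := is_powM HK hpw (is_powV HK (is_powXp Kq q0)); congr is_pow.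
    rewrite -Nw vE; have [Ec Eaj Eup] : [/\ E c, E (al ^+ j) & E (u ^+ p)].
      by split; [apply: KE | apply: Ee; apply: rpredX; apply: eP | apply: Ee; apply: rpredX; apply: eP].
    have Em : E (al ^+ j * c) by apply: Ee; apply: rpredM; apply: eP.
    rewrite (normMul Em Eup) (normPair j Kc) (normX p Eu) exprMn; field.
    by rewrite !expf_neq0 // normn0.
  (* Now [1 + x = c' u^p] with [c'] in [K]. If [u] is a one-unit, so is [c'], which is then a p-th
     power in [K]. Otherwise [c'] is a unit of [O], a power of [a] up to p-th powers, and [a] is a
     p-th power in [E]. *)
  have [c' [Kc' c'0 cE]] := absorb pj Kc c0; rewrite vE cE.
  have c'E : c' = (1 + x) * u^-1 ^+ p by rewrite vE cE exprVn mulfK // expf_neq0.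
  case: gu => [[y [hy uE]]|ur].
    have : one_unit c'.
      rewrite c'E; apply: one_unitM; first by exists x.
      by apply: one_unitX; apply: one_unitV; exists y.
    move=> /(one_unit_pow Kc') h; apply: (gen_pow c' 0%N) => //.
    by rewrite divr1.
  have [||//|oc ocV] := unitK c'.
  - by rewrite c'E; apply: spanOM => //; apply: spanOX.
  - by rewrite c'E invfM exprVn invrK; apply: spanOM => //; apply: spanOX.
  by have [l hl] := unit_gen ur c'0 oc ocV; apply: gen_pow hl _ _.
(* In the ramified case unit classes come from units of [K], and [x0] still serves. In the
   unramified case the units of [O] become p-th powers, and the unit classes are powers of that of
   [al]. *)
have units : exists x1, (E x1 /\ x1 != 0) /\ forall x, x != 0 -> span O x -> span O x^-1 ->
    exists j, is_pow p E (x / x1 ^+ j).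
  have dec v : v != 0 -> span O v -> span O v^-1 -> exists j c u, [/\ K c, c != 0,
      good_unit u, v = al ^+ j * c * u ^+ p & span O (al ^+ j * c) /\ span O (al ^+ j * c)^-1].
    move=> v0 hv hvV; have [j [c [u [Kc c0 gu vE]]]] := class_good (span_E hv) v0.
    exists j, c, u; have [u0 hu hV _] := gu.
    have gE : al ^+ j * c = v * u^-1 ^+ p by rewrite vE exprVn mulfK // expf_neq0.
    split => //; rewrite gE; split; first by apply: spanOM => //; apply: spanOX.
    by rewrite invfM exprVn invrK; apply: spanOM => //; apply: spanOX.
  case: (ram_or) => [ram|ur].
    have [K0 n0] := val_gen VO; exists x0; split; first by split => //; apply: KE.
    move=> v v0 hv hvV; have [j [c [u [Kc c0 [u0 hu hV _] vE [hg hgV]]]]] := dec v v0 hv hvV.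
    have g0 : al ^+ j * c != 0 by rewrite mulf_neq0 // expf_neq0.
    have pj : (p %| j)%N.
      apply: contraT => pj; exfalso.
      have Ng : N (al ^+ j * c) = (c * al ^+ j) ^+ p.
        by rewrite normPair // exprMn mulrC [in RHS]exprAC.
      have og := norm_O hg; rewrite Ng in og.
      have ogV := norm_unit g0 hg hgV; rewrite Ng in ogV.
      by apply: (maxi_unit (ram c j Kc pj og)) => //; rewrite expf_neq0 // mulrC.
    have [c' [Kc' c'0 cE]] := absorb pj Kc c0; rewrite cE in hg hgV.
    have [oc ocV] := unitK c' hg hgV Kc'; have [l hl] := val_unit VO c'0 oc ocV.
    exists l; rewrite vE cE mulrAC; apply: is_powM => //; first exact: powE.
    apply: is_powXp => //; exact: span_E hu.
  have [ao aV] := ur; exists al; split => // v v0 hv hvV.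
  have [j [c [u [Kc c0 [u0 hu hV _] vE [hg hgV]]]]] := dec v v0 hv hvV.
  have hal : span O al.
    have [_ K1 _ _] := HK.
    by rewrite -[al]mul1r -[al]expr1; apply: span_mono; rewrite ?mul1r ?expr1.
  have halV : span O al^-1.
    have -> : al^-1 = a^-1 * al ^+ p.-1.
      by rewrite (_ : a = al * al ^+ p.-1) ?invfM ?mulfVK ?expf_neq0 // -exprS prednK.
    apply: spanOM; last exact: spanOX.
    by apply: span_K; [apply: val_X | apply: OK].
  have [||//|oc ocV] := unitK c.
  - have -> : c = al ^+ j * c * al^-1 ^+ j by rewrite exprVn mulrAC mulfV ?mul1r // expf_neq0.
    by apply: spanOM => //; apply: spanOX.
  - have -> : c^-1 = (al ^+ j * c)^-1 * al ^+ j by rewrite invfM mulrAC mulVf ?mul1r // expf_neq0.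
    by apply: spanOM => //; apply: spanOX.
  have [l hl] := unit_gen ur c0 oc ocV; exists j.
  have -> : v / al ^+ j = c * u ^+ p by rewrite vE mulrC -mulrA mulKf // expf_neq0.
  by apply: gen_pow hl _ _ => //; apply: span_E hu.
have [x1 [hx1 hunit]] := units; exists x1; split => //; first exact: span_E.
split; first exact: span1.
by move=> x y hx hy; split; [apply: spanD => //; apply: spanN | apply: spanOM].
Qed.

End Extension.
End Valued.

(** * Rigid fields are the valued ones; rigidity of K(al) *)

Definition sub_of (Om : closedFieldType) (K : Om -> Prop) (HK : is_subfield K) : Type :=
  {x : Om | x \in sfpred HK}.

Section SubfieldType.
Variables (Om : closedFieldType) (K : Om -> Prop) (HK : is_subfield K).
HB.instance Definition _ := SubChoice.on (sub_of HK).
HB.instance Definition _ := [SubChoice_isSubIntegralDomain of sub_of HK by <:].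
HB.instance Definition _ := [SubIntegralDomain_isSubField of sub_of HK by <:].
End SubfieldType.

Section RigidStep.

Variables (Om : closedFieldType) (p : nat).
Hypotheses (p_pr : prime p) (p_odd : odd p).

(** The factorization of [X^p - 1] evaluated at [- al^-1], with [p] odd: the norm of [1 + al] is
    [1 + al^p]. *)
Lemma prod_1addroot (z al : Om) : p.-primitive_root z ->
  \prod_(j < p) (1 + z ^+ j * al) = 1 + al ^+ p.
Proof.
move=> z_prim; have [->|al0] := eqVneq al 0.
  rewrite expr0n gtn_eqF ?prime_gt0 // addr0 big1 // => j _.
  by rewrite mulr0 addr0.
have := congr1 (fun f : {poly Om} => f.[- al^-1]) (factor_Xn_sub_1 z_prim).
rewrite /= horner_prod hornerD hornerN hornerXn hornerC big_mkord => E.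
have -> : \prod_(j < p) (1 + z ^+ j * al) = \prod_(j < p) ((- al) * (- al^-1 - z ^+ j)).
  by apply: eq_bigr => j _; field.
rewrite big_split prodr_const card_ord /=.
rewrite [X in _ * X](_ : _ = (- al^-1) ^+ p - 1); last first.
  by rewrite -E; apply: eq_bigr => j _; rewrite hornerD hornerN hornerX hornerC.
have oddN (x : Om) : (- x) ^+ p = - x ^+ p.
  by rewrite exprNn -signr_odd p_odd expr1 mulN1r.
rewrite !oddN exprVn; field.
by rewrite expf_neq0.
Qed.

Lemma closed_root (n : nat) (a : Om) : (0 < n)%N -> exists b, b ^+ n = a.
Proof.
move=> n0; have /closed_rootP[b] : size ('X^n - a%:P) != 1%N.
  by rewrite size_XnsubC // -lt0n.
by rewrite rootE hornerD hornerN hornerXn hornerC subr_eq0 => /eqP; exists b.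
Qed.

Variables (K : Om -> Prop) (HK : is_subfield K) (z : Om).
Hypotheses (z_prim : p.-primitive_root z) (K_z : K z).
Local Notation k := (sfpred HK).

Lemma rigid_valued : p_rigid_field p K -> exists O x0, valued p K O x0.
Proof.
move=> rig; pose L : fieldType := sub_of HK.
have VK (u : L) : K (val u) by apply/(sfP HK)/(valP u).
have lift x : K x -> {u : L | val u = x}.
  by move=> Kx; have kx : x \in k by [apply/sfP]; exists (exist _ x kx).
have V0 (u : L) : (val u == 0) = (u == 0) by rewrite -(inj_eq val_inj) rmorph0.
have powE (u : L) : ppow p u <-> is_pow p K (val u).
  split=> [[u0 [c cE]]|[u0 [c [/lift[c' <-] uE]]]].
    by split; [rewrite V0|exists (val c); rewrite cE rmorphXn].
  split; first by rewrite -V0.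
  by exists c'; apply: val_inj; rewrite rmorphXn.
have LR (u : L) : u != 0 -> ~ ppow p u -> exists i, ppow p ((1 + u) / u ^+ i).
  move=> u0 nu; have [al alE] := closed_root (val u) (prime_gt0 p_pr).
  have vu0 : val u != 0 by rewrite V0.
  have nv : ~ exists c, K c /\ val u = c ^+ p.
    by move=> h; apply: nu; apply/powE; split.
  have [|j [c [_ Kc c0 E]]] := rig (val u) (VK u) vu0 nv (1 + val u).
    exists al, z, (1 + 'X); split => //.
    - move=> i; have [K0 K1 _ _] := HK; rewrite coefD coefC coefX.
      by apply/(sfP HK)/rpredD; [case: (i == _)%N | case: (i == _)%N]; rewrite ?rpred1 ?rpred0.
    - rewrite hornerD hornerC hornerX; apply: contra_not_neq nv => E.
      exists (-1); split; first by apply/(sfP HK); rewrite rpredN1.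
      by rewrite -alE; congr (_ ^+ _); apply/eqP; rewrite -addr_eq0 addrC E.
    rewrite -alE -(prod_1addroot _ z_prim); apply: eq_bigr => j _.
    by rewrite hornerD hornerC hornerX.
  exists j; apply/powE; rewrite rmorphM fmorphV rmorphXn rmorphD rmorph1 /= E.
  rewrite mulrC mulKf ?expf_neq0 //; split; first by rewrite expf_neq0.
  by exists c.
have [O [x0 [[x00 ring] O1 tot pw un]]] := rigid_has_valuation_ring p_pr p_odd LR.
pose O' x := exists2 u : L, O u & val u = x.
have O'V (u : L) : O' (val u) <-> O u.
  by split=> [[v hv /val_inj <-]|]; [|exists u].
have V1 : val (1 : L) = 1 by rewrite rmorph1.
exists O', (val x0); split.
- by move=> x [u _ <-].
- split; first by exists 1 => //; rewrite rmorph1.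
  move=> x y [u hu <-] [v hv <-]; have [h1 h2] := ring u v hu hv.
  by split; [exists (u - v); rewrite ?rmorphB | exists (u * v); rewrite ?rmorphM].
- move=> x /lift[u <-]; rewrite V0 => u0; rewrite -fmorphV !O'V; exact: tot.
- move=> x [u hu <-]; rewrite -fmorphV O'V => nu; rewrite -V1 -rmorphD.
  by apply/powE; apply: pw.
- by rewrite V0; split.
move=> x + [u hu xE]; rewrite -xE V0 -fmorphV O'V => u0 huV.
have [j hj] := un u u0 hu huV; exists j; rewrite -rmorphXn -fmorphV -rmorphM.
exact/powE.
Qed.

Lemma adj_sigma al w : K (al ^+ p) -> ~ (exists c, K c /\ al ^+ p = c ^+ p) -> w ^+ p = 1 ->
  exists sg, [/\ ishom (adj K al) sg, forall x, K x -> sg x = x & sg al = w * al].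
Proof.
move=> Ka na w1; apply: (hom_extend HK p_pr Ka na (h := id)) => //.
by rewrite exprMn w1 mul1r.
Qed.

Section Valued.
Variables (O : Om -> Prop) (x0 : Om).
Hypothesis VO : valued p K O x0.

(* Replace the generator by one satisfying the dichotomy of [P4]. *)
Lemma normalize_generator al : K (al ^+ p) -> ~ (exists c, K c /\ al ^+ p = c ^+ p) ->
  exists c i, let b := c * al ^+ i in
  [/\ K c, c != 0, ~~ (p %| i)%N, ~ (exists d, K d /\ b ^+ p = d ^+ p) &
    [/\ K (b ^+ p), adj K b = adj K al & ramified p K O b \/ unramified p O b]].
Proof.
move=> Ka na; have [K0 K1 KBM KV] := HK.
have p1 : ~~ (p %| 1)%N by rewrite dvdn1 neq_ltn prime_gt1 ?orbT.
have [ram|] := pselect (ramified p K O al).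
  exists 1, 1%N; rewrite /= mul1r expr1 oner_neq0; split => //; split => //.
  by left.
move=> /existsNP[c /existsNP[i /not_implyP[Kc /not_implyP[pi /not_implyP[oc nm]]]]].
have [//|[n0 ocV]] := val_maxi VO oc.
have c0 : c != 0 by apply: contraNneq n0 => ->; rewrite mul0r expr0n gtn_eqF ?prime_gt0.
have a0 : al != 0 := radical_neq0 HK na.
have [u [v uv]] : exists u v, (i * u = 1 + p * v)%N.
  move: pi; rewrite -prime_coprime // => /eqP G.
  have i0 : (0 < i)%N by rewrite lt0n; apply: contra_eq_neq G => ->; rewrite gcdn0 gtn_eqF ?prime_gt1.
  have [km kn G' _] := egcdnP p i0.
  by exists km, kn; rewrite mulnC G' gcdnC G addnC mulnC.
have alE : al = (c * al ^+ i) ^+ u / c ^+ u / (al ^+ p) ^+ v.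
  rewrite exprMn -!exprM uv exprD expr1; field.
  by rewrite !expf_neq0.
have inK M (HM : is_subfield M) x : M x -> x \in sfpred HM by move=> h; apply/sfP.
exists c, i; split => //.
  move=> [d [Kd dE]]; apply: na; exists (d ^+ u / c ^+ u / (al ^+ p) ^+ v).
  split.
    by apply/(sfP HK); apply: rpred_div; [apply: rpred_div|]; apply: rpredX; apply: inK.
  rewrite {1}alE !expr_div_n -!exprM [(u * p)%N]mulnC (exprM (c * _)) dE.
  by rewrite -!exprM.
split.
- by apply: (val_sub VO).
- have b_al : adj K al (c * al ^+ i).
    apply/(sfP (adj_subfield K al))/rpredM; first by apply: inK; apply: adj_sub.
    by apply: rpredX; apply: inK; apply: adj_gen.
  have al_b : adj K (c * al ^+ i) al.
    rewrite [X in adj _ _ X]alE; apply/(sfP (adj_subfield K (c * al ^+ i))).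
    by apply: rpred_div; [apply: rpred_div|]; apply: rpredX; apply: inK;
      [apply: adj_gen | apply: adj_sub | apply: adj_sub].
  have mono u' v' : adj K v' u' -> forall x, adj K u' x -> adj K v' x.
    move=> h; apply: gen_min; first exact: adj_subfield.
    by move=> x [Kx|->] //; apply: adj_sub.
  by apply: funext => y; apply: propext; split; apply: mono.
 by right.
Qed.

(** The valuation is extended with the normalized generator [b = c al^i]. Norms return to [al]
    because [b^p = c^p a^i] for [a = al^p], so powers of [b^p] are powers of [a] up to p-th
    powers. *)
Lemma valued_adj al : K (al ^+ p) -> ~ (exists c, K c /\ al ^+ p = c ^+ p) ->
  [/\ exists O' x1, valued p (adj K al) O' x1,
      forall w sg, p.-primitive_root w -> K w -> ishom (adj K al) sg ->
        (forall x, K x -> sg x = x) -> sg al = w * al ->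
        forall x, adj K al x -> x != 0 -> exists j c, [/\ K c, c != 0 & norm p sg x = (al ^+ p) ^+ j * c ^+ p]
    & forall x, adj K al x -> x != 0 -> radical_class p K al x].
Proof.
move=> Ka na; have [c [i [Kc c0 pi nb [Kb adjE ror]]]] := normalize_generator Ka na.
have norms w sg : p.-primitive_root w -> K w -> ishom (adj K al) sg ->
    (forall x, K x -> sg x = x) -> sg al = w * al ->
    forall x, adj K al x -> x != 0 -> exists j c, [/\ K c, c != 0 & norm p sg x = (al ^+ p) ^+ j * c ^+ p].
  move=> w_prim Kw hsg sgK sgal x Ex x'0.
  have wi_prim : p.-primitive_root (w ^+ i).
    by rewrite (prim_root_exp_coprime _ w_prim) coprime_sym prime_coprime.
  have Kwi : K (w ^+ i) by apply/(sfP HK)/rpredX/sfP.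
  have inE y : adj K al y -> y \in sfpred (adj_subfield K al) by move=> h; apply/sfP.
  have sgb : sg (c * al ^+ i) = w ^+ i * (c * al ^+ i).
    have ce : c \in sfpred (adj_subfield K al) by apply: inE; apply: adj_sub.
    have ale : al \in sfpred (adj_subfield K al) by apply: inE; apply: adj_gen.
    have sgX : sg (al ^+ i) = sg al ^+ i by apply: homX hsg _ _ ale.
    by rewrite (homM hsg ce (rpredX i ale)) sgX sgal sgK // exprMn mulrCA.
  rewrite -adjE in hsg Ex.
  have [j [d [Kd d0 ->]]] := rigid_norm HK p_pr p_odd VO Kb wi_prim Kwi nb hsg sgK sgb ror Ex x'0.
  exists (i * j)%N, (c ^+ j * d); split.
  - by apply/(sfP HK)/rpredM; [apply/rpredX/sfP | apply/sfP].
  - by rewrite mulf_neq0 // expf_neq0.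
  rewrite !exprMn -!exprM [(i * (p * j))%N]mulnCA.
  by rewrite [(j * p)%N]mulnC; ring.
split => //.
  have wp i' : (z ^+ i') ^+ p = 1 by rewrite exprAC (prim_expr_order z_prim) expr1n.
  have [sg [hsg sgK sgb]] := adj_sigma Kb nb (prim_expr_order z_prim).
  have [x1 h] := valued_extension HK p_pr p_odd VO Kb z_prim K_z nb hsg sgK sgb ror.
  by rewrite -adjE; eexists; exists x1; apply: h.
have [sg [hsg sgK sgal]] := adj_sigma Ka na (prim_expr_order z_prim).
apply: (radical_classP HK p_pr Ka z_prim K_z na hsg sgK sgal) => x Ex x'0.
have [j [d [Kd d0 E]]] := norms z sg z_prim K_z hsg sgK sgal x Ex x'0.
by exists j, d; split => //; rewrite E (norm_monomial HK p_pr Ka z_prim K_z na hsg sgK sgal).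
Qed.

End Valued.

Lemma valued_rigid O x0 : valued p K O x0 -> p_rigid_field p K.
Proof.
move=> VO a Ka a0 na y [al [w [f [alE w_prim fK fn0 yE]]]].
have Kw : K w.
  have /(prim_rootP z_prim)[i ->] : w ^+ p = 1 := prim_expr_order w_prim.
  exact/(sfP HK)/rpredX/sfP.
have fk : f \is a polyOver k by apply/polyOverP => i; apply/sfP.
have Kal : K (al ^+ p) by rewrite alE.
have nal : ~ exists c, K c /\ al ^+ p = c ^+ p by rewrite alE.
have [sg [hsg sgK sgal]] := adj_sigma Kal nal (prim_expr_order w_prim).
have [_ norms _] := valued_adj VO Kal nal.
have [|j [c [Kc c0 E]]] := norms w sg w_prim Kw hsg sgK sgal f.[al] _ fn0.
  by apply/(adjP HK p_pr Kal nal); exists f.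
rewrite (norm_eval p Kw hsg sgK sgal fk) -yE alE in E.
exists (j %% p)%N, (a ^+ (j %/ p) * c); rewrite ltn_mod prime_gt0 //; split => //.
- by apply/(sfP HK)/rpredM; [apply/rpredX/sfP | apply/sfP].
- by rewrite mulf_neq0 // expf_neq0.
by rewrite E {1}(divn_eq j p) exprD exprMn -exprM; ring.
Qed.

End RigidStep.

Section RigidTower.

Variables (Om : closedFieldType) (p : nat) (K : Om -> Prop) (HK : is_subfield K) (z : Om).
Hypotheses (p_pr : prime p) (p_odd : odd p).
Hypotheses (z_prim : p.-primitive_root z) (K_z : K z).
Hypothesis rig : p_rigid_field p K.

Lemma rigid_adj al : K (al ^+ p) -> ~ (exists c, K c /\ al ^+ p = c ^+ p) ->
  p_rigid_field p (adj K al) /\ forall x, adj K al x -> x != 0 -> radical_class p K al x.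
Proof.
move=> Ka na; have [O [x0 VO]] := rigid_valued p_pr p_odd HK z_prim rig.
have [[O' [x1 VO']] _ cl] := valued_adj p_pr p_odd HK z_prim K_z VO Ka na.
split => //; apply: (valued_rigid p_pr p_odd (adj_subfield K al) z_prim _ VO').
exact: adj_sub.
Qed.

End RigidTower.


(** * Generated subfields and finite generation *)

Section Generation.

Variable Om : closedFieldType.
Implicit Types (S K : Om -> Prop).

Lemma gen_mono S S' : (forall x, S x -> gen S' x) -> forall x, gen S x -> gen S' x.
Proof. by move=> h; apply: gen_min => //; apply: gen_subfield. Qed.

Lemma gen_finite S x : gen S x ->
  exists2 s : seq Om, (forall t, t \in s -> S t) & gen (fun y => y \in s) x.
Proof.
pose W x := exists2 s : seq Om, (forall t, t \in s -> S t) & gen (fun y => y \in s) x.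
suff HW : is_subfield W by move=> h; apply: (h W HW) => y Sy; exists [:: y] => [t|]; [rewrite inE => /eqP -> | apply: gen_sub; rewrite inE].
split.
- by exists [::] => //; have [] := gen_subfield (fun y : Om => y \in [::]).
- by exists [::] => //; have [] := gen_subfield (fun y : Om => y \in [::]).
- move=> u v [s sS su] [s' s'S s'v].
  have u' : gen (fun y => y \in s ++ s') u.
    by apply: gen_mono su => y ys; apply: gen_sub; rewrite mem_cat ys.
  have v' : gen (fun y => y \in s ++ s') v.
    by apply: gen_mono s'v => y ys; apply: gen_sub; rewrite mem_cat ys orbT.
  have [_ _ h _] := gen_subfield (fun y => y \in s ++ s').
  have [h1 h2] := h u v u' v'.
  by split; exists (s ++ s') => // t; rewrite mem_cat => /orP[/sS|/s'S].
by move=> u [s sS su]; exists s => //; have [_ _ _] := gen_subfield (fun y => y \in s); apply.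
Qed.

Lemma gen_id K : is_subfield K -> gen K = K.
Proof.
by move=> HK; apply: funext => x; apply: propext; split; [apply: gen_min | apply: gen_sub].
Qed.

Definition adjs K (s : seq Om) := gen (fun y => K y \/ y \in s).

Lemma adjs_sub K s x : K x -> adjs K s x.
Proof. by move=> Kx; apply: gen_sub; left. Qed.

Lemma adjs_mem K s x : x \in s -> adjs K s x.
Proof. by move=> xs; apply: gen_sub; right. Qed.

Lemma adjs_nil K : is_subfield K -> adjs K [::] = K.
Proof.
move=> HK; apply: funext => x; apply: propext; split; last exact: adjs_sub.
by apply: gen_min => // y [].
Qed.

Lemma adjs_cons K t s : adjs K (t :: s) = adj (adjs K s) t.
Proof.
apply: funext => x; apply: propext; split; apply: gen_mono => y.
  move=> [Ky|]; first by apply: adj_sub; apply: adjs_sub.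
  by rewrite inE => /orP[/eqP ->|ys]; [apply: adj_gen | apply: adj_sub; apply: adjs_mem].
move=> [h|->]; last by apply: adjs_mem; rewrite mem_head.
apply: gen_mono h => u [Ku|us]; first exact: adjs_sub.
by apply: adjs_mem; rewrite inE us orbT.
Qed.

Lemma adj_id K t : is_subfield K -> K t -> adj K t = K.
Proof.
move=> HK Kt; apply: funext => x; apply: propext; split; last exact: adj_sub.
by apply: gen_min => // y [|->].
Qed.

End Generation.

(** * Adjoining all p-th roots: rigidity and spanning classes *)

Section SecondLayer.

Variables (Om : closedFieldType) (p : nat) (K : Om -> Prop) (HK : is_subfield K) (z : Om).
Hypotheses (p_pr : prime p) (p_odd : odd p).
Hypotheses (z_prim : p.-primitive_root z) (K_z : K z).

Lemma root_unique (M : Om -> Prop) (HM : is_subfield M) (Mz : M z) t c :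
  M c -> t ^+ p = c ^+ p -> M t.
Proof.
move=> Mc E; have [c0|c0] := eqVneq c 0.
  move: E; rewrite c0 expr0n gtn_eqF ?prime_gt0 // => /eqP; rewrite expf_eq0 => /andP[_ /eqP ->].
  by case: HM.
have /(prim_rootP z_prim)[j jE] : (t / c) ^+ p = 1.
  by rewrite expr_div_n E divff // expf_neq0.
rewrite -[t](divfK c0) jE.
by apply/(sfP HM)/rpredM; [apply/rpredX/sfP | apply/sfP].
Qed.

Hypothesis rig : p_rigid_field p K.

(** One root at a time: [rigid_adj] splits off a power of the last root [t], and the remaining
    coefficient, in the smaller field, is treated by induction. *)
Lemma rigid_adjs s : (forall t, t \in s -> K (t ^+ p)) ->
  p_rigid_field p (adjs K s) /\
  forall x, adjs K s x -> x != 0 -> exists w y,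
    [/\ K (w ^+ p), adjs K s w, adjs K s y, y != 0 & x = w * y ^+ p].
Proof.
elim: s => [|t s IH] hs.
  rewrite adjs_nil //; split => // x Kx x0; exists x, 1.
  have [_ K1 _ _] := HK; rewrite oner_neq0 expr1n mulr1; split => //.
  by apply/(sfP HK)/rpredX/sfP.
have [|rE dec] := IH; first by move=> u us; apply: hs; rewrite inE us orbT.
have HE : is_subfield (adjs K s) := gen_subfield _.
have Ez : adjs K s z by apply: adjs_sub.
rewrite adjs_cons; have [Et|nt] := pselect (adjs K s t); first by rewrite adj_id.
have Ktp : K (t ^+ p) by apply: hs; rewrite mem_head.
have [||rE' cl] := rigid_adj HE p_pr p_odd z_prim Ez rE (al := t).
- exact: adjs_sub.
- by move=> [c [Ec E]]; apply: nt; apply: root_unique Ec E.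
split => // x Ex x0; have [j [c [y [Ec c0 Ey y0 xE]]]] := cl x Ex x0.
have [w [y1 [Kw Ew Ey1 y10 cE]]] := dec c Ec c0.
have HE' := adj_subfield (adjs K s) t.
exists (t ^+ j * w), (y1 * y); split.
- rewrite exprMn exprAC; apply/(sfP HK)/rpredM; last exact/sfP.
  exact/rpredX/sfP.
- apply/(sfP HE')/rpredM; last by apply/sfP; apply: adj_sub.
  by apply/rpredX/sfP; apply: adj_gen.
- by apply/(sfP HE')/rpredM; apply/sfP => //; apply: adj_sub.
- by rewrite mulf_neq0.
by rewrite xE cE exprMn; ring.
Qed.

Local Notation L := (F2 p K).

Lemma F2_subfield : is_subfield L. Proof. exact: gen_subfield. Qed.

Lemma F2_root x : K (x ^+ p) -> L x.
Proof. by move=> h; apply: gen_sub; right. Qed.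

Lemma F2_sub x : K x -> L x.
Proof. by move=> h; apply: gen_sub; left. Qed.

Lemma adjs_F2 s : (forall t, t \in s -> K (t ^+ p)) -> forall x, adjs K s x -> L x.
Proof. by move=> hs; apply: gen_mono => x [/F2_sub|/hs/F2_root]. Qed.

Lemma F2_finite x : L x -> exists2 s, (forall t, t \in s -> K (t ^+ p)) & adjs K s x.
Proof.
move=> /gen_finite[s sS sx]; exists s.
  by move=> t /sS[Kt|//]; apply/(sfP HK)/rpredX/sfP.
by apply: gen_mono sx => y; apply: adjs_mem.
Qed.

Lemma F2_finite_seq (l : seq Om) : (forall t, t \in l -> L t) ->
  exists2 s, (forall t, t \in s -> K (t ^+ p)) & forall t, t \in l -> adjs K s t.
Proof.
elim: l => [|u l IH] hl; first by exists [::].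
have [|s1 h1 s1l] := IH; first by move=> t tl; apply: hl; rewrite inE tl orbT.
have [s2 h2 s2u] := F2_finite (hl u (mem_head _ _)).
exists (s1 ++ s2) => [t|t].
  by rewrite mem_cat => /orP[/h1|/h2].
rewrite inE => /orP[/eqP ->|/s1l]; [move: s2u|]; apply: gen_mono => y [Ky|ys];
  by [apply: adjs_sub | apply: adjs_mem; rewrite mem_cat ys ?orbT].
Qed.

(** A norm involves only [a] and the finitely many coefficients of [f], so it is already a norm over
    a finite layer, where [rigid_adjs] applies. *)
Lemma F2_rigid : p_rigid_field p L.
Proof.
move=> a La a0 na y [al [w [f [alE w_prim fL fn0 yE]]]].
have [|s hs sl] := @F2_finite_seq (a :: f).
  by move=> t; rewrite inE => /orP[/eqP ->//|/(nthP 0)[i _ <-]].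
have [rE _] := rigid_adjs hs.
have sub := adjs_F2 hs.
have [|||j [c [jp Ec c0 E]]] := rE a _ a0 _ y.
- by apply: sl; rewrite mem_head.
- by move=> [c [Ec cE]]; apply: na; exists c; split => //; apply: sub.
- exists al, w, f; split => // i; have [si|si] := ltnP i (size f).
    by apply: sl; rewrite inE mem_nth ?orbT.
  by rewrite nth_default //; have [] := gen_subfield (fun y => K y \/ y \in s).
by exists j, c; split => //; apply: sub.
Qed.

Lemma F2_class x : L x -> x != 0 -> exists w y,
  [/\ K (w ^+ p), w != 0, L y, y != 0 & x = w * y ^+ p].
Proof.
move=> /F2_finite[s hs sx] x0; have [_ dec] := rigid_adjs hs.
have [w [y [Kw _ Ey y0 xE]]] := dec x sx x0; exists w, y; split => //.
  by apply: contraNneq x0 => w0; rewrite xE w0 mul0r.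
exact: adjs_F2 hs _ Ey.
Qed.

Lemma root_decomposition (I : eqType) (zo : option Om) (g g' : I -> Om) x :
  pspans p K (omap (fun u => u ^+ p) zo) g -> (forall i, g' i ^+ p = g i) ->
  K (x ^+ p) -> x != 0 ->
  exists om e0 (s : seq I) (e : I -> nat) y,
    [/\ om ^+ p = 1, K y, y != 0 & x = om * (oapp (fun w => w ^+ e0) 1 zo * \prod_(i <- s) g' i ^+ e i * y)].
Proof.
move=> [hz hg hspan] hg' Kx x0.
have [e0 [s [e [y [Ky y0 xE]]]]] := hspan _ Kx (expf_neq0 p x0).
pose m := oapp (fun w => w ^+ e0) 1 zo * \prod_(i <- s) g' i ^+ e i * y.
have mp : m ^+ p = x ^+ p.
  rewrite xE /m !exprMn -prodrXl; congr (_ * _ * _).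
    by case: (zo) => [w|] /=; rewrite ?expr1n // exprAC.
  by apply: eq_bigr => i _; rewrite exprAC hg'.
have m0 : m != 0 by have := expf_neq0 p x0; rewrite -mp expf_eq0 prime_gt0.
exists (x / m), e0, s, e, y; split => //; last by rewrite divfK.
by rewrite expr_div_n mp divff // expf_neq0.
Qed.

Lemma F2_spans (I : eqType) (zo : option Om) (g g' : I -> Om) :
  pspans p K (omap (fun u => u ^+ p) zo) g -> (forall i, g' i ^+ p = g i) ->
  pspans p L zo g'.
Proof.
move=> hs hg'; have [hz hg hspan] := hs; split.
- move=> w wE; have [|Kw w0] := hz (w ^+ p); first by rewrite wE.
  by split; [apply: F2_root | move: w0; rewrite expf_eq0 prime_gt0].
- move=> i; have [Kg g0] := hg i; rewrite -hg' in Kg g0.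
  by split; [apply: F2_root | move: g0; rewrite expf_eq0 prime_gt0].
move=> x Lx x0; have [w [y [Kw w0 Ly y0 xE]]] := F2_class Lx x0.
have [om [e0 [s [e [y1 [om1 Ky1 y10 wE]]]]]] := root_decomposition hs hg' Kw w0.
(* [om], a power of [z], and [y1] lie in [K], so both are p-th powers in [L] and are absorbed. *)
have [r rE] := closed_root om (prime_gt0 p_pr).
have [r1 r1E] := closed_root y1 (prime_gt0 p_pr).
have /(prim_rootP z_prim)[j jE] := om1.
exists e0, s, e, (r * r1 * y); split.
- apply/(sfP F2_subfield)/rpredM; last exact/sfP.
  apply: rpredM; apply/sfP; apply: F2_root; rewrite ?r1E // rE jE.
  exact/(sfP HK)/rpredX/sfP.
- rewrite !mulf_neq0 //; last by apply: contraNneq y10 => r10; rewrite -r1E r10 expr0n gtn_eqF ?prime_gt0.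
  apply/eqP => r0; move/eqP: om1; rewrite -rE r0 !expr0n !gtn_eqF ?prime_gt0 //= expr0n.
  by rewrite gtn_eqF ?prime_gt0 // eq_sym oner_eq0.
by rewrite xE wE -r1E -rE !exprMn; ring.
Qed.

End SecondLayer.

(** * Radical extensions that are Galois over F *)

Section FiniteGalois.

Variables (Om : closedFieldType) (p : nat) (F : Om -> Prop) (HF : is_subfield F) (z : Om).
Hypotheses (p_pr : prime p) (z_prim : p.-primitive_root z) (F_z : F z).

(** A finite Galois group in Artin's form. Inverses are not demanded: each map is injective and so
    permutes every finite orbit. *)
Definition fin_galois (M : Om -> Prop) := exists (T : finType) (g : T -> Om -> Om),
  [/\ forall i, ishom M (g i) /\ forall x, M x -> M (g i x),
      forall i x, F x -> g i x = x,
      forall i j, exists l, forall x, M x -> g i (g j x) = g l x,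
      exists i, forall x, M x -> g i x = x
    & forall x, M x -> (forall i, g i x = x) -> F x].

Lemma hom_map_prod M (HM : is_subfield M) h (s : seq Om) : ishom M h -> (forall r, r \in s -> M r) ->
  map_poly h (\prod_(r <- s) ('X - r%:P)) = \prod_(r <- map h s) ('X - r%:P).
Proof.
move=> hh; have Xk r : M r -> 'X - r%:P \is a polyOver (sfpred HM).
  by move=> Mr; apply: rpredB; [apply: polyOverX | rewrite polyOverC; apply/sfP].
elim: s => [|r s IH] hs.
  by rewrite !big_nil (hom_map_polyC HM hh) (hom1 hh).
have Mr : M r by apply: hs; rewrite mem_head.
have hs' u : u \in s -> M u by move=> us; apply: hs; rewrite inE us orbT.
rewrite !big_cons (hom_map_polyM (HK := HM) hh) ?IH //; last 2 first.
- exact: Xk.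
- rewrite big_seq; apply: rpred_prod => u us; apply: Xk; exact: hs'.
rewrite (hom_map_polyB (HK := HM) hh) ?polyOverX //; last by rewrite polyOverC; apply/sfP.
by rewrite -['X]expr1 (hom_map_polyXn HM hh) (hom_map_polyC HM hh).
Qed.

(** The polynomial whose roots are the distinct elements of the orbit of [y] is fixed by every map
    of the group, so its coefficients lie in [F]. *)
Lemma fin_galois_over M : is_subfield M -> fin_galois M -> galois_over M F.
Proof.
move=> HM [T [g [gM gF gcomp [i0 gid] gfix]]] y My.
pose s := undup [seq g i y | i <- enum T].
have sM r : r \in s -> M r.
  by rewrite mem_undup => /mapP[i _ ->]; apply: (gM i).2.
exists s; split => //.
- exact: undup_uniq.
- by rewrite mem_undup; apply/mapP; exists i0; rewrite ?mem_enum // gid.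
move=> n; apply: gfix.
  suff /polyOverP/(_ n)/sfP : \prod_(r <- s) ('X - r%:P) \is a polyOver (sfpred HM) by [].
  rewrite big_seq; apply: rpred_prod => r /sM Mr.
  by apply: rpredB; [apply: polyOverX | rewrite polyOverC; apply/sfP].
move=> i; have [hh _] := gM i; rewrite -(coef_map_id0 _ _ (hom0 HM hh)) (hom_map_prod HM hh sM).
have inj : {in s &, injective (g i)}.
  by move=> u v /sM Mu /sM Mv; apply: (hom_inj (HK := HM) hh); apply/sfP.
have sub : {subset map (g i) s <= s}.
  move=> _ /mapP[r + ->]; rewrite mem_undup => /mapP[j _ ->].
  have [l ->//] := gcomp i j; by rewrite mem_undup; apply/mapP; exists l; rewrite ?mem_enum.
have us : uniq (map (g i) s) by rewrite map_inj_in_uniq // undup_uniq.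
have [|_ eqs] := uniq_min_size us sub; first by rewrite size_map.
have perm : perm_eq (map (g i) s) s by apply: uniq_perm => //; rewrite undup_uniq.
by rewrite (perm_big _ perm).
Qed.

Lemma hom_adj_eq (M : Om -> Prop) x h h' (HM : is_subfield M) : M (x ^+ p) -> ~ (exists c, M c /\ x ^+ p = c ^+ p) ->
  ishom (adj M x) h -> ishom (adj M x) h' -> (forall y, M y -> h y = h' y) -> h x = h' x ->
  forall y, adj M x y -> h y = h' y.
Proof.
move=> Mx nx hh hh' hM hx y /(adjP HM p_pr Mx nx)[f fk ->].
have HE := adj_subfield M x.
have fe : f \is a polyOver (sfpred HE).
  by apply: polyOverS fk => u /sfP Mu; apply/sfP; apply: adj_sub.
have xe : x \in sfpred HE by apply/sfP; apply: adj_gen.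
rewrite (hom_horner hh fe xe) (hom_horner hh' fe xe) hx; congr horner.
apply/polyP => i; rewrite !coef_map_id0 ?(hom0 HE hh) ?(hom0 HE hh') //.
by apply: hM; apply/(sfP HM)/(polyOverP fk).
Qed.

Lemma fin_galois_step M x l : is_subfield M -> (forall y, F y -> M y) -> fin_galois M ->
  M (x ^+ p) -> F (x ^+ (p ^ l.+1)) -> (forall w, w ^+ (p ^ l.+1) = 1 -> adj M x w) ->
  fin_galois (adj M x).
Proof.
move=> HM FM galM Mx Fx muE; have [Mx'|nMx] := pselect (M x).
  by rewrite adj_id.
have Mz := FM z F_z; have p0 := prime_gt0 p_pr.
have nx : ~ exists c, M c /\ x ^+ p = c ^+ p.
  by move=> [c [Mc E]]; apply: nMx; apply: (root_unique p_pr z_prim HM Mz Mc E).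
have x0 : x != 0 by apply/eqP => x0; apply: nMx; rewrite x0; case: HM.
have xp0 : x ^+ p != 0 by rewrite expf_neq0.
have HE := adj_subfield M x.
have Ex : adj M x x by apply: adj_gen.
have ME y : M y -> adj M x y by apply: adj_sub.
have [T [g [gM gF gcomp [i0 gid] gfix]]] := galM.
have MkP y : M y -> y \in sfpred HM by move=> h; apply/sfP.
(* Since [x^(p^(l+1))] is in [F], the quotient [g i (x^p) / x^p] is a [p^l]-th root of unity; its
   p-th root [w] lies in [M(x)] by [muE], and [b = w x]. Each [g i] then extends in [p] ways, by [x]
   to [z^j b_i]. *)
have rootex i : exists b, adj M x b /\ b ^+ p = g i (x ^+ p).
  have [hh _] := gM i; have [w wE] := closed_root (g i (x ^+ p) / x ^+ p) p0.
  exists (w * x); split; last by rewrite exprMn wE divfK.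
  apply/(sfP HE)/rpredM; last exact/sfP.
  apply/sfP; apply: muE; rewrite expnS exprM wE expr_div_n.
  rewrite -(homX (HK := HM) hh) ?MkP // -exprM -expnS gF // divff //.
  by rewrite expf_neq0.
have [b bP] := choice rootex.
have b0 i : b i != 0.
  have [_ bE] := bP i; have [hh _] := gM i.
  have : g i (x ^+ p) != 0 by rewrite (hom_eq0 (HK := HM) hh) ?MkP.
  by apply: contraNneq => b0; rewrite -bE b0 expr0n gtn_eqF.
have zp j : (z ^+ j) ^+ p = 1 by rewrite exprAC (prim_expr_order z_prim) expr1n.
have ext (ij : T * 'I_p) : exists h, [/\ ishom (adj M x) h, forall y, M y -> h y = g ij.1 y &
    h x = z ^+ ij.2 * b ij.1].
  apply: (hom_extend HM p_pr Mx nx (gM ij.1).1).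
  by rewrite exprMn zp mul1r; case: (bP ij.1).
have {ext} [h hP] := choice ext.
have pick_root u v : u ^+ p = v ^+ p -> v != 0 -> exists j : 'I_p, u = z ^+ j * v.
  move=> E v0; have /(prim_rootP z_prim)[j jE] : (u / v) ^+ p = 1.
    by rewrite expr_div_n E divff // expf_neq0.
  by exists j; rewrite -jE divfK.
have hE ij y : adj M x y -> adj M x (h ij y).
  have [hh hM hx] := hP ij; move=> /(adjP HM p_pr Mx nx)[f fk ->].
  have fe : f \is a polyOver (sfpred HE).
    by apply: polyOverS fk => u /sfP Mu; apply/sfP; apply: ME.
  have xe : x \in sfpred HE by apply/sfP.
  rewrite (hom_horner hh fe xe) hx; apply/(sfP HE).
  apply: (@polyOver_eval _ (sfpred HE)); first by move=> u v; apply: rpredM.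
    apply: rpredM; first by apply: rpredX; apply/sfP; apply: ME.
    by apply/sfP; case: (bP ij.1).
  apply/polyOverP => i; rewrite coef_map_id0 ?(hom0 HE hh) //.
  have Mfi : M f`_i by apply/(sfP HM)/(polyOverP fk).
  by apply/sfP; rewrite hM //; apply: ME; apply: (gM ij.1).2.
have hid : exists i, forall y, adj M x y -> h i y = y.
  have [|j jE] := @pick_root x (b i0) _ (b0 i0).
    by have [_ ->] := bP i0; rewrite gid.
  exists (i0, j); have [hh hM hx] := hP (i0, j).
  have hom_id : ishom (adj M x) id by split.
  by apply: (hom_adj_eq HM Mx nx hh hom_id) => [y My|]; [rewrite hM // gid | rewrite hx -jE].
exists (T * 'I_p)%type, h; split => //.
- by move=> ij; have [hh _ _] := hP ij; split => // y; apply: hE.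
- by move=> ij y Fy; have [_ hM _] := hP ij; rewrite hM ?gF //; apply: FM.
- move=> i j; have [m mE] := gcomp i.1 j.1.
  have [hi hiM hix] := hP i; have [hj hjM hjx] := hP j.
  have Mgj y : M y -> M (g j.1 y) by apply: (gM j.1).2.
  have compE : ishom (adj M x) (fun y => h i (h j y)).
    split; first by rewrite (hom1 hj) (hom1 hi).
    move=> u v Eu Ev; have [-> ->] := hj.2 u v Eu Ev.
    exact: hi.2 _ _ (hE j u Eu) (hE j v Ev).
  have [|q qE] := @pick_root (h i (h j x)) (b m) _ (b0 m).
    have [_ ->] := bP m.
    rewrite -(homX (HK := HE) hi); last by apply/sfP; apply: hE.
    rewrite -(homX (HK := HE) hj); last by apply/sfP.
    by rewrite hjM // hiM ?mE //; apply: Mgj.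
  exists (m, q) => y Ey; have [hl hlM hlx] := hP (m, q).
  apply: (hom_adj_eq HM Mx nx compE hl) => // [u Mu|].
    by rewrite hlM // hjM // hiM ?mE //; apply: Mgj.
  by rewrite hlx.
(* The extension of the identity sending [x] to [z x] fixes [y], so [y] is in [M], where the fixed
   field is known. *)
move=> y Ey hfix; have My : M y.
  have [|j jE] := @pick_root (z * x) (b i0) _ (b0 i0).
    by have [_ ->] := bP i0; rewrite gid // exprMn (prim_expr_order z_prim) mul1r.
  have [hh hM hx] := hP (i0, j).
  apply: (sg_fixed HM p_pr Mx z_prim Mz nx hh _ _ Ey (hfix _)) => [u Mu|].
    by rewrite hM // gid.
  by rewrite hx -jE.
apply: gfix => // i; have [_ hM _] := hP (i, Ordinal p0).
by rewrite -hM.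
Qed.

Variable zeta : nat -> Om.
Hypothesis zetaP : forall l, (p ^ l)%N.-primitive_root (zeta l) /\ zeta l.+1 ^+ p = zeta l.

Lemma zetaX m n : zeta (m + n) ^+ (p ^ n) = zeta m.
Proof.
elim: n => [|n IH]; first by rewrite addn0 expr1.
by rewrite addnS expnS exprM (zetaP (m + n)).2.
Qed.

Section Tower.

Variable B : Om -> Prop.
Hypotheses (HB : is_subfield B) (FB : forall x, F x -> B x).

Definition good_layer M := [/\ is_subfield M, forall x, F x -> M x, forall x, M x -> B x & fin_galois M].

Lemma good_step M x l : good_layer M -> B x -> M (x ^+ p) -> F (x ^+ (p ^ l.+1)) ->
  (forall w, w ^+ (p ^ l.+1) = 1 -> adj M x w) -> good_layer (adj M x).
Proof.
move=> [HM FM MB gM] Bx Mx Fx mu; split.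
- exact: adj_subfield.
- by move=> y /FM; apply: adj_sub.
- by apply: gen_min => // y [/MB|->].
exact: fin_galois_step gM Mx Fx mu.
Qed.

Lemma mu_in M N w : is_subfield M -> M (zeta N) -> w ^+ (p ^ N) = 1 -> M w.
Proof.
move=> HM Mz /(prim_rootP (zetaP N).1)[i ->].
exact/(sfP HM)/rpredX/sfP.
Qed.

Lemma good_zeta N : B (zeta N) -> exists2 M, good_layer M & M (zeta N).
Proof.
elim: N => [|N IH] BN.
  exists F; last first.
    by have := (zetaP 0).1; rewrite expn0 => /prim_expr_order; rewrite expr1 => ->; case: HF.
  by split => //; exists unit, (fun _ => id); split => //; exists tt.
have [|M gM MN] := IH.
  by rewrite -(zetaP N).2; apply/(sfP HB)/rpredX/sfP.
exists (adj M (zeta N.+1)); last exact: adj_gen.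
apply: (good_step (l := N)) => //.
- by rewrite (zetaP N).2.
- by rewrite (prim_expr_order (zetaP N.+1).1); case: HF.
move=> w; apply: mu_in; first exact: adj_subfield.
exact: adj_gen.
Qed.

(** The roots of unity come first; then for each [t] one climbs through [t^(p^N)], [t^(p^(N-1))],
    ..., [t], each a p-th root of the one before, so that [good_step] applies throughout. *)
Lemma good_seq N (s : seq Om) : B (zeta N) -> (forall t, t \in s -> B t /\ F (t ^+ (p ^ N))) ->
  exists2 M, good_layer M & forall t, t \in s -> M t.
Proof.
move=> BN hs; suff [M gM [_ Ms]] : exists2 M, good_layer M & M (zeta N) /\ forall t, t \in s -> M t.
  by exists M.
elim: s hs => [|t s IH] hs; first by have [M] := good_zeta BN; exists M.
have [|M gM [MN Ms]] := IH; first by move=> u us; apply: hs; rewrite inE us orbT.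
have [Bt Ft] := hs t (mem_head _ _).
have climb m : (m <= N)%N -> exists2 M', good_layer M' &
    (forall u, M u -> M' u) /\ M' (t ^+ (p ^ (N - m))).
  elim: m => [_|m IHm mN].
    by exists M => //; split => //; rewrite subn0; have [_ FM _ _] := gM; apply: FM.
  have [|M' gM' [MM' M't]] := IHm; first exact: ltnW.
  have HM' : is_subfield M' by case: gM'.
  exists (adj M' (t ^+ (p ^ (N - m.+1)))); last first.
    by split; [move=> u /MM'; apply: adj_sub | apply: adj_gen].
  have E : (p ^ (N - m.+1) * p = p ^ (N - m))%N by rewrite -expnSr; congr expn; lia.
  apply: (good_step (l := m)) => //.
  - by apply/(sfP HB)/rpredX/sfP.
  - by rewrite -exprM E.
  - by rewrite -exprM -expnD subnK.
  move=> w w1; apply: adj_sub; apply: MM'; apply: (mu_in (N := N)) => //; first by case: gM.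
  by rewrite -(subnK mN) expnD mulnC exprM w1 expr1n.
have [M' gM' [MM' M't]] := climb N (leqnn N).
exists M' => //; split; first exact: MM'.
by move=> u; rewrite inE => /orP[/eqP ->|/Ms/MM'//]; move: M't; rewrite subnn expr1.
Qed.

Lemma galois_radical N (S : Om -> Prop) : B (zeta N) ->
  (forall t, S t -> B t /\ F (t ^+ (p ^ N))) -> (forall x, B x -> gen S x) -> galois_over B F.
Proof.
move=> BN hS BS y /BS/gen_finite[s sS sy].
have [|M gM Ms] := @good_seq N s BN; first by move=> t /sS/hS.
have [HM FM MB galM] := gM; have My : M y by apply: (gen_min HM Ms).
have [s' [h1 h2 h3 h4]] := fin_galois_over HM galM My.
by exists s'; split => // r /h1/MB.
Qed.

End Tower.

End FiniteGalois.

(** * Induction along the tower *)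

Theorem theorem4p7 (Om : closedFieldType) (p : nat) (F : Om -> Prop)
    (k : option nat) (zeta : nat -> Om) (I : eqType) (a : I -> Om) :
  prime p -> odd p ->
  is_subfield F ->
  (exists z, F z /\ p.-primitive_root z) ->
  p_rigid_field p F ->
  is_k p F k ->
  (forall l : nat, (p ^ l)%N.-primitive_root (zeta l) /\ zeta l.+1 ^+ p = zeta l) ->
  pbasis p F (omap zeta k) a ->
  forall n : nat, (1 <= n)%N ->
  forall b : I -> Om, (forall i, b i ^+ (p ^ n.-1) = a i) ->
  pspans p (Fn p F n) (omap (fun h => zeta (h + n.-1)%N) k) b.
Proof.
move=> p_pr p_odd HF [z [F_z z_prim]] rig _ zetaP [spF _].
pose Rad m := gen (fun t : Om => F (t ^+ (p ^ m))).
have FP x : F x -> x \in sfpred HF by move=> h; apply/sfP.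
have p0 := prime_gt0 p_pr.
have FX x m : F x -> F (x ^+ m) by move=> Fx; apply/(sfP HF)/rpredX/sfP.
have zeta1 : F (zeta 1%N).
  have := (zetaP 1%N).1; rewrite expn1 => /prim_expr_order /(prim_rootP z_prim)[i ->].
  exact: FX.
have zetaX := zetaX zetaP.
have FnS n : Fn p F n.+3 = Fstep p F (Fn p F n.+2).
  by rewrite /Fn /= !subn2 /=.
(* Besides the spanning classes, the induction carries rigidity, needed for the next layer, and the
   description by [p^n]-th roots over [F], needed for the Galois condition. *)
have main n : [/\ is_subfield (Fn p F n.+1), Fn p F n.+1 = Rad n, p_rigid_field p (Fn p F n.+1) &
    forall b : I -> Om, (forall i, b i ^+ (p ^ n) = a i) ->
      pspans p (Fn p F n.+1) (omap (fun h => zeta (h + n)%N) k) b].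
  elim: n => [|n [HL LE rL spL]].
    split => //.
    - by rewrite /Rad (_ : (fun t => _) = F) ?gen_id //; apply: funext => t; rewrite expr1.
    - move=> b bE; rewrite (_ : b = a); last by apply: funext => i; rewrite -bE expr1.
      by move: spF; case: (k) => [h|] //=; rewrite addn0.
  set L := Fn p F n.+1 in HL LE rL spL *.
  have FL x : F x -> L x by rewrite LE => Fx; apply: gen_sub; apply: FX.
  have Lz := FL z F_z.
  pose zo := omap (fun h => zeta (h + n.+1)%N) k.
  have zoE : omap (fun u => u ^+ p) zo = omap (fun h => zeta (h + n)%N) k.
    by rewrite /zo; case: (k) => [h|] //=; rewrite addnS (zetaP (h + n)%N).2.
  have Lzeta : L (zeta n.+1).
    by rewrite LE; apply: gen_sub; rewrite -[n.+1]add1n zetaX.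
  have bex i : exists b, b ^+ (p ^ n) = a i by apply: closed_root; rewrite expn_gt0 p0.
  have [b bE] := choice bex.
  have b'ex i : exists b', b' ^+ p = b i by apply: closed_root.
  have [b' b'E] := choice b'ex.
  have spb : pspans p L (omap (fun u => u ^+ p) zo) b by rewrite zoE; apply: spL.
  (* The key inclusion: [F2 p L] is generated by [L] and radicals over [F]. *)
  have key (X : Om -> Prop) : is_subfield X -> (forall x, L x -> X x) ->
      (forall x, x != 0 -> L (x ^+ p) -> F (x ^+ (p ^ n.+1)) -> X x) ->
      forall x, F2 p L x -> X x.
    move=> HX LX radX; apply: gen_min => // x Lx.
    have {}Lx : L (x ^+ p) by case: Lx => // h; apply/(sfP HL)/rpredX/sfP.
    have [->|x0] := eqVneq x 0; first by case: HX.
    have [om [e0 [s [e [y [om1 Ly y0 ->]]]]]] :=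
      root_decomposition p_pr spb b'E Lx x0.
    have XP u : X u -> u \in sfpred HX by move=> h; apply/sfP.
    have /(prim_rootP z_prim)[j ->] := om1.
    have [_ hb _] := spb; have [_ ha _] := spF.
    apply/(sfP HX); apply: rpredM; first by apply/rpredX/XP/LX.
    apply: rpredM; last exact/XP/LX.
    apply: rpredM.
      have := spb; rewrite /zo; case kE : (k) => [h|] /=; last by rewrite rpred1.
      move=> [hz _ _]; have [Lzp zp0] := hz _ erefl.
      apply/rpredX/XP/radX => //.
        by move: zp0; rewrite expf_eq0 p0.
      by rewrite zetaX; move: spF; rewrite kE /= => -[/(_ _ erefl)[]].
    apply: rpred_prod => i _; apply/rpredX/XP/radX.
    - by have [_] := hb i; rewrite -b'E expf_eq0 p0.
    - by rewrite b'E; have [] := hb i.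
    by rewrite expnS exprM b'E bE; have [] := ha i.
  have LF2 : Fn p F n.+2 = F2 p L.
    rewrite /L; case: n @L HL LE rL spL FL Lz zo zoE Lzeta b bex bE b'ex b' b'E spb key
      => [//|n] L HL LE rL spL FL Lz zo zoE Lzeta b bex bE b'ex b' b'E spb key.
    rewrite FnS -/L; apply: funext => x; apply: propext; split.
      by apply: gen_mono => y [Ly|[Ly _ _]]; apply: gen_sub; [left | right].
    apply: key; first exact: gen_subfield.
      by move=> y Ly; apply: gen_sub; left.
    move=> y y0 Ly Fy; apply: gen_sub; right; split => //.
    have HB := adj_subfield L y.
    have LB u : L u -> adj L y u by apply: adj_sub.
    apply: (@galois_radical Om p F HF z p_pr z_prim F_z zeta zetaP (adj L y) HB _ n.+2
       (fun t => adj L y t /\ F (t ^+ (p ^ n.+2)))) => //.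
    - by move=> u /FL/LB.
    - exact: LB.
    apply: gen_mono => u [|->]; last by apply: gen_sub; split => //; apply: adj_gen.
    move=> Lu; have h : Rad n.+1 u by rewrite -LE.
    apply: (gen_mono _ h) => t Ft; apply: gen_sub; split.
      by apply: LB; have : Rad n.+1 t by [apply: gen_sub]; rewrite -LE.
    by rewrite expnSr exprM; apply: FX.
  rewrite LF2; split.
  - exact: gen_subfield.
  - apply: funext => x; apply: propext; split.
      apply: key; first exact: gen_subfield.
        rewrite LE; apply: gen_mono => t Ft; apply: gen_sub.
        by rewrite expnSr exprM; apply: FX.
      by move=> y _ _ Fy; apply: gen_sub.
    apply: gen_mono => t Ft; apply: gen_sub; right; rewrite LE; apply: gen_sub.
    by rewrite -exprM -expnS.
  - exact (F2_rigid HL p_pr p_odd z_prim Lz rL).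
  (* For any choice [c] of roots at the new level, the [c i ^+ p] are a choice at the old level,
     where the induction hypothesis covers all choices. *)
  move=> c cE; apply: (F2_spans HL p_pr p_odd z_prim Lz rL (g := fun i => c i ^+ p)) => //.
  by rewrite zoE; apply: spL => i; rewrite -exprM -expnS.
case=> // n _ b bE; have [_ _ _ sp] := main n.
exact: sp.
Qed.
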